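(* Let $|\gamma|<1$, assume $\mu$ is not normalized Lebesgue measure, let $f\in L^2(\mu)$, and let $(g_1,g_2)=\Phi_\gamma^*f$, $g_+:=g_1\in H^2$ (identified with its analytic extension to $\mathbb D$), $g_-:=\overline{\theta_\gamma}g_1+\Delta_\gamma g_2$. Then: (1) the non-tangential boundary values of $z\mapsto\frac{1-\overline\gamma}{(1-|\gamma|^2)^{1/2}}g_+(z)$, $z\in\mathbb D$, exist and equal $f_{\mathrm s}$ for $\mu_{\mathrm s}$-a.e. point of $\mathbb T$; (2) Lebesgue-a.e. on $\mathbb T$, $$(1-|\gamma|^2)^{1/2}\,w\,f_{\mathrm a}=\frac{1-\overline\gamma\theta_0}{1-\theta_0}\,g_++\frac{1-\gamma\overline{\theta_0}}{1-\overline{\theta_0}}\,g_-.$$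
   Context: $\mathbb T=\{|z|=1\}$ with normalized Lebesgue measure $m$. Let $\mu$ be a Borel probability measure on $\mathbb T$ with Lebesgue decomposition $\mu=\mu_{\mathrm a}+\mu_{\mathrm s}$, $\mu_{\mathrm a}=w\,m$; for $f\in L^2(\mu)$, $f_{\mathrm a}=d(f\mu)_{\mathrm a}/d\mu_{\mathrm a}$ and $f_{\mathrm s}=d(f\mu)_{\mathrm s}/d\mu_{\mathrm s}$. $U=M_\xi$ on $L^2(\mu)$, $b=\mathbf 1$, $b_1(\xi)=\overline\xi$, $U_\gamma=U+(\gamma-1)(\,\cdot\,,b_1)_{L^2(\mu)}b$. For $\lambda\in\mathbb D$, $R_2\mu(\lambda)=\int\frac{1+\overline\xi\lambda}{1-\overline\xi\lambda}d\mu(\xi)$, $\theta_\gamma=\frac{(1-\gamma)R_2\mu-(1+\gamma)}{(1-\overline\gamma)R_2\mu+(1+\overline\gamma)}$ (so $\theta_0=\frac{R_2\mu-1}{R_2\mu+1}$); boundary values on $\mathbb T$ have the same names; $\Delta_\gamma=(1-|\theta_\gamma|^2)^{1/2}$. Model space $\mathcal K_\theta=(H^2\oplus\operatorname{clos}\Delta L^2)\ominus\{(\theta h,\Delta h):h\in H^2\}$, model operator $\mathcal M_\theta=P_{\mathcal K_\theta}M_z|_{\mathcal K_\theta}$. Defect vectors $c^\gamma(z)=(1-|\theta_\gamma(0)|^2)^{-1/2}(1-\overline{\theta_\gamma(0)}\theta_\gamma(z),-\overline{\theta_\gamma(0)}\Delta_\gamma(z))^T$, $c_1^\gamma(z)=(1-|\theta_\gamma(0)|^2)^{-1/2}(z^{-1}(\theta_\gamma(z)-\theta_\gamma(0)),z^{-1}\Delta_\gamma(z))^T$.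 $\Phi_\gamma:\mathcal K_{\theta_\gamma}\to L^2(\mu)$ is the unitary operator (Clark operator) with $\Phi_\gamma\mathcal M_{\theta_\gamma}=U_\gamma\Phi_\gamma$, $\Phi_\gamma c^\gamma=b$, $\Phi_\gamma c_1^\gamma=b_1$, and $\Phi_\gamma^*$ its adjoint. *)

(* Defs.v *)
(* MathComp + MathComp-Analysis, over Stdlib's concrete reals
   (a realType / rcfType via Rstruct) and C := R[i] (mathcomp-real-closed). *)
From HB Require Import structures.
From mathcomp Require Import all_boot all_order all_algebra.
From mathcomp Require Import all_classical all_reals all_analysis.
From mathcomp Require Import Rstruct Rstruct_topology.
From mathcomp Require Import complex.
Set Implicit Arguments. Unset Strict Implicit. Unset Printing Implicit Defensive.
Import Order.TTheory GRing.Theory Num.Theory.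
Import numFieldTopology.Exports numFieldNormedType.Exports.
Local Open Scope classical_set_scope.
Local Open Scope ring_scope.

(* Stdlib's reals, seen through their realType structure *)
Definition RR : realType := Rdefinitions.R.
Notation CC := (RR[i]).
(* the usual (norm) topology on C *)
HB.instance Definition _ := PseudoPointedMetric.copy CC CC^o.
(* domain of functions on T (via the parametrisation t |-> e t), with the
   Borel sigma-algebra used by Lebesgue measure *)
Notation MR := (measurableTypeR RR).

(* The circle T is parametrised by t in [0,1) via t |-> e t = exp(2 pi i t).
   Normalised Lebesgue measure m on T is Lebesgue measure on [0,1). *)
Definition I0 : set MR := `[0%R, 1%R[%classic.
Definition leb := (@lebesgue_measure RR).
Definition ee (t : RR) : CC :=
  (cos (2 * pi * t))%:C%C + 'i%C * (sin (2 * pi * t))%:C%C.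

(* measurability and integrals of complex-valued functions on [0,1) *)
Definition cmeas (F : MR -> CC) : Prop :=
  measurable_fun I0 (fun x => complex.Re (F x)) /\ measurable_fun I0 (fun x => complex.Im (F x)).

Definition cint (mu : {measure set MR -> \bar RR}) (D : set RR) (F : MR -> CC) : CC :=
  (Rintegral mu D (fun x => complex.Re (F x)))%:C%C
  + 'i%C * (Rintegral mu D (fun x => complex.Im (F x)))%:C%C.

Definition sqn (z : CC) : RR := complex.Re z ^+ 2 + complex.Im z ^+ 2.

(* square-integrable complex functions on T w.r.t. mu *)
Definition L2 (mu : {measure set MR -> \bar RR}) (F : MR -> CC) : Prop :=
  cmeas F /\ mu.-integrable I0 (fun x => (sqn (F x))%:E).

(* L^2(mu) inner product and norm *)
Definition ip (mu : {measure set MR -> \bar RR}) (F G : MR -> CC) : CC :=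
  cint mu I0 (fun x => F x * (G x)^*).
Definition nrm (mu : {measure set MR -> \bar RR}) (F : MR -> CC) : RR :=
  Num.sqrt (Rintegral mu I0 (fun x => sqn (F x))).

(* equality mu-a.e. on T *)
Definition aeq (mu : {measure set MR -> \bar RR}) (F G : MR -> CC) : Prop :=
  {ae mu, forall x, I0 x -> F x = G x}.

(* Fourier coefficients and the Hardy space H^2 (as boundary functions) *)
Definition fcoef (G : MR -> CC) (n : int) : CC :=
  cint leb I0 (fun x : MR => G x * (ee x) ^ (- n)).
Definition H2 (G : MR -> CC) : Prop :=
  L2 leb G /\ forall n : int, (n < 0)%R -> fcoef G n = 0.

(* analytic extension of an H^2 function to the disc (Cauchy integral) *)
Definition hext (G : MR -> CC) (z : CC) : CC :=
  cint leb I0 (fun x => G x / (1 - z * (ee x)^*)).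

(* radial boundary value of a function on the disc at e(t) *)
Definition bval (F : CC -> CC) (t : RR) : CC :=
  lim (F (r%:C%C * ee t) @[r --> (1 : RR)^'-]).

(* non-tangential limit of F at the boundary point zeta equals L *)
Definition ntlim (F : CC -> CC) (zeta L : CC) : Prop :=
  forall alpha : RR, 1 < alpha -> forall eps : RR, 0 < eps ->
  exists2 delta : RR, 0 < delta &
    forall z : CC, `|z| < 1 -> `|zeta - z| < delta%:C%C ->
      `|zeta - z| < alpha%:C%C * (1 - `|z|) -> `|F z - L| < eps%:C%C.

(* Herglotz-type transform R_2 mu on the disc *)
Definition R2 (mu : {measure set MR -> \bar RR}) (l : CC) : CC :=
  cint mu I0 (fun x => (1 + (ee x)^* * l) / (1 - (ee x)^* * l)).

(* theta_gamma on the disc *)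
Definition theta (mu : {measure set MR -> \bar RR}) (g : CC) (l : CC) : CC :=
  ((1 - g) * R2 mu l - (1 + g)) / ((1 - g^*) * R2 mu l + (1 + g^*)).

(* boundary values of theta_gamma and Delta_gamma on T *)
Definition thetab mu g (t : RR) : CC := bval (theta mu g) t.
Definition Deltab mu g (t : RR) : CC :=
  (Num.sqrt (1 - sqn (thetab mu g t)))%:C%C.

(* pairs of functions : elements of L^2(m) (+) L^2(m) *)
Definition pip (u v : (MR -> CC) * (MR -> CC)) : CC :=
  ip leb u.1 v.1 + ip leb u.2 v.2.

(* closure of Delta L^2 in L^2(m) *)
Definition closDL2 (D : MR -> CC) (G : MR -> CC) : Prop :=
  L2 leb G /\ forall eps : RR, 0 < eps -> exists2 h : MR -> CC, L2 leb h &
    nrm leb (fun x => G x - D x * h x) < eps.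

(* the model space K_theta, theta with boundary values th, Delta = D *)
Definition Kmodel (th D : MR -> CC) (u : (MR -> CC) * (MR -> CC)) : Prop :=
  H2 u.1 /\ closDL2 D u.2 /\
  forall h, H2 h -> pip u (fun x => th x * h x, fun x => D x * h x) = 0.

(* multiplication by z on pairs *)
Definition mulz (u : (MR -> CC) * (MR -> CC)) : (MR -> CC) * (MR -> CC) :=
  (fun x => ee x * u.1 x, fun x => ee x * u.2 x).

(* the rank-one perturbation U_gamma on L^2(mu), b = 1, b1 = conj xi *)
Definition bb1 (x : RR) : CC := (ee x)^*.
Definition Ug mu (g : CC) (F : MR -> CC) : MR -> CC :=
  fun x => ee x * F x + (g - 1) * ip mu F bb1.

(* defect vectors c^gamma and c_1^gamma *)
Definition cg mu g : (MR -> CC) * (MR -> CC) :=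
  let t0 := theta mu g 0 in
  let k := ((Num.sqrt (1 - sqn t0))^-1)%:C%C in
  (fun x => k * (1 - t0^* * thetab mu g x),
   fun x => k * (- t0^* * Deltab mu g x)).
Definition c1g mu g : (MR -> CC) * (MR -> CC) :=
  let t0 := theta mu g 0 in
  let k := ((Num.sqrt (1 - sqn t0))^-1)%:C%C in
  (fun x => k * ((ee x)^-1 * (thetab mu g x - t0)),
   fun x => k * ((ee x)^-1 * Deltab mu g x)).

(* Phi is the Clark operator Phi_gamma : K_{theta_gamma} -> L^2(mu)
   (acting on representatives; equalities in L^2(mu) are mu-a.e.) *)
Definition IsClark mu (g : CC) (Phi : (MR -> CC) * (MR -> CC) -> (MR -> CC)) : Prop :=
  let K := Kmodel (thetab mu g) (Deltab mu g) in
  (* maps K into L^2(mu) *)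
  (forall u, K u -> L2 mu (Phi u)) /\
  (* linear *)
  (forall u v (a : CC), K u -> K v ->
     aeq mu (Phi (fun x => a * u.1 x + v.1 x, fun x => a * u.2 x + v.2 x))
            (fun x => a * Phi u x + Phi v x)) /\
  (* isometric *)
  (forall u, K u -> ip mu (Phi u) (Phi u) = pip u u) /\
  (* onto L^2(mu) *)
  (forall F, L2 mu F -> exists2 u, K u & aeq mu (Phi u) F) /\
  (* intertwining Phi (P_K M_z) = U_gamma Phi *)
  (forall u w, K u -> K w ->
     (forall v, K v -> pip (fun x => (mulz u).1 x - w.1 x,
                            fun x => (mulz u).2 x - w.2 x) v = 0) ->
     aeq mu (Phi w) (Ug mu g (Phi u))) /\
  (* Phi c^gamma = b, Phi c_1^gamma = b_1 *)
  aeq mu (Phi (cg mu g)) (fun _ => 1) /\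
  aeq mu (Phi (c1g mu g)) bb1.

(* u = Phi^* F : u in K and <Phi v, F>_mu = <v, u> for all v in K *)
Definition IsAdj mu (g : CC) (Phi : (MR -> CC) * (MR -> CC) -> (MR -> CC))
  (F : MR -> CC) (u : (MR -> CC) * (MR -> CC)) : Prop :=
  Kmodel (thetab mu g) (Deltab mu g) u /\
  forall v, Kmodel (thetab mu g) (Deltab mu g) v -> ip mu (Phi v) F = pip v u.

(* Main.v *)
(* Pairing Phi_gamma^* f = (g_1, g_2) with the kernel vectors of the model space amounts, by the
   intertwining relation, to two identities on the disc. Write P[nu] for the Poisson integral of nu,
   k for (1 - |gamma|^2)^(1/2), R = (R_2 mu + 1) / 2 for the Cauchy transform of mu and
   Q = (1 - conj(gamma)) R + conj(gamma) for half the denominator of theta_gamma; then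
     k P[f mu] = Q g_+ + conj(Q) P[g_- m].
   Together with the energy identity, which expresses P[(|g_1|^2 + |g_2|^2) m] through P[|f|^2 mu],
   this shows that |(P[mu] + c P[m]) G - P[f mu]|^2, where G is the function of (1) and c > 0 a
   constant, equals
     |P[f mu]|^2 - (P[mu] + c P[m]) (P[|f|^2 mu] - P[(|g_1|^2 + |g_2|^2) m]).
   Poisson integrals can be differentiated almost everywhere with respect to P[mu + m]: at
   mu_s-a.e. point P[m] / P[mu + m] tends to 0, so the right-hand side divided by P[mu + m]^2 tends
   to |f|^2 - |f|^2 = 0, which gives (1). At Lebesgue-a.e. point the boundary values of the first
   identity give (2); there Fatou's theorem is used for theta_gamma, and theta_0 <> 1 a.e. because
   1 / (1 + e R), bounded by 1 and of mean 1 / (1 + e), has boundary value 0 where theta_0 = 1.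
   Differentiation of Poisson integrals is reduced to the Lebesgue differentiation theorem by
   transporting mu + m to Lebesgue measure with its quantile function. *)
Require Import Defs.
From HB Require Import structures.
From mathcomp Require Import all_boot all_order all_algebra.
From mathcomp Require Import all_classical all_reals all_analysis.
From mathcomp Require Import Rstruct Rstruct_topology.
From mathcomp Require Import complex.
From mathcomp Require Import measurable_realfun ring lra.
Set Implicit Arguments. Unset Strict Implicit. Unset Printing Implicit Defensive.
Import Order.TTheory GRing.Theory Num.Theory.
Import numFieldTopology.Exports numFieldNormedType.Exports.
Local Open Scope classical_set_scope.
Local Open Scope ring_scope.

(** Statement (1) is of the type of Poltoratski's theorem. The analytic half of the first identity
    reads k C[f mu] = Q g_+, with C the Cauchy transform, so G is the quotient of C[f mu] by R +
    conj(gamma) / (1 - conj(gamma)). Differentiation theorems control quotients of Poisson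
    integrals, whose kernel is positive, but not quotients of Cauchy transforms; the square identity
    closes this gap, because the energy identity supplies exactly the cross terms by which a Cauchy
    expression becomes a Poisson one. No weak-type estimate for Cauchy transforms enters. The
    constant c is (1 - |gamma|^2) / |1 - gamma|^2. The measure mu + m need not be doubling, so only
    intervals centred at the point under consideration may be compared. Two devices respect this:
    the quantile function pulls such an interval back into an interval of comparable length, and the
    Poisson kernel is bounded from both sides by sums of indicators of centred intervals with the
    same weights. *)

Section Quantile.
Context {R : realType}.
Variable k : {finite_measure set (measurableTypeR R) -> \bar R}.

(** * Distribution function and quantile function of a finite measure on [[0, 1[] *)

Lemma finite_measure_decreasing_approx (F : (set (measurableTypeR R))^nat) (e : R) :
  (forall n, measurable (F n)) -> nonincreasing_seq F -> 0 < e ->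
  exists n, fine (k (F n)) < fine (k (\bigcap_n F n)) + e.
Proof.
move=> mF dF e0.
have fin A : measurable A -> k A \is a fin_num by move=> mA; exact: fin_num_measure.
have mI : measurable (\bigcap_n F n) by apply: bigcapT_measurable.
have lt0 : (k (F 0%N) < +oo)%E by rewrite ltey_eq fin.
have /fine_cvgP[_ /cvgrPdist_lt /(_ e e0)] : k (F n) @[n --> \oo] --> (fine (k (\bigcap_n F n)))%:E.
  rewrite fineK ?fin//; exact: nonincreasing_cvg_mu.
case=> N _ /(_ N (leqnn N)) /=; rewrite ltr_norml => /andP[h _].
exists N; lra.
Qed.

Let I : set (measurableTypeR R) := `[0, 1[%classic.
Let mIC : measurable (~` I). Proof. apply: measurableC; exact: measurable_itv. Qed.
Let IP (y : R) : I y -> 0 <= y /\ y < 1. Proof. by rewrite /I/= in_itv/= => /andP[]. Qed.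
Hypothesis kI : k (~` I) = 0%E.

Definition cumul (x : R) : R := fine (k `]-oo, x]%classic).
(** The generalised inverse of the distribution function: an atom of [k] becomes an interval on
    which [quant] is constant. *)
Definition quant (s : R) : R := inf [set x | s <= cumul x].
Let M := fine (k setT).

Lemma fin_k A : measurable A -> k A \is a fin_num.
Proof. by move=> mA; exact: fin_num_measure. Qed.

Lemma cumul_sub (a b : R) : a <= b -> cumul b = cumul a + fine (k `]a, b]%classic).
Proof.
move=> ab; rewrite /cumul -fineD ?fin_k//; congr fine.
rewrite -measureU//.
  by rewrite -(itv_bndbnd_setU (x := BRight a))//.
by apply/seteqP; split => x //=; rewrite !in_itv/= => -[? /andP[]]; lra.
Qed.

Lemma cumul_nd (a b : R) : a <= b -> cumul a <= cumul b.
Proof. by move=> ab; rewrite (cumul_sub ab) lerDl fine_ge0. Qed.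

Lemma cumul_lt0 x : x < 0 -> cumul x = 0.
Proof.
move=> x0; rewrite /cumul (_ : k _ = 0%E)//.
apply: (@subset_measure0 _ _ _ k _ (~` I)) => //.
by move=> y /=; rewrite in_itv/= => yx /IP[y0 _]; move: (le_lt_trans (le_trans y0 yx) x0); rewrite ltxx.
Qed.

Lemma cumul_ge1 x : 1 <= x -> cumul x = M.
Proof.
move=> x1; rewrite /cumul /M; congr fine.
rewrite -(setUv `]-oo, x]%classic) measureU//; last 2 first.
- exact: measurableC.
- by rewrite setICr.
rewrite [X in (_ + X)%E](_ : _ = 0%E) ?adde0//.
apply: (@subset_measure0 _ _ _ _ _ (~` I)) => //; do ?exact: measurableC.
by move=> y /=; rewrite in_itv/= => h /IP[_ h2]; apply: h; exact: le_trans (ltW h2) x1.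
Qed.

(** Right continuity of the distribution function, by which the infimum in [quant] is attained. *)
Lemma cumul_rc x e : 0 < e -> exists2 d, 0 < d & cumul (x + d) < cumul x + e.
Proof.
move=> e0.
have [||n Hn] := @finite_measure_decreasing_approx (fun n => `]-oo, x + n.+1%:R^-1]%classic) e _ _ e0.
- by move=> n; exact: measurable_itv.
- move=> m n mn; apply/subsetPset => y /=; rewrite !in_itv/= => /le_trans; apply.
  by rewrite lerD2l lef_pV2 ?posrE// ler_nat.
exists n.+1%:R^-1 => //.
apply: (lt_le_trans Hn); rewrite lerD2r /cumul.
rewrite (_ : \bigcap_n _ = `]-oo, x]%classic)//.
apply/seteqP; split=> y /=; rewrite ?in_itv/=.
  move=> H; apply/ler_addgt0Pr => d d0.
  have [j _ Hj] := near_infty_natSinv_lt (PosNum d0).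
  have h1 : y <= x + j.+1%:R^-1 by have := H j Logic.I; rewrite /= in_itv.
  have h2 : j.+1%:R^-1 < d := Hj j (leqnn j).
  by rewrite (le_trans h1)// lerD2l ltW.
by move=> yx j _ /=; rewrite in_itv/=; rewrite (le_trans yx)// lerDl invr_ge0.
Qed.

(** The bounds on [s] keep the set in [quant] bounded below, as [cumul] vanishes on the negative
    axis, and nonempty, as [cumul] equals [M] at 1. *)
Lemma quantP s x : 0 < s -> s <= M -> (quant s <= x) <-> (s <= cumul x).
Proof.
move=> s0 sM.
have lb : has_lbound [set x | s <= cumul x].
  exists 0 => y /= h; rewrite leNgt; apply/negP => /cumul_lt0 H; lra.
have ne : [set x | s <= cumul x] !=set0 by exists 1; rewrite /= cumul_ge1.
split=> [h|h]; last exact: ge_inf.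
apply/ler_addgt0Pr => e e0.
have [d d0 /ltW Hd] := cumul_rc x e0.
apply: le_trans Hd.
have [y ys] := @inf_adherent _ [set x | s <= cumul x] d d0 (conj ne lb).
rewrite -/(quant s) => yd; apply: (le_trans ys); apply: cumul_nd; lra.
Qed.

Let D : set (measurableTypeR R) := `]0, M]%classic.

Let DP s : D s -> 0 < s /\ s <= M. Proof. by rewrite /D/= in_itv/= => /andP[]. Qed.

Lemma measurable_quant :
  @measurable_fun _ _ (measurableTypeR R) (measurableTypeR R) setT (quant \_ D).
Proof.
apply/(measurable_restrictT _ _).1 => //.
  exact: measurable_itv.
suff H : measurable_fun (D : set R) (quant : R -> R) by exact: H.
apply: (measurability (@RGenCInfty.G R)) => [|/= _ [_] [r] -> <-]; first exact: RGenCInfty.measurableE.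
apply: is_interval_measurable => s t/= [/DP[s0 sM]].
rewrite !in_itv/= !andbT => fs [/DP[t0 tM] _] u /andP[su ut].
have u0 : 0 < u by exact: lt_le_trans su.
have uM : u <= M by exact: le_trans tM.
split; first by rewrite /D/= in_itv/= u0.
rewrite in_itv/= andbT; apply: (le_trans fs).
by apply/quantP => //; apply: (le_trans su); exact/quantP.
Qed.

Let mD : measurable D. Proof. exact: measurable_itv. Qed.

(** By [quantP] the preimage of []a, b]] is []cumul a, cumul b]], whose length is the mass of []a,
    b]]; a finite measure is determined by half-open intervals. *)
Lemma pushforward_quant (A : set (measurableTypeR R)) : measurable A ->
  pushforward (mrestr (@lebesgue_measure R) mD) (quant \_ D) A = k A.
Proof.
move=> mA.
pose nu := measure_function_pushforward__canonical__measure_function_Measure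
  (mrestr (@lebesgue_measure R) mD) measurable_quant.
have -> : pushforward (mrestr (@lebesgue_measure R) mD) (quant \_ D) A = nu A by [].
apply/esym.
apply: (@measure_unique _ R (measurableTypeR R) (@ocitv R) (fun n => `](- n%:R), n%:R]%classic) _ _ _ _ k nu) => //.
- exact: ocitvI.
- by move=> i; exists (- i%:R, i%:R).
- apply/seteqP; split=> // x _; have := archi_boundP (normr_ge0 x).
  set n := Num.Def.archi_bound _ => h; exists n => //=; rewrite in_itv/=.
  by move: h; rewrite ltr_norml => /andP[-> /ltW ->].
- move=> _ [[a b] /= _ <-].
  have [ab|ba] := leP b a.
    have -> : `]a, b]%classic = set0 by rewrite set_itv_ge// bnd_simp -leNgt.
    by rewrite measure0 -[RHS]/(nu set0) measure0.
  rewrite /nu/= /pushforward /mrestr/=.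
  rewrite (_ : _ `&` _ = `]cumul a, cumul b]%classic); last first.
    apply/seteqP; split=> s /=; rewrite ?in_itv/=.
      move=> [+ sD]; rewrite patchE mem_set//.
      move: sD; rewrite /D/= in_itv/= => /andP[s0 sM] /andP[aq qb].
      apply/andP; split; last exact/quantP.
      by rewrite ltNge; apply/negP => /quantP-/(_ s0 sM); rewrite leNgt aq.
    move=> /andP[as_ sb].
    have sD : 0 < s <= M.
      rewrite (le_lt_trans _ as_) ?fine_ge0//= (le_trans sb)//.
      by apply: fine_le; rewrite ?fin_k// le_measure// inE.
    split; last by rewrite /D/= in_itv.
    rewrite patchE mem_set; last by rewrite /D/= in_itv.
    case/andP: sD => s0 sM; apply/andP; split; last exact/quantP.
    by rewrite ltNge; apply/negP => /quantP-/(_ s0 sM); rewrite leNgt as_.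
  rewrite lebesgue_measure_itv/= lte_fin (cumul_sub (ltW ba)).
  case: ltP => h; first by rewrite -EFinB addrAC subrr add0r fineK// fin_k.
  have -> : k `]a, b]%classic = (fine (k `]a, b]%classic))%:E by rewrite fineK// fin_k.
  congr EFin; apply/eqP; rewrite eq_le fine_ge0// andbT; lra.
- by move=> n; rewrite ltey_eq fin_k.
Qed.

(** The value -1 lies outside [[0, 1[], so that preimages of subsets of [[0, 1[] stay inside []0,
    M]] although the function is defined on the whole line. *)
Definition quantx (s : R) : R := if (0 < s) && (s <= M) then quant s else -1.

Lemma quantxE s : D s -> quantx s = quant s.
Proof. by move=> /DP[s0 sM]; rewrite /quantx s0 sM. Qed.

Lemma measurable_quantx :
  @measurable_fun _ _ (measurableTypeR R) (measurableTypeR R) setT quantx.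
Proof.
pose c := (cst (-1) : measurableTypeR R -> measurableTypeR R).
rewrite -(setUv D); apply/measurable_funU => //; first exact: measurableC.
split.
- apply: (@eq_measurable_fun _ _ _ _ _ (quant \_ D)).
    by move=> s; rewrite inE => sD; rewrite patchE mem_set// quantxE.
  apply: measurable_funS measurable_quant => //.
- apply: (@eq_measurable_fun _ _ _ _ _ c); last exact: measurable_cst.
  move=> s; rewrite inE/= => sD; rewrite /quantx; case: ifPn => //.
Qed.

Lemma quantx_preimage (A : set (measurableTypeR R)) : A `<=` I -> quantx @^-1` A `<=` D.
Proof.
move=> AI s; rewrite /= /quantx; case: ifPn => [h _|_ /AI/IP[]]; first by rewrite /D/= in_itv.
by rewrite lerNr oppr0 ler10.
Qed.

Lemma pushforward_quantx (A : set (measurableTypeR R)) : measurable A -> A `<=` I ->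
  (@lebesgue_measure R) (quantx @^-1` A) = k A.
Proof.
move=> mA AI; rewrite -pushforward_quant// /pushforward /mrestr; congr (lebesgue_measure _).
apply/seteqP; split=> s /=.
  move=> h; have sD := quantx_preimage AI h.
  by split=> //; rewrite patchE mem_set// -quantxE.
by move=> [+ sD]; rewrite patchE mem_set// quantxE.
Qed.

Lemma ge0_integral_quantx (A : set (measurableTypeR R)) (h : measurableTypeR R -> \bar R) :
  measurable A -> A `<=` I -> measurable_fun A h -> (forall x, A x -> (0 <= h x)%E) ->
  (\int[k]_(x in A) h x = \int[@lebesgue_measure R]_(s in quantx @^-1` A) h (quantx s))%E.
Proof.
move=> mA AI mh h0.
rewrite -(@ge0_integral_pushforward _ _ _ _ _ _ measurable_quantx)//; last first.
  by move=> x; rewrite inE => /h0.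
apply: eq_measure_integral => [|mq B mB BA]; first exact: measurable_quantx.
by rewrite /= /pushforward pushforward_quantx//; exact: subset_trans AI.
Qed.

Hypothesis kpos : forall a b, 0 <= a -> a < b -> b < 1 -> (0 < k `]a, b]%classic)%E.

Lemma cumul_lt a b : 0 <= a -> a < b -> b < 1 -> cumul a < cumul b.
Proof.
move=> a0 ab b1; rewrite (cumul_sub (ltW ab)) ltrDl fine_gt0// kpos//=.
by rewrite ltey_eq fin_k.
Qed.

Lemma cumul_D x : 0 < x -> x < 1 -> D (cumul x).
Proof.
move=> x0 x1; rewrite /D/= in_itv/=; apply/andP; split.
  by apply: le_lt_trans (cumul_lt (lexx 0) x0 x1); rewrite fine_ge0.
by apply: fine_le; rewrite ?fin_k// le_measure// inE.
Qed.

Lemma quant_ge0 s : D s -> 0 <= quant s.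
Proof.
move=> /DP[s0 sM]; rewrite leNgt; apply/negP => q0.
have /quantP : quant s <= quant s by [].
by move=> /(_ s0 sM); rewrite cumul_lt0// leNgt s0.
Qed.

(** Full support makes the distribution function strictly increasing on [[0, 1[], hence [quant] a
    left inverse of it. *)
Lemma quant_cumul x : 0 < x -> x < 1 -> quant (cumul x) = x.
Proof.
move=> x0 x1; have sD := cumul_D x0 x1; have [s0 sM] := DP sD.
apply/eqP; rewrite eq_le; apply/andP; split; first exact/quantP.
rewrite leNgt; apply/negP => qx.
have := cumul_lt (quant_ge0 sD) qx x1.
by rewrite ltNge; apply/negP/negPn/quantP.
Qed.
End Quantile.


(** * Differentiation along centred intervals with respect to a finite measure *)

Lemma shrinking_integral d (T : measurableType d) (R : realType)
    (k : {measure set T -> \bar R}) (F : (set T)^nat) (h : T -> R) (e : R) :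
  (forall n, measurable (F n)) -> nonincreasing_seq F ->
  k.-integrable setT (EFin \o h) -> (forall x, 0 <= h x) ->
  (forall x, (\bigcap_n F n) x -> h x = 0) -> 0 < e ->
  exists n, (\int[k]_(x in F n) (h x)%:E < e%:E)%E.
Proof.
move=> mF dF ih h0 hF e0.
have mh : measurable_fun setT (EFin \o h) := measurable_int k ih.
have [|||||_ _ H] := @dominated_convergence _ T R k setT measurableT
  (fun n => (EFin \o h) \_ (F n)) (cst 0%E) (EFin \o h).
- move=> n; apply/(measurable_restrictT _ _).1 => //; exact: measurable_funTS.
- exact: measurable_cst.
- apply/aeW => x _.
  have [xF|xF] := pselect ((\bigcap_n F n) x).
    have -> : (fun n => ((EFin \o h) \_ (F n)) x) = cst 0%E.
      by apply/funext => n; rewrite patchE /= hF//; case: ifP.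
    exact: cvg_cst.
  have [N FN] : exists N, ~ F N x.
    by apply/existsNP => H; apply: xF => n _; exact: H.
  apply: cvg_near_cst; exists N => // n /= Nn; apply/eqP.
  rewrite patchE ifF//; apply/negP; rewrite inE => /(subsetPset _ _ (dF _ _ Nn)).
  exact: FN.
- exact: ih.
- apply/aeW => x n _; rewrite patchE; case: ifP => _ /=; last by rewrite normr0 lee_fin.
  by rewrite ger0_norm.
move: H; rewrite integral0 => /fine_cvgP[[N1 _ Hf] /cvgrPdist_lt /(_ e e0)[N _ HN]].
exists (maxn N N1); have /= := HN (maxn N N1) (leq_maxl _ _).
have /= fn := Hf (maxn N N1) (leq_maxr _ _).
rewrite sub0r normrN => HH; rewrite integral_mkcond -(fineK fn) lte_fin.
by apply: le_lt_trans HH; exact: ler_norm.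
Qed.

Section Differentiation.
Context {R : realType}.
Variable k : {finite_measure set (measurableTypeR R) -> \bar R}.
Let I : set (measurableTypeR R) := `[0, 1[%classic.
Hypothesis kI : k (~` I) = 0%E.
Hypothesis kpos : forall a b, 0 <= a -> a < b -> b < 1 -> (0 < k `]a, b]%classic)%E.

Let M := fine (k setT).
Let D : set (measurableTypeR R) := `]0, M]%classic.
Let q := quantx k.
Notation leb := (@lebesgue_measure R).

Let J (x r : R) : set (measurableTypeR R) := `]x - r, x + r[%classic.

Let mJr x r : measurable (J x r). Proof. exact: measurable_itv. Qed.

Let JS (x : R) m n : (m <= n)%N -> J x n.+1%:R^-1 `<=` J x m.+1%:R^-1.
Proof.
move=> mn y; rewrite /J/= !in_itv/= => /andP[h1 h2].
have h : n.+1%:R^-1 <= m.+1%:R^-1 :> R by rewrite lef_pV2 ?posrE// ler_nat.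
by rewrite (le_lt_trans _ h1) ?lerD2l ?lerN2//= (lt_le_trans h2)// lerD2l.
Qed.

Let J_cap (x : R) : \bigcap_n J x n.+1%:R^-1 = [set x].
Proof.
apply/seteqP; split=> [y H|_ -> n _]; last first.
  by rewrite /J/= in_itv/= ltrBlDr ltrDl invr_gt0 ltr0n.
apply/eqP; rewrite -subr_eq0 -normr_le0; apply/ler_addgt0Pr => d d0; rewrite add0r.
have [j _ Hj] := near_infty_natSinv_lt (PosNum d0).
have h2 : j.+1%:R^-1 < d := Hj j (leqnn j).
have := H j Logic.I; rewrite /J/= in_itv/= => /andP[h3 h4].
by rewrite ltW// (lt_trans _ h2)// ltr_norml ltrBrDl h3/= ltrBlDl.
Qed.

Variable g : measurableTypeR R -> R.
Hypothesis ig : k.-integrable setT (EFin \o g).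

Let good (x : R) := forall e, 0 < e -> exists2 d, 0 < d & forall r, 0 < r -> r < d ->
  (\int[k]_(y in J x r) `|g y - g x|%:E <= e%:E * k (J x r))%E.

Let mg : measurable_fun setT g.
Proof. by have /measurable_EFinP := measurable_int k ig. Qed.

Let igB x : k.-integrable setT (EFin \o (fun y => `|g y - g x|)).
Proof.
apply: (@integrable_norm _ _ _ k setT (fun y => g y - g x)).
apply: (@integrableB _ _ _ k setT measurableT (EFin \o g) (EFin \o cst (g x))) => //.
exact: finite_measure_integrable_cst.
Qed.

Let mgB x A : measurable_fun A (fun y => `|g y - g x|%:E).
Proof. by apply: measurable_funTS; exact: (measurable_int k (igB x)). Qed.

Let JSr (x r s : R) : r <= s -> J x r `<=` J x s.
Proof.
move=> rs y; rewrite /J/= !in_itv/= => /andP[h1 h2].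
by rewrite (le_lt_trans _ h1) ?lerD2l ?lerN2//= (lt_le_trans h2)// lerD2l.
Qed.

(** The mass of [J x r] stays above that of the atom, while the integral tends to 0 because the
    integrand vanishes at [x]. *)
Let good_atom x : k [set x] != 0%E -> good x.
Proof.
move=> kx e e0.
have kx0 : (0 < k [set x])%E by rewrite lt0e kx measure_ge0.
have fx : k [set x] \is a fin_num by exact: fin_k.
have [||||||n Hn] := @shrinking_integral _ _ _ k (fun n => J x n.+1%:R^-1)
  (fun y => `|g y - g x|) (e * fine (k [set x])).
- by move=> n; exact: measurable_itv.
- by move=> m n mn; apply/subsetPset; exact: JS.
- exact: igB.
- by [].
- by move=> y; rewrite J_cap => ->; rewrite subrr normr0.
- by rewrite mulr_gt0// fine_gt0// kx0 ltey_eq fx.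
exists n.+1%:R^-1; first by rewrite invr_gt0.
move=> r r0 rn; apply: (@le_trans _ _ (e * fine (k [set x]))%:E).
  apply: le_trans (ltW Hn); apply: ge0_subset_integral => //.
  exact/JSr/ltW.
rewrite EFinM fineK//; apply: lee_wpmul2l; first by rewrite lee_fin ltW.
apply: le_measure; rewrite ?inE// => y ->; rewrite /J/= in_itv/=.
by rewrite ltrBlDr ltrDl r0.
Qed.

Let Q : set (measurableTypeR R) := q @^-1` I.
Let gq : R -> R := (g \o q) \_ Q.

Let mI : measurable I. Proof. exact: measurable_itv. Qed.

Let mQ : measurable Q.
Proof. by rewrite -[X in measurable X]setTI; apply: measurable_quantx. Qed.

Let mgq : measurable_fun setT (g \o q).
Proof. by apply: (measurableT_comp mg); exact: measurable_quantx. Qed.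

Let integrable_gq : locally_integrable setT gq.
Proof.
apply: integrable_locally_restrict => //.
apply/integrableP; split.
  by apply/measurable_EFinP; exact: measurable_funTS.
case/integrableP: ig => _; apply: le_lt_trans.
apply: (@le_trans _ _ (\int[k]_(x in I) `|(EFin \o g) x|)%E); last first.
  by apply: ge0_subset_integral => //; apply/measurable_EFinP; apply: measurableT_comp.
rewrite ge0_integral_quantx//.
by apply/measurable_EFinP; apply: measurableT_comp => //; exact: measurable_funTS.
Qed.

(* J x r is pulled back by the quantile function into a ball whose radius is comparable to k (J x r). *)
Let quantx_J x r : 0 < x -> x < 1 -> J x r `<=` I ->
  q @^-1` (J x r) `<=` ball (cumul k x) (2 * fine (k (J x r))).
Proof.
move=> x0 x1 JI t tJ.
have tD : D t by apply: (quantx_preimage (k := k) (A := I)) => //; exact: JI.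
have /= := tJ; rewrite /q quantxE// /J/= in_itv/= => /andP[h1 h2].
have mJ : measurable (J x r) by exact: measurable_itv.
have r0 : 0 < r by lra.
have xr1 : x + r / 2 < 1.
  have : I (x + r / 2) by apply: JI; rewrite /J/= in_itv/=; apply/andP; split; lra.
  by rewrite /I/= in_itv/= => /andP[].
have kJ A : measurable A -> A `<=` J x r -> fine (k A) <= fine (k (J x r)).
  by move=> mA AJ; apply: fine_le; rewrite ?fin_k// le_measure// inE.
have kJ0 : 0 < fine (k (J x r)).
  apply: (@lt_le_trans _ _ (fine (k `]x, x + r / 2]%classic))).
    rewrite fine_gt0// kpos//=; [|lra|lra]; by rewrite ltey_eq fin_k.
  apply: kJ => // y; rewrite /J/= !in_itv/= => /andP[? ?]; apply/andP; split; lra.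
have [t0 tM] : 0 < t /\ t <= M by move: tD; rewrite /D/= in_itv/= => /andP[].
have c1 : cumul k (x - r) < t.
  rewrite ltNge; apply/negP => h; move: h1; rewrite ltNge; apply/negP/negPn.
  exact/(quantP kI).
have c2 : t <= cumul k (quant k t) by exact/(quantP kI).
have e1 : cumul k x <= cumul k (x - r) + fine (k (J x r)).
  rewrite (@cumul_sub _ k (x - r) x); last lra.
  rewrite lerD2l; apply: kJ => // y; rewrite /J/= !in_itv/= => /andP[? ?].
  apply/andP; split; lra.
have e2 : cumul k (quant k t) <= cumul k x + fine (k (J x r)).
  have [qx|qx] := leP (quant k t) x.
    by apply: ler_wpDr; [exact: ltW|exact: cumul_nd].
  rewrite (cumul_sub k (ltW qx)) lerD2l; apply: kJ => // y; rewrite /J/= !in_itv/= => /andP[? ?].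
  apply/andP; split; lra.
rewrite /ball/= ltr_norml; apply/andP; split; lra.
Qed.

Let good_pt x : 0 < x -> x < 1 -> k [set x] = 0%E ->
  lebesgue_pt gq (cumul k x) -> good x.
Proof.
move=> x0 x1 kx pt e e0.
(* The ball that receives the preimage of [J x r] has radius [2 * kap], hence length [4 * kap];
   averages below [e / 4] over it give [e * kap]. *)
have e4 : 0 < e / 4 by lra.
have [d' d'0 Hd'] : exists2 d', 0 < d' &
    forall rho, 0 < rho -> rho < d' -> (davg gq (cumul k x) rho <= (e / 4)%:E)%E.
  move/fine_cvgP : pt => [] [d1 /= d10 H1] /cvgrPdist_le /(_ _ e4)[d2 /= d20 H2].
  exists (Num.min d1 d2); first by rewrite lt_min d10.
  move=> rho rho0; rewrite lt_min => /andP[r1 r2].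
  have B d : rho < d -> ball_ Num.norm 0 d rho by move=> h; rewrite /ball_/= sub0r normrN gtr0_norm.
  have := H1 _ (B _ r1) rho0 => /fineK <-; rewrite lee_fin.
  have := H2 _ (B _ r2) rho0; rewrite /= sub0r normrN; apply: le_trans; exact: ler_norm.
(* Since [x] is no atom, [k (J x r)] tends to 0 with [r], and with it the radius of the ball in the
   quantile coordinate. *)
have [|||n Hn] := @finite_measure_decreasing_approx _ k (fun n => J x n.+1%:R^-1) (d' / 2).
- by move=> n; exact: measurable_itv.
- by move=> m n mn; apply/subsetPset; exact: JS.
- lra.
move: Hn; rewrite J_cap kx/= add0r => Hn.
exists (Num.min n.+1%:R^-1 (Num.min x (1 - x))).
  by rewrite !lt_min invr_gt0 ltr0n/= x0/=; lra.
move=> r r0; rewrite !lt_min => /andP[rn /andP[rx rx1]].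
have mJ : measurable (J x r) by exact: measurable_itv.
have JI : J x r `<=` I.
  move=> y; rewrite /J/I/= !in_itv/= => /andP[? ?]; apply/andP; split; lra.
rewrite (ge0_integral_quantx kI mJ JI)//.
pose kap := fine (k (J x r)).
have kap0 : 0 < kap.
  apply: (@lt_le_trans _ _ (fine (k `]x, x + r / 2]%classic))).
    rewrite fine_gt0// kpos//=; [|lra|lra|lra]; by rewrite ltey_eq fin_k.
  apply: fine_le; rewrite ?fin_k//; apply: le_measure; rewrite ?inE//.
  by move=> y; rewrite /J/= !in_itv/= => /andP[? ?]; apply/andP; split; lra.
have kapd : 2 * kap < d'.
  have : kap <= fine (k (J x n.+1%:R^-1)).
    apply: fine_le; rewrite ?fin_k//; apply: le_measure; rewrite ?inE//.
    exact/JSr/ltW.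
  by move=> ?; lra.
have xQ : Q (cumul k x).
  rewrite /Q/q/= quantxE; last exact: cumul_D.
  by rewrite quant_cumul// /I/= in_itv/= x1 ltW.
have gqx : gq (cumul k x) = g x.
  rewrite /gq patchE mem_set//= /q quantxE; last exact: cumul_D.
  by rewrite quant_cumul.
have mgq' : measurable_fun setT (fun t : measurableTypeR R => `|gq t - gq (cumul k x)|%:E).
  apply/measurable_EFinP; apply: measurableT_comp => //.
  apply: measurable_funB => //.
  by case: integrable_gq.
apply: (@le_trans _ _ (\int[leb]_(t in ball (cumul k x) (2 * kap)) `|gq t - gq (cumul k x)|%:E)%E).
  rewrite (eq_integral (fun t : measurableTypeR R => `|gq t - gq (cumul k x)|%:E)); last first.
    move=> t; rewrite inE => tJ; rewrite gqx /gq patchE mem_set//.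
    exact: JI.
  apply: ge0_subset_integral => //.
  - by rewrite -[X in measurable X]setTI; apply: measurable_quantx.
  - exact: measurable_ball.
  - exact: measurable_funTS.
  - exact: quantx_J.
have := Hd' (2 * kap) _ kapd; rewrite mulr_gt0// => /(_ isT).
rewrite /davg /iavg lebesgue_measure_ball; last lra.
rewrite inver mulrn_eq0/= gt_eqF; last lra.
rewrite muleC lee_pdivrMr; last lra.
move=> /le_trans; apply; rewrite -[k _]fineK ?fin_k// -!EFinM lee_fin -/kap.
by rewrite -mulr_natr; lra.
Qed.

(** The left limit of the distribution function. Atoms are the points where it differs from [cumul];
    since both functions are monotone, the set of non-atoms is measurable. *)
Let cumulm (x : R) : R := fine (k `]-oo, x[%classic).

Let cumul_cumulm x : cumul k x = cumulm x + fine (k [set x]).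
Proof.
rewrite /cumul /cumulm -fineD ?fin_k//; congr fine.
rewrite -measureU//; last first.
  by apply/seteqP; split=> // y [/= + yx]; rewrite in_itv/= yx ltxx.
congr (k _); apply/seteqP; split=> y /=; rewrite !in_itv/= le_eqVlt.
  by move=> /orP[/eqP ->|?]; [right|left].
by move=> [->|->]; rewrite ?eqxx ?orbT.
Qed.

(** Otherwise [q] would send the whole interval []s, cumul k (q s)]], of positive length, to the
    point [q s], which would then be an atom. *)
Let cumul_quantx s : Q s -> k [set q s] = 0%E -> cumul k (q s) = s.
Proof.
move=> sQ kx; have sD : D s by exact: (quantx_preimage (k := k) (A := I)).
have [s0 sM] : 0 < s /\ s <= M by move: sD; rewrite /D/= in_itv/= => /andP[].
have sq : s <= cumul k (q s) by apply/(quantP kI) => //; rewrite /q quantxE.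
apply/eqP; rewrite eq_le sq andbT leNgt; apply/negP => lt.
have : (leb `]s, cumul k (q s)]%classic <= leb (q @^-1` [set q s]))%E.
  apply: le_measure; rewrite ?inE//.
    by rewrite -[X in measurable X]setTI; apply: measurable_quantx.
  move=> t /=; rewrite in_itv/= => /andP[st tq].
  have tM : t <= M by apply: (le_trans tq); apply: fine_le; rewrite ?fin_k// le_measure// inE.
  have t0 : 0 < t by exact: lt_trans st.
  have tD : D t by rewrite /D/= in_itv/= t0.
  rewrite /q !quantxE//; apply/eqP; rewrite eq_le; apply/andP; split.
    by apply/(quantP kI) => //; rewrite -(quantxE sD).
  apply/(quantP kI) => //; apply: (le_trans (ltW st)); exact/(quantP kI).
rewrite pushforward_quantx//; last by move=> _ ->.
by rewrite kx lebesgue_measure_itv/= lte_fin lt -EFinB lee_fin leNgt subr_gt0 lt.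
Qed.

Lemma interval_differentiation : {ae k, forall x : R, I x -> k [set x] != 0%E \/
  (0 < x /\ forall e, 0 < e -> exists2 d, 0 < d & forall r, 0 < r -> r < d ->
  (\int[k]_(y in `](x - r)%R, (x + r)%R[) `|g y - g x|%:E <= e%:E * k `](x - r)%R, (x + r)%R[%classic)%E)}.
Proof.
have [N [mN N0 HN]] := lebesgue_differentiation integrable_gq.
have mc : measurable_fun setT (cumul k).
  apply: nondecreasing_measurable => //; exact: cumul_nd.
have mcm : measurable_fun setT cumulm.
  apply: nondecreasing_measurable => // x y xy; apply: fine_le; rewrite ?fin_k//.
  apply: le_measure; rewrite ?inE// => z /=; rewrite !in_itv/= => /lt_le_trans; exact.
pose A0 : set (measurableTypeR R) := [set x | cumul k x == cumulm x].
have A0E x : A0 x <-> k [set x] = 0%E.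
  split=> [/eqP h|h]; last by rewrite /A0/= cumul_cumulm h addr0.
  have h0 : fine (k [set x]) = 0 by have := cumul_cumulm x; rewrite h; lra.
  by rewrite -[k _]fineK ?fin_k// h0.
have mA0 : measurable A0.
  have h := measurable_fun_eqr mc mcm.
  by rewrite -[A0]setTI; apply: (h measurableT [set true]).
(* The bad non-atoms have [cumul k x] in the Lebesgue null set [N]; by [cumul_quantx] the preimage
   of [B] under the quantile function lies in [N]. *)
pose B : set (measurableTypeR R) := `]0, 1[%classic `&` A0 `&` cumul k @^-1` N.
have mB : measurable B.
  apply: measurableI; first exact: measurableI.
  by rewrite -[X in measurable X]setTI; apply: mc.
have kB : k B = 0%E.
  rewrite -pushforward_quantx//; last first.
    by move=> x [[/= + _] _]; rewrite /I/= !in_itv/= => /andP[/ltW -> ->].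
  apply: (@subset_measure0 _ _ _ leb _ N) => //.
    by rewrite -[X in measurable X]setTI; apply: measurable_quantx.
  move=> s [[/= q01 /A0E kq]] /=; rewrite -/q cumul_quantx//.
  by rewrite /Q/I/= in_itv/=; move: q01; rewrite in_itv/= => /andP[/ltW -> ->].
(* No symmetric interval around the endpoint 0 stays in [[0, 1[]: this point is either an atom or a
   null set. *)
pose C : set (measurableTypeR R) := if `[< k [set 0] = 0%E >] then [set 0] else set0.
have mC : measurable C by rewrite /C; case: ifP.
have kC : k C = 0%E by rewrite /C; case: ifPn => [/asboolP|]; rewrite ?measure0.
exists (B `|` C); split; first exact: measurableU.
  by rewrite measureU0.
move=> x /= /not_implyP[Ix]; rewrite not_orP => -[/negP/negPn/eqP kx] H.
move: Ix; rewrite /I/= in_itv/= => /andP[x0 x1].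
have [xE|xE] := eqVneq x 0; first by right; rewrite /C asboolT -xE.
have {}x0 : 0 < x by rewrite lt_def xE.
left; split; first by split; [rewrite /= in_itv/= x0|exact/A0E].
apply: HN => /= pt; apply: H; split => //; exact: good_pt.
Qed.
End Differentiation.

(** * Modulus, real and imaginary parts *)

Notation ReC := complex.Re.
Notation ImC := complex.Im.

(** The norm of [CC] takes its values in [CC]; this real modulus is the one that enters real
    integrals, suprema and estimates. *)
Definition nm (z : CC) : RR := Num.sqrt (sqn z).

Lemma sqn_ge0 z : 0 <= sqn z.
Proof. by rewrite addr_ge0// sqr_ge0. Qed.

Lemma nm_ge0 z : 0 <= nm z. Proof. exact: sqrtr_ge0. Qed.

Lemma normCnm (z : CC) : `|z| = (nm z)%:C%C.
Proof. by rewrite normc_def. Qed.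

Lemma nm_sqr z : nm z ^+ 2 = sqn z.
Proof. by rewrite sqr_sqrtr// sqn_ge0. Qed.

Lemma nmM x y : nm (x * y) = nm x * nm y.
Proof.
by have := normrM x y; rewrite !normCnm -rmorphM => -[].
Qed.

Lemma nmD x y : nm (x + y) <= nm x + nm y.
Proof. by have := ler_normD x y; rewrite !normCnm -rmorphD lecR. Qed.

Lemma nmN x : nm (- x) = nm x.
Proof. by have := normrN x; rewrite !normCnm => -[]. Qed.

Lemma nmB x y : nm (x - y) = nm (y - x).
Proof. by rewrite -nmN opprB. Qed.

Lemma nmBle x y : nm (x - y) <= nm x + nm y.
Proof. by rewrite (le_trans (nmD _ _))// nmN. Qed.

Lemma nmV x : nm x^-1 = (nm x)^-1.
Proof. by have := normfV x; rewrite !normCnm -fmorphV => -[]. Qed.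

Lemma nmJ (x : CC) : nm (x^*) = nm x.
Proof. by case: x => a b; rewrite /nm /sqn/= sqrrN. Qed.

Lemma nm_real (r : RR) : nm r%:C%C = `|r|.
Proof. by rewrite /nm /sqn/= expr0n/= addr0 sqrtr_sqr. Qed.

Lemma nm0 : nm 0 = 0. Proof. by rewrite /nm /sqn/= !expr0n/= addr0 sqrtr0. Qed.
Lemma nm1 : nm 1 = 1. Proof. by rewrite /nm /sqn/= expr1n expr0n/= addr0 sqrtr1. Qed.

Lemma nm_eq0 z : (nm z == 0) = (z == 0).
Proof. by rewrite -(normr_eq0 z) normCnm eq_complex/= eqxx andbT. Qed.

Lemma nm_gt0 z : (0 < nm z) = (z != 0).
Proof. by rewrite lt_def nm_ge0 andbT nm_eq0. Qed.

Lemma nmX z n : nm (z ^+ n) = nm z ^+ n.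
Proof. by elim: n => [|n IH]; rewrite ?expr0 ?nm1// !exprS nmM IH. Qed.

Lemma nm_triangle z x y : nm (x - y) <= nm (x - z) + nm (z - y).
Proof. by rewrite (le_trans _ (nmD _ _))// addrA subrK. Qed.

Lemma nm_dist x y : `|nm x - nm y| <= nm (x - y).
Proof.
rewrite ler_norml; apply/andP; split.
  have := nmD (y - x) x; rewrite subrK nmB; lra.
have := nmD (x - y) y; rewrite subrK; lra.
Qed.

Lemma Re_le_nm z : `|ReC z| <= nm z.
Proof. by rewrite -sqrtr_sqr ler_sqrt ?sqn_ge0// lerDl sqr_ge0. Qed.

Lemma Im_le_nm z : `|ImC z| <= nm z.
Proof. by rewrite -sqrtr_sqr ler_sqrt ?sqn_ge0// lerDr sqr_ge0. Qed.

Lemma nm_le_ReIm z : nm z <= `|ReC z| + `|ImC z|.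
Proof.
rewrite -[leRHS]ger0_norm ?addr_ge0// -sqrtr_sqr ler_sqrt ?sqr_ge0//.
by rewrite sqrrD !real_normK ?num_real// /sqn -addrA lerD2l lerDr mulrn_wge0// mulr_ge0.
Qed.

Lemma ReD (x y : CC) : ReC (x + y) = ReC x + ReC y. Proof. by case: x; case: y. Qed.
Lemma ImD (x y : CC) : ImC (x + y) = ImC x + ImC y. Proof. by case: x; case: y. Qed.
Lemma ReN (x : CC) : ReC (- x) = - ReC x. Proof. by case: x. Qed.
Lemma ImN (x : CC) : ImC (- x) = - ImC x. Proof. by case: x. Qed.
Lemma ReM (x y : CC) : ReC (x * y) = ReC x * ReC y - ImC x * ImC y.
Proof. by case: x; case: y. Qed.
Lemma ImM (x y : CC) : ImC (x * y) = ReC x * ImC y + ImC x * ReC y.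
Proof. by case: x => a b; case: y. Qed.
Lemma ReJ (x : CC) : ReC (x^*) = ReC x. Proof. by case: x. Qed.
Lemma ImJ (x : CC) : ImC (x^*) = - ImC x. Proof. by case: x. Qed.
Lemma ReV (x : CC) : ReC x^-1 = ReC x / sqn x.
Proof. by case: x. Qed.
Lemma ImV (x : CC) : ImC x^-1 = - ImC x / sqn x.
Proof. by case: x => a b; rewrite /= mulNr. Qed.
Lemma ReR (r : RR) : ReC r%:C%C = r. Proof. by []. Qed.
Lemma ImR (r : RR) : ImC r%:C%C = 0. Proof. by []. Qed.
Definition ReImE := (ReD, ImD, ReN, ImN, ReM, ImM, ReJ, ImJ).

Lemma CCext (x y : CC) : ReC x = ReC y -> ImC x = ImC y -> x = y.
Proof. by case: x => a b; case: y => c d /= -> ->. Qed.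

Lemma sqnE (z : CC) : (sqn z)%:C%C = z * z^*.
Proof. apply: CCext; rewrite !ReImE ?ReR ?ImR /sqn; ring. Qed.

Lemma addCJ (z : CC) : z + z^* = (2 * ReC z)%:C%C.
Proof. apply: CCext; rewrite !ReImE ?ReR ?ImR; ring. Qed.

Lemma conjM (x y : CC) : (x * y)^* = x^* * y^*. Proof. exact: rmorphM. Qed.
Lemma conjD (x y : CC) : (x + y)^* = x^* + y^*. Proof. exact: rmorphD. Qed.
Lemma conjB (x y : CC) : (x - y)^* = x^* - y^*. Proof. exact: rmorphB. Qed.
Lemma conjN (x : CC) : (- x)^* = - x^*. Proof. exact: rmorphN. Qed.
Lemma conjK (x : CC) : (x^*)^* = x. Proof. by apply: CCext; rewrite !ReImE ?opprK. Qed.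
Lemma conj1 : (1 : CC)^* = 1. Proof. exact: rmorph1. Qed.
Lemma conjR (r : RR) : (r%:C%C)^* = r%:C%C.
Proof. by apply: CCext; rewrite !ReImE ?ReR ?ImR ?oppr0. Qed.
Lemma conjV (x : CC) : (x^-1)^* = (x^*)^-1. Proof. exact: fmorphV. Qed.
Definition conjE := (conjM, conjD, conjB, conjN, conjK, conj1, conjR, conjV).

(** The radii of the metric on [CC] are complex, but a positive complex number is real, so real
    radii suffice. *)
Lemma cvgCP (T : Type) (F : set_system T) (FF : Filter F) (g : T -> CC) (l : CC) :
  g @ F --> l <-> (fun t => nm (g t - l)) @ F --> (0 : RR).
Proof.
split.
- move=> /(@cvgrPdist_lt _ (CC^o : pseudoMetricNormedZmodType CC) _ F FF) H.
  apply/cvgrPdist_lt => e e0; have e0' : 0 < e%:C%C by rewrite ltcR.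
  have := H _ e0'; apply: filterS => t.
  by rewrite normCnm ltcR sub0r normrN ger0_norm ?nm_ge0// nmB.
- move=> /cvgrPdist_lt H.
  apply/(@cvgrPdist_lt _ (CC^o : pseudoMetricNormedZmodType CC) _ F FF) => e e0.
  have [eR ei] : 0 < ReC e /\ e = (ReC e)%:C%C.
    by case: e e0 => a b; rewrite ltcE /= => /andP[/eqP -> ?].
  have := H _ eR; apply: filterS => t.
  by rewrite ei normCnm ltcR sub0r normrN ger0_norm ?nm_ge0// nmB.
Qed.

Lemma nm_lt_norm (z : CC) (r : RR) : (`|z| < r%:C%C) = (nm z < r).
Proof. by rewrite normCnm ltcR. Qed.

Lemma nm_lt1_norm (z : CC) : (`|z| < 1) = (nm z < 1).
Proof. by rewrite -nm_lt_norm. Qed.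

(** * The circle *)

Lemma ReIm_ee t : ReC (ee t) = cos (2 * pi * t) /\ ImC (ee t) = sin (2 * pi * t).
Proof.
have Ri : ReC 'i%C = 0 :> RR by [].
have Ii : ImC 'i%C = 1 :> RR by [].
by rewrite /ee ReD ImD ReM ImM Ri Ii !ReR !ImR; split; ring.
Qed.

Lemma Re_ee t : ReC (ee t) = cos (2 * pi * t). Proof. by have [] := ReIm_ee t. Qed.
Lemma Im_ee t : ImC (ee t) = sin (2 * pi * t). Proof. by have [] := ReIm_ee t. Qed.

Lemma nm_ee t : nm (ee t) = 1.
Proof. by rewrite /nm /sqn Re_ee Im_ee cos2Dsin2 sqrtr1. Qed.

Lemma ee_neq0 t : ee t != 0.
Proof. by rewrite -nm_eq0 nm_ee oner_eq0. Qed.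

Lemma eeJ t : ee t * (ee t)^* = 1.
Proof. by rewrite -sqnE -nm_sqr nm_ee expr1n. Qed.

Lemma eeV t : (ee t)^-1 = (ee t)^*.
Proof. by apply: (mulfI (ee_neq0 t)); rewrite eeJ mulfV// ee_neq0. Qed.

Lemma eeX t n : ee t ^+ n = ee (n%:R * t).
Proof.
elim: n => [|n IH].
  by apply: CCext; rewrite expr0 mul0r ?Re_ee ?Im_ee mulr0 ?cos0 ?sin0.
rewrite exprS IH; apply: CCext; rewrite ?ReM ?ImM !Re_ee !Im_ee.
  by rewrite -trigo.cosD; congr cos; rewrite -natr1; ring.
by rewrite addrC -trigo.sinD; congr sin; rewrite -natr1; ring.
Qed.

Lemma nm_kernel_ge (l : CC) t : nm l < 1 -> 1 - nm l <= nm (1 - l * (ee t)^*).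
Proof.
move=> _; have := nm_dist 1 (l * (ee t)^*).
rewrite nmM nmJ nm_ee mulr1 nm1; apply: le_trans; exact: ler_norm.
Qed.

Lemma kernel_neq0 (l : CC) t : nm l < 1 -> 1 - l * (ee t)^* != 0.
Proof. by move=> l1; rewrite -nm_gt0 (lt_le_trans _ (nm_kernel_ge t l1))// subr_gt0. Qed.

Lemma nm_kernel_dist l t : nm (1 - l * (ee t)^*) = nm (ee t - l).
Proof.
rewrite -[LHS]mulr1 -(nm_ee t) -nmM mulrBl mul1r -mulrA.
by rewrite [_^* * _]mulrC eeJ mulr1.
Qed.

(** * Complex-valued measurable functions and integrals on the circle *)

Lemma mI0 : measurable (I0 : set MR).
Proof. exact: measurable_itv. Qed.
#[local] Hint Resolve mI0 : core.

Lemma cmeas_cst (c : CC) : cmeas (fun _ => c).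
Proof. by split; exact: measurable_cst. Qed.

Lemma cmeas_real (f : MR -> RR) : measurable_fun I0 f -> cmeas (fun x => (f x)%:C%C).
Proof. by move=> mf; split => //; exact: measurable_cst. Qed.

Lemma cmeasD F G : cmeas F -> cmeas G -> cmeas (fun x => F x + G x).
Proof.
move=> [F1 F2] [G1 G2]; split.
  by under eq_fun do rewrite ReD; exact: measurable_funD.
by under eq_fun do rewrite ImD; exact: measurable_funD.
Qed.

Lemma cmeasN F : cmeas F -> cmeas (fun x => - F x).
Proof.
move=> [F1 F2]; split.
  by under eq_fun do rewrite ReN; exact: measurable_funN.
by under eq_fun do rewrite ImN; exact: measurable_funN.
Qed.

Lemma cmeasB F G : cmeas F -> cmeas G -> cmeas (fun x => F x - G x).
Proof. by move=> mF mG; apply: cmeasD => //; exact: cmeasN. Qed.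

Lemma cmeasM F G : cmeas F -> cmeas G -> cmeas (fun x => F x * G x).
Proof.
move=> [F1 F2] [G1 G2]; split.
  by under eq_fun do rewrite ReM; apply: measurable_funB; exact: measurable_funM.
by under eq_fun do rewrite ImM; apply: measurable_funD; exact: measurable_funM.
Qed.

Lemma cmeasJ F : cmeas F -> cmeas (fun x => (F x)^*).
Proof.
move=> [F1 F2]; split.
  by under eq_fun do rewrite ReJ.
by under eq_fun do rewrite ImJ; exact: measurable_funN.
Qed.

Lemma cmeas_sqn F : cmeas F -> measurable_fun I0 (fun x => sqn (F x)).
Proof. by move=> [F1 F2]; apply: measurable_funD; exact: measurable_funX. Qed.

Lemma measurable_inv (f : MR -> RR) : measurable_fun I0 f -> (forall x, 0 <= f x) ->
  measurable_fun I0 (fun x => (f x)^-1).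
Proof.
move=> mf f0; under eq_fun do rewrite -powR_inv1//.
by apply: (measurableT_comp (measurable_powR (-1))).
Qed.

Lemma measurable_sqrt (f : MR -> RR) : measurable_fun I0 f ->
  measurable_fun I0 (fun x => Num.sqrt (f x)).
Proof.
move=> mf; apply: (@measurableT_comp _ _ _ _ _ _ (@Num.sqrt RR)) => //.
by apply: continuous_measurable_fun; exact: sqrt_continuous.
Qed.

Lemma cmeas_nm F : cmeas F -> measurable_fun I0 (fun x => nm (F x)).
Proof. by move=> mF; apply: measurable_sqrt; exact: cmeas_sqn. Qed.

Lemma cmeasV F : cmeas F -> cmeas (fun x => (F x)^-1).
Proof.
move=> mF; have [F1 F2] := mF; have i := measurable_inv (cmeas_sqn mF) (fun x => sqn_ge0 _).
split.
  by under eq_fun do rewrite ReV; exact: measurable_funM.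
under eq_fun do rewrite ImV; apply: measurable_funM => //; exact: measurable_funN.
Qed.

Lemma cmeas_ee : cmeas ee.
Proof.
have c : continuous (fun x : RR => 2 * pi * x).
  by move=> x; apply: cvgM; [exact: cvg_cst|exact: cvg_id].
split.
  under eq_fun do rewrite Re_ee; apply: measurable_funTS; apply: continuous_measurable_fun.
  move=> x; apply: (continuous_comp (c x)); exact: continuous_cos.
under eq_fun do rewrite Im_ee; apply: measurable_funTS; apply: continuous_measurable_fun.
by move=> x; apply: (continuous_comp (c x)); exact: continuous_sin.
Qed.

Lemma cmeasX F n : cmeas F -> cmeas (fun x => F x ^+ n).
Proof.
move=> mF; elim: n => [|n IH]; first exact: cmeas_cst.
by under eq_fun do rewrite exprS; exact: cmeasM.
Qed.

Lemma eq_cmeas F G : (forall x, I0 x -> F x = G x) -> cmeas F -> cmeas G.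
Proof.
move=> FG [F1 F2]; split.
  by apply: eq_measurable_fun F1 => x; rewrite inE => /FG ->.
by apply: eq_measurable_fun F2 => x; rewrite inE => /FG ->.
Qed.

Lemma cmeas_kernel l : cmeas (fun x => 1 - l * (ee x)^*).
Proof.
apply: cmeasB; first exact: cmeas_cst.
by apply: cmeasM; [exact: cmeas_cst|apply: cmeasJ; exact: cmeas_ee].
Qed.

Ltac cmeas_tac := repeat first
  [ assumption | exact: cmeas_cst | exact: cmeas_ee | exact: cmeas_kernel
  | apply: cmeasB | apply: cmeasD | apply: cmeasN | apply: cmeasM | apply: cmeasJ | apply: cmeasV | apply: cmeasX ].

Section cintegral.
Variable mu : {measure set MR -> \bar RR}.

Definition L1 (F : MR -> CC) : Prop :=
  cmeas F /\ mu.-integrable I0 (fun x => (nm (F x))%:E).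

Lemma L1_Re F : L1 F -> mu.-integrable I0 (EFin \o (fun x => ReC (F x))).
Proof.
move=> [[F1 _] iF]; apply: le_integrable iF => //; first exact/measurable_EFinP.
by move=> x _ /=; rewrite lee_fin (ger0_norm (nm_ge0 _)) Re_le_nm.
Qed.

Lemma L1_Im F : L1 F -> mu.-integrable I0 (EFin \o (fun x => ImC (F x))).
Proof.
move=> [[_ F2] iF]; apply: le_integrable iF => //; first exact/measurable_EFinP.
by move=> x _ /=; rewrite lee_fin (ger0_norm (nm_ge0 _)) Im_le_nm.
Qed.

Lemma L1_nm F : L1 F -> mu.-integrable I0 (EFin \o (fun x => nm (F x))).
Proof. by case. Qed.

Lemma L1_le F (G : MR -> RR) : cmeas F -> mu.-integrable I0 (EFin \o G) ->
  (forall x, I0 x -> nm (F x) <= G x) -> L1 F.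
Proof.
move=> mF iG FG; split=> //; apply: le_integrable iG => //.
  by apply/measurable_EFinP; exact: cmeas_nm.
move=> x Ix /=; rewrite lee_fin (ger0_norm (nm_ge0 _)).
by rewrite (le_trans (FG x Ix))// ler_norm.
Qed.

Lemma L1D F G : L1 F -> L1 G -> L1 (fun x => F x + G x).
Proof.
move=> [mF iF] [mG iG]; apply: (@L1_le _ (fun x => nm (F x) + nm (G x))).
- exact: cmeasD.
- have := integrableD mI0 iF iG; apply: eq_integrable => //.
- by move=> x _; exact: nmD.
Qed.

Lemma L1N F : L1 F -> L1 (fun x => - F x).
Proof.
move=> [mF iF]; split; first exact: cmeasN.
by under eq_fun do rewrite nmN.
Qed.

Lemma L1B F G : L1 F -> L1 G -> L1 (fun x => F x - G x).
Proof. by move=> iF iG; apply: L1D => //; exact: L1N. Qed.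

Lemma L1J F : L1 F -> L1 (fun x => (F x)^*).
Proof.
move=> [mF iF]; split; first exact: cmeasJ.
by under eq_fun do rewrite nmJ.
Qed.

Lemma L1Ml F G (B : RR) : cmeas F -> (forall x, I0 x -> nm (F x) <= B) -> L1 G ->
  L1 (fun x => F x * G x).
Proof.
move=> mF FB [mG iG]; apply: (@L1_le _ (fun x => B * nm (G x))).
- exact: cmeasM.
- have := integrableZl mI0 B iG; apply: eq_integrable => //.
- by move=> x Ix; rewrite nmM ler_wpM2r ?nm_ge0// FB.
Qed.

Lemma L1Mr F G (B : RR) : cmeas F -> (forall x, I0 x -> nm (F x) <= B) -> L1 G ->
  L1 (fun x => G x * F x).
Proof. by move=> mF FB iG; under eq_fun do rewrite mulrC; exact: (L1Ml mF FB). Qed.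

Lemma L1Z c F : L1 F -> L1 (fun x => c * F x).
Proof. by move=> iF; apply: (L1Ml (B := nm c)) => //; exact: cmeas_cst. Qed.

Lemma eq_L1 F G : (forall x, I0 x -> F x = G x) -> L1 F -> L1 G.
Proof.
move=> FG [mF iF]; split; first exact: eq_cmeas mF.
by apply: eq_integrable iF => // x; rewrite inE => /FG ->.
Qed.

Lemma cintE F : cint mu I0 F = Complex (Rintegral mu I0 (fun x => ReC (F x)))
   (Rintegral mu I0 (fun x => ImC (F x))).
Proof. by rewrite [RHS]complexE. Qed.

Lemma Re_cint F : ReC (cint mu I0 F) = Rintegral mu I0 (fun x => ReC (F x)).
Proof. by rewrite cintE. Qed.
Lemma Im_cint F : ImC (cint mu I0 F) = Rintegral mu I0 (fun x => ImC (F x)).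
Proof. by rewrite cintE. Qed.

Lemma cintD F G : L1 F -> L1 G ->
  cint mu I0 (fun x => F x + G x) = cint mu I0 F + cint mu I0 G.
Proof.
move=> iF iG; apply: CCext.
  rewrite Re_cint [RHS]ReD !Re_cint; under eq_Rintegral do rewrite ReD.
  by rewrite RintegralD//; exact: L1_Re.
rewrite Im_cint [RHS]ImD !Im_cint; under eq_Rintegral do rewrite ImD.
by rewrite RintegralD//; exact: L1_Im.
Qed.

Lemma cintZ c F : L1 F -> cint mu I0 (fun x => c * F x) = c * cint mu I0 F.
Proof.
move=> iF; have R := L1_Re iF; have I := L1_Im iF.
have Z (r : RR) h : mu.-integrable I0 (EFin \o h) -> mu.-integrable I0 (EFin \o (fun x => r * h x)).
  by move=> ih; have := integrableZl mI0 r ih; apply: eq_integrable.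
apply: CCext.
  rewrite Re_cint [RHS]ReM !Re_cint !Im_cint; under eq_Rintegral do rewrite ReM.
  by rewrite RintegralB ?RintegralZl//; apply: Z.
rewrite Im_cint [RHS]ImM !Re_cint !Im_cint; under eq_Rintegral do rewrite ImM.
by rewrite RintegralD ?RintegralZl//; apply: Z.
Qed.

Lemma cintN F : L1 F -> cint mu I0 (fun x => - F x) = - cint mu I0 F.
Proof. by move=> iF; under eq_fun do rewrite -mulN1r; rewrite cintZ// mulN1r. Qed.

Lemma cintB F G : L1 F -> L1 G ->
  cint mu I0 (fun x => F x - G x) = cint mu I0 F - cint mu I0 G.
Proof. by move=> iF iG; rewrite cintD ?cintN//; exact: L1N. Qed.

Lemma cintJ F : L1 F -> cint mu I0 (fun x => (F x)^*) = (cint mu I0 F)^*.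
Proof.
move=> iF; apply: CCext.
  by rewrite Re_cint [RHS]ReJ Re_cint; apply: eq_Rintegral => x _; rewrite ReJ.
rewrite Im_cint [RHS]ImJ Im_cint; under eq_Rintegral do rewrite ImJ -mulN1r.
by rewrite RintegralZl ?mulN1r//; exact: L1_Im.
Qed.

Lemma eq_cint F G : (forall x, I0 x -> F x = G x) -> cint mu I0 F = cint mu I0 G.
Proof.
move=> FG; apply: CCext; [rewrite !Re_cint|rewrite !Im_cint];
  by apply: eq_Rintegral => x; rewrite inE => /FG ->.
Qed.

Lemma ae_eq_cint F G : cmeas F -> cmeas G -> aeq mu F G -> cint mu I0 F = cint mu I0 G.
Proof.
move=> [F1 F2] [G1 G2] FG; apply: CCext; [rewrite !Re_cint|rewrite !Im_cint]; congr fine;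
  apply: ae_eq_integral => //; try exact/measurable_EFinP;
  by apply: filterS FG => x H /H ->.
Qed.

(** The unimodular constant [u] rotates the integral to a nonnegative real number, after which only
    the real part of the integrand counts. *)
Lemma nm_cint_le F : L1 F -> nm (cint mu I0 F) <= Rintegral mu I0 (fun x => nm (F x)).
Proof.
move=> iF; have [->|c0] := eqVneq (cint mu I0 F) 0.
  by rewrite nm0 Rintegral_ge0// => x _; exact: nm_ge0.
set c := cint mu I0 F in c0 *.
have nc0 : 0 < nm c by rewrite nm_gt0.
pose u := c^* / (nm c)%:C%C.
have uc : u * c = (nm c)%:C%C.
  by rewrite /u mulrAC [_^* * _]mulrC -sqnE -nm_sqr rmorphXn/= expr2 mulfK// -nm_eq0 nm_real gt_eqF// normr_gt0 gt_eqF.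
have nu : nm u = 1 by rewrite /u nmM nmJ nmV nm_real ger0_norm ?nm_ge0// divff// gt_eqF.
have -> : nm c = ReC (u * c) by rewrite uc.
rewrite /c -cintZ// Re_cint; apply: le_Rintegral => //.
- by apply: L1_Re; exact: L1Z.
- exact: L1_nm.
- by move=> x _; rewrite (le_trans (ler_norm _))// (le_trans (Re_le_nm _))// nmM nu mul1r.
Qed.

End cintegral.

Section finite_cintegral.
Variable mu : {measure set MR -> \bar RR}.
Hypothesis fmu : (mu I0 < +oo)%E.

Lemma integrable_cstI0 (B : RR) : mu.-integrable I0 (EFin \o (fun _ => B)).
Proof.
apply: measurable_bounded_integrable => //.
by exists `|B|; split=> [|M BM x _ /=]; rewrite ?num_real// ltW.
Qed.

Lemma L1_bdd F (B : RR) : cmeas F -> (forall x, I0 x -> nm (F x) <= B) -> L1 mu F.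
Proof. by move=> mF FB; apply: (L1_le mF (integrable_cstI0 B)). Qed.

Lemma L1_cst c : L1 mu (fun _ => c).
Proof. by apply: (@L1_bdd _ (nm c)) => //; exact: cmeas_cst. Qed.

Lemma L2_L1 F : L2 mu F -> L1 mu F.
Proof.
move=> [mF iF]; apply: (@L1_le _ _ (fun x => sqn (F x) + 1)) => //.
  have := integrableD mI0 iF (integrable_cstI0 1); apply: eq_integrable => //.
move=> x _; rewrite -nm_sqr; have := sqr_ge0 (nm (F x) - 1); nra.
Qed.
End finite_cintegral.

Section L2.
Variable mu : {measure set MR -> \bar RR}.

Lemma L2M F G : L2 mu F -> L2 mu G -> L1 mu (fun x => F x * G x).
Proof.
move=> [mF iF] [mG iG]; apply: (@L1_le _ _ (fun x => sqn (F x) + sqn (G x))).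
- exact: cmeasM.
- by have := integrableD mI0 iF iG; apply: eq_integrable.
- move=> x _; rewrite nmM -!nm_sqr.
  have := sqr_ge0 (nm (F x) - nm (G x)); have := nm_ge0 (F x); have := nm_ge0 (G x); nra.
Qed.

Lemma L2J F : L2 mu F -> L2 mu (fun x => (F x)^*).
Proof.
move=> [mF iF]; split; first exact: cmeasJ.
by under eq_fun do rewrite -nm_sqr nmJ nm_sqr.
Qed.

Lemma L2MJ F G : L2 mu F -> L2 mu G -> L1 mu (fun x => F x * (G x)^*).
Proof. by move=> iF iG; apply: L2M => //; exact: L2J. Qed.

Lemma L2_le F (G : MR -> RR) : cmeas F -> mu.-integrable I0 (EFin \o G) ->
  (forall x, I0 x -> sqn (F x) <= G x) -> L2 mu F.
Proof.
move=> mF iG FG; split=> //; apply: le_integrable iG => //.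
  by apply/measurable_EFinP; exact: cmeas_sqn.
move=> x Ix /=; rewrite lee_fin (ger0_norm (sqn_ge0 _)).
by rewrite (le_trans (FG x Ix))// ler_norm.
Qed.

Lemma L2D F G : L2 mu F -> L2 mu G -> L2 mu (fun x => F x + G x).
Proof.
move=> [mF iF] [mG iG]; apply: (@L2_le _ (fun x => 2 * (sqn (F x) + sqn (G x)))).
- exact: cmeasD.
- by have := integrableZl mI0 2 (integrableD mI0 iF iG); apply: eq_integrable.
- move=> x _; rewrite /sqn ReD ImD.
  have := sqr_ge0 (ReC (F x) - ReC (G x)); have := sqr_ge0 (ImC (F x) - ImC (G x)); nra.
Qed.

Lemma L2Ml F G (B : RR) : cmeas F -> (forall x, I0 x -> nm (F x) <= B) -> L2 mu G ->
  L2 mu (fun x => F x * G x).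
Proof.
move=> mF FB [mG iG]; apply: (@L2_le _ (fun x => B ^+ 2 * sqn (G x))).
- exact: cmeasM.
- by have := integrableZl mI0 (B ^+ 2) iG; apply: eq_integrable.
- move=> x Ix; rewrite -!nm_sqr nmM exprMn ler_wpM2r ?sqr_ge0//.
  by rewrite ler_sqr ?nnegrE ?nm_ge0 ?FB// (le_trans (nm_ge0 _) (FB x Ix)).
Qed.

Lemma L2Z c F : L2 mu F -> L2 mu (fun x => c * F x).
Proof. by move=> iF; apply: (L2Ml (B := nm c)) => //; exact: cmeas_cst. Qed.

Lemma L2N F : L2 mu F -> L2 mu (fun x => - F x).
Proof. by move=> iF; under eq_fun do rewrite -mulN1r; exact: L2Z. Qed.

Lemma L2B F G : L2 mu F -> L2 mu G -> L2 mu (fun x => F x - G x).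
Proof. by move=> iF iG; apply: L2D => //; exact: L2N. Qed.

Lemma eq_L2 F G : (forall x, I0 x -> F x = G x) -> L2 mu F -> L2 mu G.
Proof.
move=> FG [mF iF]; split; first exact: eq_cmeas mF.
by apply: eq_integrable iF => // x; rewrite inE => /FG ->.
Qed.

Lemma L2_bdd F (B : RR) : (mu I0 < +oo)%E -> cmeas F -> (forall x, I0 x -> nm (F x) <= B) ->
  L2 mu F.
Proof.
move=> fmu mF FB; apply: (L2_le mF (integrable_cstI0 fmu (B ^+ 2))) => x Ix.
rewrite -nm_sqr ler_sqr ?nnegrE ?nm_ge0 ?FB//; exact: le_trans (nm_ge0 _) (FB x Ix).
Qed.

Lemma ipC F G : L2 mu F -> L2 mu G -> ip mu G F = (ip mu F G)^*.
Proof.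
move=> iF iG; rewrite /ip -cintJ; last exact: L2MJ.
by apply: eq_cint => x _; rewrite conjM conjK mulrC.
Qed.

Lemma ipDl F G H : L2 mu F -> L2 mu G -> L2 mu H ->
  ip mu (fun x => F x + G x) H = ip mu F H + ip mu G H.
Proof.
move=> iF iG iH; rewrite /ip -cintD; [|exact: L2MJ|exact: L2MJ].
by apply: eq_cint => x _; rewrite mulrDl.
Qed.

Lemma ipZl c F G : L2 mu F -> L2 mu G -> ip mu (fun x => c * F x) G = c * ip mu F G.
Proof.
move=> iF iG; rewrite /ip -cintZ; last exact: L2MJ.
by apply: eq_cint => x _; rewrite mulrA.
Qed.

Lemma ipDr F G H : L2 mu F -> L2 mu G -> L2 mu H ->
  ip mu H (fun x => F x + G x) = ip mu H F + ip mu H G.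
Proof.
by move=> iF iG iH; rewrite (ipC (L2D iF iG) iH) ipDl// conjD -!ipC.
Qed.
End L2.

(** * Limits of complex-valued functions and dominated convergence *)

Section cvgC.
Context (T : Type) (F : set_system T) (FF : ProperFilter F).

Lemma cvgC_unique (g : T -> CC) (a b : CC) : g @ F --> a -> g @ F --> b -> a = b.
Proof.
move=> /cvgCP ga /cvgCP gb; apply/eqP; rewrite -subr_eq0 -nm_eq0.
have h : (fun t => nm (g t - a) + nm (g t - b)) @ F --> (0 + 0 : RR) by exact: cvgD.
rewrite eq_le nm_ge0 andbT -[leRHS](addr0 0).
apply: (cvgr_to_ge h); apply: nearW => t.
by rewrite [nm (g t - a)]nmB; exact: nm_triangle.
Qed.

Lemma cvgC_Re (g : T -> CC) (l : CC) : g @ F --> l -> (fun t => ReC (g t)) @ F --> ReC l.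
Proof.
move=> /cvgCP /cvgrPdist_lt H; apply/cvgrPdist_lt => e e0.
have := H e e0; apply: filterS => t; rewrite sub0r normrN ger0_norm ?nm_ge0//.
by apply: le_lt_trans; rewrite distrC -ReN -ReD Re_le_nm.
Qed.

Lemma cvgC_Im (g : T -> CC) (l : CC) : g @ F --> l -> (fun t => ImC (g t)) @ F --> ImC l.
Proof.
move=> /cvgCP /cvgrPdist_lt H; apply/cvgrPdist_lt => e e0.
have := H e e0; apply: filterS => t; rewrite sub0r normrN ger0_norm ?nm_ge0//.
by apply: le_lt_trans; rewrite distrC -ImN -ImD Im_le_nm.
Qed.

Lemma cvgC_ReIm (g : T -> CC) (l : CC) : (fun t => ReC (g t)) @ F --> ReC l ->
  (fun t => ImC (g t)) @ F --> ImC l -> g @ F --> l.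
Proof.
move=> /cvgrPdist_lt R /cvgrPdist_lt I; apply/cvgCP/cvgrPdist_lt => e e0.
have e2 : 0 < e / 2 by lra.
have := R _ e2; apply: filterS2 (I _ e2) => t h1 h2.
rewrite sub0r normrN ger0_norm ?nm_ge0//.
apply: (le_lt_trans (nm_le_ReIm _)); rewrite ReD ReN ImD ImN.
by rewrite distrC [X in _ + X]distrC; lra.
Qed.

Lemma cvgC_nm (g : T -> CC) (l : CC) : g @ F --> l -> (fun t => nm (g t)) @ F --> nm l.
Proof.
move=> /cvgCP /cvgrPdist_lt H; apply/cvgrPdist_lt => e e0.
have := H e e0; apply: filterS => t; rewrite sub0r normrN ger0_norm ?nm_ge0//.
by apply: le_lt_trans; rewrite distrC nm_dist.
Qed.

Lemma cvgC_cst (l : CC) : (fun _ : T => l) @ F --> l.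
Proof. exact: cvg_cst. Qed.

Lemma cvgCD (f g : T -> CC) (a b : CC) : f @ F --> a -> g @ F --> b ->
  (fun t => f t + g t) @ F --> a + b.
Proof.
move=> fa ga; apply: cvgC_ReIm.
  by under eq_fun do rewrite ReD; rewrite ReD; apply: cvgD; exact: cvgC_Re.
by under eq_fun do rewrite ImD; rewrite ImD; apply: cvgD; exact: cvgC_Im.
Qed.

Lemma cvgCM (f g : T -> CC) (a b : CC) : f @ F --> a -> g @ F --> b ->
  (fun t => f t * g t) @ F --> a * b.
Proof.
move=> fa ga; have := (cvgC_Re fa, cvgC_Im fa, cvgC_Re ga, cvgC_Im ga) => -[[[fR fI] gR] gI].
apply: cvgC_ReIm.
  by under eq_fun do rewrite ReM; rewrite ReM; apply: cvgB; exact: cvgM.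
by under eq_fun do rewrite ImM; rewrite ImM; apply: cvgD; exact: cvgM.
Qed.

Lemma cvgCJ (f : T -> CC) (a : CC) : f @ F --> a -> (fun t => (f t)^*) @ F --> a^*.
Proof.
move=> fa; apply: cvgC_ReIm.
  by under eq_fun do rewrite ReJ; rewrite ReJ; exact: cvgC_Re.
by under eq_fun do rewrite ImJ; rewrite ImJ; apply: cvgN; exact: cvgC_Im.
Qed.

Lemma cvgCN (f : T -> CC) (a : CC) : f @ F --> a -> (fun t => - f t) @ F --> - a.
Proof.
move=> fa; apply: cvgC_ReIm.
  by under eq_fun do rewrite ReN; rewrite ReN; apply: cvgN; exact: cvgC_Re.
by under eq_fun do rewrite ImN; rewrite ImN; apply: cvgN; exact: cvgC_Im.
Qed.

Lemma cvgCB (f g : T -> CC) (a b : CC) : f @ F --> a -> g @ F --> b ->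
  (fun t => f t - g t) @ F --> a - b.
Proof. by move=> fa ga; exact: (cvgCD fa (cvgCN ga)). Qed.

Lemma cvgCV (f : T -> CC) (a : CC) : a != 0 -> f @ F --> a ->
  (fun t => (f t)^-1) @ F --> a^-1.
Proof.
move=> a0 fa; have [fR fI] := (cvgC_Re fa, cvgC_Im fa).
have fs : (fun t => sqn (f t)) @ F --> sqn a.
  by apply: cvgD; under eq_fun do rewrite expr2; rewrite expr2; exact: cvgM.
have s0 : sqn a != 0 by rewrite -nm_sqr expf_neq0// nm_eq0.
apply: cvgC_ReIm.
  by under eq_fun do rewrite ReV; rewrite ReV; apply: cvgM => //; exact: cvgV.
under eq_fun do rewrite ImV; rewrite ImV; apply: cvgM; [exact: cvgN|exact: cvgV].
Qed.

Lemma cvgC_real (f : T -> RR) (a : RR) : f @ F --> a -> (fun t => (f t)%:C%C) @ F --> a%:C%C.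
Proof. by move=> fa; apply: cvgC_ReIm => //; exact: cvg_cst. Qed.

Lemma cvgC_near (f g : T -> CC) (a : CC) : (\forall t \near F, f t = g t) -> f @ F --> a -> g @ F --> a.
Proof.
move=> fg /cvgCP fa; apply/cvgCP; apply: cvg_trans fa; apply: near_eq_cvg.
by apply: filterS fg => t ->.
Qed.

Lemma cvgC_le (f : T -> CC) (a : CC) (B : RR) : f @ F --> a -> (\forall t \near F, nm (f t) <= B) ->
  nm a <= B.
Proof. by move=> /cvgC_nm fa; exact: (cvgr_to_le fa). Qed.
End cvgC.

Lemma Rintegral_dct (mu : {measure set MR -> \bar RR}) (Fn : nat -> MR -> RR) (F G : MR -> RR) :
  (forall n, measurable_fun I0 (Fn n)) -> measurable_fun I0 F ->
  mu.-integrable I0 (EFin \o G) -> (forall n x, I0 x -> `|Fn n x| <= G x) ->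
  {ae mu, forall x, I0 x -> (fun n => Fn n x) @ \oo --> F x} ->
  (fun n => Rintegral mu I0 (Fn n)) @ \oo --> Rintegral mu I0 F.
Proof.
move=> mFn mF iG FG FnF.
have [|||||iF _ H] := @dominated_convergence _ _ RR mu I0 mI0
  (fun n => EFin \o Fn n) (EFin \o F) (EFin \o G).
- by move=> n; exact/measurable_EFinP.
- exact/measurable_EFinP.
- by apply: filterS FnF => x H Ix /=; apply: cvg_EFin; [exact: nearW|exact: H].
- exact: iG.
- by apply/aeW => x n Ix /=; rewrite lee_fin FG.
apply: fine_cvg; rewrite fineK//; exact: integrable_fin_num.
Qed.

Lemma cint_dct (mu : {measure set MR -> \bar RR}) (Fn : nat -> MR -> CC) (F : MR -> CC) (G : MR -> RR) :
  (forall n, cmeas (Fn n)) -> cmeas F ->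
  mu.-integrable I0 (EFin \o G) -> (forall n x, I0 x -> nm (Fn n x) <= G x) ->
  {ae mu, forall x, I0 x -> (fun n => Fn n x) @ \oo --> F x} ->
  (fun n => cint mu I0 (Fn n)) @ \oo --> cint mu I0 F.
Proof.
move=> mFn mF iG FG FnF; apply: cvgC_ReIm.
  under eq_fun do rewrite Re_cint; rewrite Re_cint.
  apply: (Rintegral_dct _ _ iG); [by move=> n; case: (mFn n)|by case: mF| |].
    by move=> n x Ix; rewrite (le_trans (Re_le_nm _))// FG.
  by apply: filterS FnF => x H Ix; apply: cvgC_Re; exact: H.
under eq_fun do rewrite Im_cint; rewrite Im_cint.
apply: (Rintegral_dct _ _ iG); [by move=> n; case: (mFn n)|by case: mF| |].
  by move=> n x Ix; rewrite (le_trans (Im_le_nm _))// FG.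
by apply: filterS FnF => x H Ix; apply: cvgC_Im; exact: H.
Qed.

(** * Uniform limits of polynomials on compact subdiscs *)

(** An encoding of holomorphy in the open disc without derivatives: Parseval's and Poisson's
    formulas are checked on polynomials and passed to the uniform limit. *)
Definition discA (F : CC -> CC) : Prop := forall r e : RR, 0 <= r -> r < 1 -> 0 < e ->
  exists p : {poly CC}, forall z, nm z <= r -> nm (F z - p.[z]) <= e.

Lemma nm_sum (n : nat) (F : 'I_n -> CC) : nm (\sum_i F i) <= \sum_i nm (F i).
Proof.
elim: n F => [|n IH] F; first by rewrite !big_ord0 nm0.
by rewrite !big_ord_recl (le_trans (nmD _ _))// lerD2l IH.
Qed.

Lemma nm_horner_le (p : {poly CC}) (z : CC) : nm z <= 1 -> nm p.[z] <= \sum_(i < size p) nm p`_i.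
Proof.
move=> z1; rewrite horner_coef (le_trans (nm_sum _))//; apply: ler_sum => i _.
by rewrite nmM nmX ler_piMr ?nm_ge0// exprn_ile1// nm_ge0.
Qed.

Lemma discA_bdd F r : discA F -> 0 <= r -> r < 1 ->
  exists2 B, 0 < B & forall z, nm z <= r -> nm (F z) <= B.
Proof.
move=> dF r0 r1; have [p Hp] := dF r 1 r0 r1 ltr01.
exists (1 + \sum_(i < size p) nm p`_i).
  by rewrite ltr_wpDr// sumr_ge0// => i _; exact: nm_ge0.
move=> z zr; rewrite -(subrK p.[z] (F z)) (le_trans (nmD _ _))// lerD ?Hp//.
by rewrite nm_horner_le// (le_trans zr)// ltW.
Qed.

Lemma eq_discA F G : (forall z, nm z < 1 -> F z = G z) -> discA F -> discA G.
Proof.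
move=> FG dF r e r0 r1 e0; have [p Hp] := dF r e r0 r1 e0.
by exists p => z zr; rewrite -FG ?Hp// (le_lt_trans zr).
Qed.

Lemma discA_poly (p : {poly CC}) : discA (horner p).
Proof. by move=> r e _ _ e0; exists p => z _; rewrite subrr nm0 ltW. Qed.

Lemma discA_cst c : discA (fun _ => c).
Proof. by apply: eq_discA (discA_poly c%:P) => z _; rewrite hornerC. Qed.

Lemma discAD F G : discA F -> discA G -> discA (fun z => F z + G z).
Proof.
move=> dF dG r e r0 r1 e0; have e2 : 0 < e / 2 by lra.
have [p Hp] := dF r _ r0 r1 e2; have [q Hq] := dG r _ r0 r1 e2.
exists (p + q) => z zr; rewrite hornerD opprD addrACA (le_trans (nmD _ _))//.
by have := Hp z zr; have := Hq z zr; lra.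
Qed.

Lemma discAM F G : discA F -> discA G -> discA (fun z => F z * G z).
Proof.
move=> dF dG r e r0 r1 e0.
have [B B0 HB] := discA_bdd dG r0 r1; have [A A0 HA] := discA_bdd dF r0 r1.
(* The cap 1 bounds the polynomial [p] by [A + 1] on the disc of radius [r], which fixes the
   tolerance for [q]. *)
have e1 : 0 < Num.min 1 (e / (2 * B)) by rewrite lt_min ltr01 divr_gt0// mulr_gt0.
have [p Hp] := dF r _ r0 r1 e1.
have e2 : 0 < e / (2 * (A + 1)) by rewrite divr_gt0// mulr_gt0// addr_gt0.
have [q Hq] := dG r _ r0 r1 e2.
exists (p * q) => z zr; rewrite hornerM.
have -> : F z * G z - p.[z] * q.[z] = (F z - p.[z]) * G z + p.[z] * (G z - q.[z]) by ring.
apply: (le_trans (nmD _ _)); rewrite !nmM.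
have h1 : nm (F z - p.[z]) * nm (G z) <= e / 2.
  apply: (@le_trans _ _ (e / (2 * B) * B)); last by rewrite invfM mulrA mulfVK ?gt_eqF.
  apply: ler_pM; rewrite ?nm_ge0 ?HB// (le_trans (Hp z zr))//.
  by rewrite ge_min lexx orbT.
have h2 : nm p.[z] * nm (G z - q.[z]) <= e / 2.
  apply: (@le_trans _ _ ((A + 1) * (e / (2 * (A + 1))))); last first.
    by rewrite mulrC invfM mulrA mulfVK ?gt_eqF// addr_gt0.
  apply: ler_pM; rewrite ?nm_ge0 ?Hq//.
  have -> : p.[z] = F z - (F z - p.[z]) by ring.
  rewrite (le_trans (nmBle _ _))// lerD ?HA// (le_trans (Hp z zr))//.
  by rewrite ge_min lexx.
lra.
Qed.

Lemma discAZ c F : discA F -> discA (fun z => c * F z).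
Proof. by move=> dF; apply: discAM => //; exact: discA_cst. Qed.

Lemma discAB F G : discA F -> discA G -> discA (fun z => F z - G z).
Proof.
move=> dF dG; apply: discAD => //.
by apply: eq_discA (discAZ (-1) dG) => z _; rewrite mulN1r.
Qed.

Lemma discAX F n : discA F -> discA (fun z => F z ^+ n).
Proof.
move=> dF; elim: n => [|n IH]; first exact: discA_cst.
by apply: eq_discA (discAM dF IH) => z _; rewrite exprS.
Qed.

Lemma discA_sum n (F : 'I_n -> CC -> CC) : (forall i, discA (F i)) -> discA (fun z => \sum_i F i z).
Proof.
elim: n F => [|n IH] F dF.
  by apply: eq_discA (discA_cst 0) => z _; rewrite big_ord0.
apply: eq_discA (discAD (dF ord0) (IH _ (fun i => dF (lift ord0 i)))) => z _.
by rewrite big_ord_recl.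
Qed.

Lemma discA_lim F : (forall r e : RR, 0 <= r -> r < 1 -> 0 < e ->
  exists2 G, discA G & forall z, nm z <= r -> nm (F z - G z) <= e) -> discA F.
Proof.
move=> H r e r0 r1 e0; have e2 : 0 < e / 2 by lra.
have [G dG FG] := H r _ r0 r1 e2; have [p Hp] := dG r _ r0 r1 e2.
exists p => z zr; rewrite (le_trans (nm_triangle (G z) _ _))//.
by have := FG z zr; have := Hp z zr; lra.
Qed.

Lemma expr_small (q c e : RR) : 0 <= q -> q < 1 -> 0 < e -> exists N, c * q ^+ N <= e.
Proof.
move=> q0 q1 e0; have h : `|q| < 1 by rewrite ger0_norm.
have /cvgr0Pnorm_le /(_ e e0) [N _ /(_ N (leqnn N))/= H] := @cvg_geometric RR c q h.
by exists N; exact: le_trans (ler_norm _) H.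
Qed.

Lemma geometric_rem (a : CC) n : a != 1 -> (1 - a)^-1 - \sum_(i < n) a ^+ i = a ^+ n / (1 - a).
Proof.
move=> a1; have h : 1 - a != 0 by rewrite subr_eq0 eq_sym.
apply: (mulIf h); rewrite mulrBl mulVf// mulfVK//.
by rewrite -[a ^+ n](subrK 1) subrX1; ring.
Qed.

(* The Neumann series of 1/F = M^-1 / (1 - (1 - F/M)) converges uniformly as soon as Re F >= d > 0 and M is large. *)
Lemma discAV F (d : RR) : 0 < d -> (forall z, nm z < 1 -> d <= ReC (F z)) ->
  discA F -> discA (fun z => (F z)^-1).
Proof.
move=> d0 Fd dF; apply: discA_lim => r e r0 r1 e0.
have [B B0 HB] := discA_bdd dF r0 r1.
(* From [B ^+ 2 / M <= d] follows [|1 - F / M|^2 <= 1 - 2 d / M + B ^+ 2 / M ^+ 2 <= 1 - d / M]; the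
   summand [d] keeps the last expression nonnegative. *)
pose M := B ^+ 2 / d + d + 1.
have M0 : 0 < M by rewrite /M addr_gt0// addr_gt0// divr_gt0// exprn_gt0.
have dM : d / M <= 1.
  by rewrite ler_pdivrMr// mul1r /M -addrA addrCA lerDl addr_ge0// divr_ge0// ?ltW// exprn_gt0.
pose q := Num.sqrt (1 - d / M).
have q1 : q < 1.
  by rewrite -sqrtr1 ltr_sqrt// gtrBl divr_gt0.
have [N HN] := expr_small d^-1 (sqrtr_ge0 _) q1 e0.
exists (fun z => (M%:C%C)^-1 * \sum_(i < N) (1 - F z / M%:C%C) ^+ i).
  apply: discAZ; apply: discA_sum => i; apply: discAX; apply: discAB; first exact: discA_cst.
  by apply: discAM => //; exact: discA_cst.
move=> z zr; have z1 : nm z < 1 by exact: le_lt_trans r1.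
have F0 : F z != 0.
  rewrite -nm_gt0 (lt_le_trans d0)// (le_trans (Fd z z1))// (le_trans (ler_norm _))//.
  exact: Re_le_nm.
have MC : M%:C%C != 0 by rewrite -nm_eq0 nm_real normr_eq0 gt_eqF.
have a1 : 1 - F z / M%:C%C != 1.
  by rewrite -subr_eq0 addrAC subrr sub0r oppr_eq0 mulf_neq0// invr_eq0.
have -> : (F z)^-1 = (M%:C%C)^-1 * (1 - (1 - F z / M%:C%C))^-1.
  by rewrite opprB addrCA subrr addr0 invf_div mulrA mulVf// mul1r.
rewrite -mulrBr geometric_rem// opprB addrCA subrr addr0 invf_div mulrCA [_ * (_ / _)]mulrA mulVf// mul1r.
rewrite nmM nmX nmV mulrC; apply: le_trans HN; apply: ler_pM.
- by rewrite invr_ge0 nm_ge0.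
- by rewrite exprn_ge0// nm_ge0.
- rewrite lef_pV2 ?posrE// ?nm_gt0// (le_trans (Fd z z1))// (le_trans (ler_norm _))//.
  exact: Re_le_nm.
- apply: lerXn2r; rewrite ?nnegrE ?nm_ge0 ?sqrtr_ge0//.
  rewrite -[leLHS]ger0_norm ?nm_ge0// -sqrtr_sqr ler_sqrt; last by rewrite subr_ge0.
  rewrite nm_sqr; have := Fd z z1; have := HB z zr.
  rewrite -(@ler_sqr _ (nm _)) ?nnegrE ?nm_ge0 ?(ltW B0)// nm_sqr /sqn.
  have -> : F z / M%:C%C = (M^-1)%:C%C * F z by rewrite mulrC fmorphV.
  rewrite ReD ReN ReM ImD ImN ImM !ReR !ImR.
  move: (ReC (F z)) (ImC (F z)) => u v uvB du.
  have MB : B ^+ 2 * M^-1 <= d.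
    by rewrite ler_pdivrMr// /M !mulrDr mulrCA mulfV ?gt_eqF// mulr1 -addrA lerDl addr_ge0// mulr_ge0// ltW.
  have MV : 0 < M^-1 by rewrite invr_gt0.
  have -> : (1 - (M^-1 * u - 0 * v)) ^+ 2 + (0 - (M^-1 * v + 0 * u)) ^+ 2 =
    1 - 2 * M^-1 * u + M^-1 * (M^-1 * (u ^+ 2 + v ^+ 2)) by ring.
  nra.
Qed.

(** * Cauchy and Poisson kernels *)

Lemma leb_I0 : leb I0 = 1%E.
Proof. by rewrite /leb /I0 lebesgue_measure_itv/= lte_fin ltr01 oppr0 adde0. Qed.

Lemma leb_I0_lty : (leb I0 < +oo)%E.
Proof. by rewrite leb_I0 ltry. Qed.
#[local] Hint Resolve leb_I0_lty : core.

Lemma Rintegral_leb_cst r : Rintegral leb I0 (fun _ => r) = r.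
Proof.
have -> : Rintegral leb I0 (fun _ => r) = r * fine (leb I0) by exact: Rintegral_cst.
by rewrite leb_I0 mulr1.
Qed.

Lemma cint_leb_cst c : cint leb I0 (fun _ => c) = c.
Proof. by apply: CCext; rewrite ?Re_cint ?Im_cint Rintegral_leb_cst. Qed.

Lemma ee1 : ee 1 = 1.
Proof.
apply: CCext; rewrite ?Re_ee ?Im_ee mulr1 mulr_natl mulr2n.
  by rewrite trigo.cosD cospi sinpi mulr0 subr0 mulrNN mulr1.
by rewrite trigo.sinD cospi sinpi mulr0 mul0r addr0.
Qed.

Lemma integral_cos_sin (R : realType) (c : R) : c != 0 ->
  Rintegral (@lebesgue_measure R) `[0, 1[ (fun t => cos (c * t)) = sin c / c /\
  Rintegral (@lebesgue_measure R) `[0, 1[ (fun t => sin (c * t)) = (1 - cos c) / c.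
Proof.
move=> c0.
have der (t : R) : is_derive t 1 (fun x : R => c * x) c.
  have -> : (fun x : R => c * x) = c \*: id by [].
  by apply: is_derive_eq; rewrite /GRing.scale/= mulr1.
have cont (h : R -> R) : continuous h -> continuous (fun t => h (c * t)).
  move=> ch t; apply: (continuous_comp (f := fun t => c * t)); last exact: ch.
  by apply: cvgM; [exact: cvg_cst|exact: cvg_id].
have FTC (F f : R -> R) : (forall t : R, is_derive t 1 F (f t)) -> continuous f -> continuous F ->
    Rintegral (@lebesgue_measure R) `[0, 1[ f = F 1 - F 0.
  move=> dF cf cF; rewrite Rintegral_itv_bndo_bndc; last first.
    have : (@lebesgue_measure R).-integrable `[0, 1] (EFin \o f).
      apply: continuous_compact_integrable; first exact: segment_compact.
      exact: continuous_subspaceT.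
    apply: integrableS => //.
    by move=> x /=; rewrite !in_itv/= => /andP[-> /ltW].
  rewrite /Rintegral (@continuous_FTC2 _ _ F)//.
  - exact: continuous_subspaceT.
  - split; [by move=> x _; have := dF x|apply: cvg_at_right_filter; exact: cF|apply: cvg_at_left_filter; exact: cF].
  - by move=> x _; rewrite derive1E; have := dF x => -[].
have dS (t : R) : is_derive t 1 (fun t => sin (c * t) / c) (cos (c * t)).
  have -> : (fun t => sin (c * t) / c) = c^-1 \*: (sin \o (fun x => c * x)).
    by apply/funext => x /=; rewrite mulrC.
  by apply: is_derive_eq; rewrite /GRing.scale/= [_ * c]mulrC mulKf.
have dC (t : R) : is_derive t 1 (fun t => - cos (c * t) / c) (sin (c * t)).
  have -> : (fun t => - cos (c * t) / c) = (- c^-1) \*: (cos \o (fun x => c * x)).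
    by apply/funext => x /=; rewrite /GRing.scale/= mulrC mulrN mulNr.
  by apply: is_derive_eq; rewrite /GRing.scale/=; field.
split.
  rewrite (FTC _ _ dS).
  - by rewrite mulr0 sin0 mul0r subr0 mulr1.
  - by apply: cont; exact: continuous_cos.
  - move=> t; apply: cvgM; last exact: cvg_cst.
    by apply: (cont sin); exact: continuous_sin.
rewrite (FTC _ _ dC).
- by rewrite mulr0 cos0 mulr1 -mulrBl opprK addrC.
- by apply: cont; exact: continuous_sin.
- move=> t; apply: cvgM; last exact: cvg_cst.
  by apply: cvgN; apply: (cont cos); exact: continuous_cos.
Qed.

Lemma cint_eeX n : cint leb I0 (fun t => ee t ^+ n) = (n == 0%N)%:R.
Proof.
case: n => [|n].
  by rewrite -[RHS]cint_leb_cst; apply: eq_cint.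
have c0 : 2 * pi * n.+1%:R != 0 :> RR by rewrite !mulf_neq0// ?gt_eqF ?pi_gt0.
have [C S] := integral_cos_sin c0.
have e1 : ee n.+1%:R = 1 by rewrite -[n.+1%:R]mulr1 -eeX ee1 expr1n.
have C1 : cos (2 * pi * n.+1%:R) = 1 :> RR by rewrite -Re_ee e1.
have S1 : sin (2 * pi * n.+1%:R) = 0 :> RR by rewrite -Im_ee e1.
apply: CCext.
  rewrite Re_cint; under eq_Rintegral do rewrite eeX Re_ee mulrA.
  by rewrite C S1 mul0r.
rewrite Im_cint; under eq_Rintegral do rewrite eeX Im_ee mulrA.
by rewrite S C1 subrr mul0r.
Qed.

Lemma nm_eeX t n : nm (ee t ^+ n) = 1. Proof. by rewrite nmX nm_ee expr1n. Qed.
Lemma nm_eeJ t : nm (ee t)^* = 1. Proof. by rewrite nmJ nm_ee. Qed.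
Lemma eeX_bdd n t : I0 t -> nm (ee t ^+ n) <= 1. Proof. by rewrite nm_eeX. Qed.
Lemma H2P G : H2 G <-> L2 leb G /\ forall n, cint leb I0 (fun t => G t * ee t ^+ n.+1) = 0.
Proof.
split=> -[LG HG]; split=> //.
  by move=> n; rewrite -[RHS](HG (Negz n)).
by case=> // n _; rewrite -[RHS](HG n).
Qed.

Definition ker (l : CC) (t : MR) : CC := (1 - l * (ee t)^*)^-1.

Lemma cmeas_ker l : cmeas (ker l).
Proof. by rewrite /ker; apply: cmeasV; exact: cmeas_kernel. Qed.

Lemma nm_ker_le l t : nm l < 1 -> nm (ker l t) <= (1 - nm l)^-1.
Proof.
move=> l1; rewrite /ker nmV lef_pV2 ?posrE ?subr_gt0//; first exact: nm_kernel_ge.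
by rewrite nm_gt0 kernel_neq0.
Qed.

Lemma kerE l t : nm l < 1 -> ker l t = 1 + l * (ee t)^* * ker l t.
Proof.
move=> l1; have h := kernel_neq0 t l1; apply: (mulIf h).
have KD : ker l t * (1 - l * (ee t)^*) = 1 by exact: mulVf.
by rewrite KD mulrDl mul1r -[_ * ker l t * _]mulrA KD; ring.
Qed.

(** Takes the place of expanding the Cauchy kernel into a geometric series: [kerE] yields this
    recursion for moments against the kernel, and iterating it leaves only 0 among bounded
    solutions. *)
Lemma geo_zero (a : nat -> CC) (l : CC) (B : RR) : nm l < 1 ->
  (forall n, a n = l * a n.+1) -> (forall n, nm (a n) <= B) -> a 0%N = 0.
Proof.
move=> l1 al aB; apply/eqP; rewrite -nm_eq0 eq_le nm_ge0 andbT.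
apply/ler_addgt0Pr => e e0; rewrite add0r.
have [N] := expr_small B (nm_ge0 l) l1 e0; apply: le_trans.
have -> : a 0%N = l ^+ N * a N.
  elim: N => [|N ->]; first by rewrite expr0 mul1r.
  by rewrite [a N]al exprSr mulrA.
by rewrite nmM nmX mulrC ler_wpM2r// exprn_ge0// nm_ge0.
Qed.

Section Cauchy.
Variable mu : {measure set MR -> \bar RR}.

Definition cauchy (G : MR -> CC) (l : CC) : CC := cint mu I0 (fun t => G t * ker l t).

Lemma L1_ker G l : nm l < 1 -> L1 mu G -> L1 mu (fun t => G t * ker l t).
Proof.
move=> l1 iG; apply: (L1Mr (B := (1 - nm l)^-1)) => //; first exact: cmeas_ker.
by move=> t _; exact: nm_ker_le.
Qed.

Lemma L1_kerJ G l : nm l < 1 -> L1 mu G -> L1 mu (fun t => G t * (ker l t)^*).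
Proof.
move=> l1 iG; apply: (L1Mr (B := (1 - nm l)^-1)) => //.
  by apply: cmeasJ; exact: cmeas_ker.
by move=> t _; rewrite nmJ nm_ker_le.
Qed.

Lemma L1_eeX G n : L1 mu G -> L1 mu (fun t => G t * ee t ^+ n).
Proof.
move=> iG; apply: (L1Mr (B := 1)) => //; last exact: eeX_bdd.
by apply: cmeasX; exact: cmeas_ee.
Qed.

Lemma L1_eeJX G n : L1 mu G -> L1 mu (fun t => G t * (ee t)^* ^+ n).
Proof.
move=> iG; apply: (L1Mr (B := 1)) => //; last by move=> t _; rewrite nmX nm_eeJ expr1n.
by apply: cmeasX; apply: cmeasJ; exact: cmeas_ee.
Qed.

Lemma L1_sum n (F : 'I_n -> MR -> CC) : (forall i, L1 mu (F i)) ->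
  L1 mu (fun t => \sum_i F i t).
Proof.
elim: n F => [|n IH] F iF.
  under eq_fun do rewrite big_ord0; split; first exact: cmeas_cst.
  by rewrite nm0; exact: integrable0.
by under eq_fun do rewrite big_ord_recl; apply: L1D => //; exact: (IH (fun i => F (lift ord0 i))).
Qed.

Lemma cint_sum n (F : 'I_n -> MR -> CC) : (forall i, L1 mu (F i)) ->
  cint mu I0 (fun t => \sum_i F i t) = \sum_i cint mu I0 (F i).
Proof.
elim: n F => [|n IH] F iF.
  rewrite big_ord0; under eq_cint do rewrite big_ord0.
  by rewrite cintE /Rintegral !integral0_eq.
rewrite big_ord_recl -IH// -cintD//; last exact: (L1_sum (fun i => iF (lift ord0 i))).
by apply: eq_cint => t _; rewrite big_ord_recl.
Qed.

(** The approximants are the Taylor polynomials: by [geometric_rem] the remainder is [z ^+ N] times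
    an integral bounded by [A / (1 - r)]. *)
Lemma discA_cauchy G : L1 mu G -> discA (cauchy G).
Proof.
move=> iG r e r0 r1 e0.
pose A := Rintegral mu I0 (fun t => nm (G t)).
have [N HN] := expr_small (A / (1 - r)) r0 r1 e0.
pose c n := cint mu I0 (fun t => G t * (ee t)^* ^+ n).
exists (\poly_(i < N) c i) => z zr.
have z1 : nm z < 1 by exact: le_lt_trans r1.
have -> : (\poly_(i < N) c i).[z] = cint mu I0 (fun t => \sum_(i < N) z ^+ i * (G t * (ee t)^* ^+ i)).
  rewrite horner_poly cint_sum; last by move=> i; apply: L1Z; exact: L1_eeJX.
  by apply: eq_bigr => i _; rewrite cintZ ?[c i * _]mulrC//; exact: L1_eeJX.
have iS : L1 mu (fun t => \sum_(i < N) z ^+ i * (G t * (ee t)^* ^+ i)).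
  by apply: L1_sum => i; apply: L1Z; exact: L1_eeJX.
rewrite /cauchy -cintB//; last exact: L1_ker.
have -> : cint mu I0 (fun t => G t * ker z t - \sum_(i < N) z ^+ i * (G t * (ee t)^* ^+ i)) =
  z ^+ N * cint mu I0 (fun t => (G t * ker z t) * (ee t)^* ^+ N).
  rewrite -cintZ; last by apply: L1_eeJX; exact: L1_ker.
  apply: eq_cint => t _.
  have -> : \sum_(i < N) z ^+ i * (G t * (ee t)^* ^+ i) = G t * \sum_(i < N) (z * (ee t)^*) ^+ i.
    by rewrite mulr_sumr; apply: eq_bigr => i _; rewrite exprMn; ring.
  rewrite -mulrBr geometric_rem ?exprMn /ker; first by ring.
  by rewrite -subr_eq0 -opprB oppr_eq0 kernel_neq0.
rewrite nmM nmX mulrC; apply: le_trans HN; apply: ler_pM.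
- exact: nm_ge0.
- by rewrite exprn_ge0// nm_ge0.
- apply: (le_trans (nm_cint_le _)); first by apply: L1_eeJX; exact: L1_ker.
  rewrite mulrC -RintegralZl//; last by case: iG.
  apply: le_Rintegral => //.
  + by apply: L1_nm; apply: L1_eeJX; exact: L1_ker.
  + by case: iG => _ iG; have := integrableZl mI0 (1 - r)^-1 iG; apply: eq_integrable.
  + move=> t _; rewrite !nmM nmX nm_eeJ expr1n mulr1 mulrC ler_wpM2r ?nm_ge0//.
    rewrite (le_trans (nm_ker_le t z1))// lef_pV2 ?posrE ?subr_gt0// lerD2l lerN2//.
- by apply: lerXn2r; rewrite ?nnegrE ?nm_ge0.
Qed.
End Cauchy.

Lemma hextE G l : hext G l = cauchy leb G l. Proof. by []. Qed.

Lemma H2_L1 G : H2 G -> L1 leb G. Proof. by move=> [LG _]; exact: L2_L1. Qed.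

Lemma L1_ker1 l : nm l < 1 -> L1 leb (ker l).
Proof.
move=> l1; apply: (L1_bdd leb_I0_lty (B := (1 - nm l)^-1)); first exact: cmeas_ker.
by move=> t _; exact: nm_ker_le.
Qed.

Lemma cint_bdd (F : MR -> CC) (B : RR) : L1 leb F -> (forall t, I0 t -> nm (F t) <= B) ->
  nm (cint leb I0 F) <= B.
Proof.
move=> iF FB; apply: (le_trans (nm_cint_le iF)).
apply: (@le_trans _ _ (Rintegral leb I0 (fun _ => B))).
  by apply: le_Rintegral => //; [exact: L1_nm|exact: integrable_cstI0].
by rewrite Rintegral_leb_cst.
Qed.

Lemma Rintegral_nm_eeX (mu : {measure set MR -> \bar RR}) G n : L1 mu G ->
  nm (cint mu I0 (fun t => G t * ee t ^+ n)) <= Rintegral mu I0 (fun t => nm (G t)).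
Proof.
move=> iG; apply: (le_trans (nm_cint_le (L1_eeX n iG))).
by under eq_Rintegral do rewrite nmM nm_eeX mulr1.
Qed.

Lemma Rintegral_nm_eeJX (mu : {measure set MR -> \bar RR}) G n : L1 mu G ->
  nm (cint mu I0 (fun t => G t * (ee t)^* ^+ n)) <= Rintegral mu I0 (fun t => nm (G t)).
Proof.
move=> iG; apply: (le_trans (nm_cint_le (L1_eeJX n iG))).
by under eq_Rintegral do rewrite nmM nmX nm_eeJ expr1n mulr1.
Qed.

Lemma cint_eeJX n : cint leb I0 (fun t => (ee t)^* ^+ n) = (n == 0%N)%:R.
Proof.
have -> : (n == 0%N)%:R = ((n == 0%N)%:R : CC)^* :> CC by rewrite rmorph_nat.
rewrite -cint_eeX -cintJ; last first.
  by apply: (L1_bdd leb_I0_lty (B := 1)); [apply: cmeasX; exact: cmeas_ee|exact: eeX_bdd].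
by apply: eq_cint => t _; rewrite rmorphXn.
Qed.

(** The moments of the kernel against powers of conj(xi) satisfy [a 0 = 1 + l * a 1] and, from index
    1 on, the recursion of [geo_zero]; so [a 1 = 0]. *)
Lemma cauchy1 l : nm l < 1 -> cint leb I0 (ker l) = 1.
Proof.
move=> l1; have iK := L1_ker1 l1.
pose a n := cint leb I0 (fun t => ker l t * (ee t)^* ^+ n).
have aS n : a n = (n == 0%N)%:R + l * a n.+1.
  rewrite /a -cint_eeJX -cintZ; last exact: L1_eeJX.
  rewrite -cintD; last 2 first.
  - by apply: (L1_bdd leb_I0_lty (B := 1)); [apply: cmeasX; apply: cmeasJ; exact: cmeas_ee|
      move=> t _; rewrite nmX nm_eeJ expr1n].
  - by apply: L1Z; exact: L1_eeJX.
  by apply: eq_cint => t _; rewrite {1}kerE// exprS; ring.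
have a1 : a 1%N = 0.
  apply: (geo_zero (a := fun n => a n.+1) l1 (B := Rintegral leb I0 (fun t => nm (ker l t)))).
    by move=> n; rewrite aS add0r.
  by move=> n; exact: Rintegral_nm_eeJX.
rewrite -[RHS](_ : a 0%N = 1); last by rewrite aS a1 mulr0 addr0.
by apply: eq_cint => t _; rewrite expr0 mulr1.
Qed.

(** The conjugate kernel is the analytic function [1 / (1 - conj(l) z)]. By [kerE] and the vanishing
    moments of [h], the moments of the product obey the recursion of [geo_zero]. *)
Lemma H2_kerJ h l : nm l < 1 -> H2 h -> H2 (fun t => h t * (ker l t)^*).
Proof.
move=> l1 Hh; have [Lh h0] := (H2P h).1 Hh; have ih := H2_L1 Hh.
apply/H2P; split.
  under eq_fun do rewrite mulrC; apply: (L2Ml (B := (1 - nm l)^-1)) => //.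
    by apply: cmeasJ; exact: cmeas_ker.
  by move=> t _; rewrite nmJ nm_ker_le.
have iK := L1_kerJ l1 ih.
pose a n := cint leb I0 (fun t => h t * (ker l t)^* * ee t ^+ n.+1).
have aS n : a n = l^* * a n.+1.
  rewrite /a -cintZ; last exact: L1_eeX.
  rewrite -[LHS]subr0 -(h0 n) -cintB; last 2 first; try exact: L1_eeX.
  apply: eq_cint => t _; rewrite {1}kerE// !conjE ![ee t ^+ n.+2]exprS; ring.
move=> n; apply: (geo_zero (a := fun m => a (m + n)%N) (l := l^*)
  (B := Rintegral leb I0 (fun t => nm (h t * (ker l t)^*)))).
- by rewrite nmJ.
- by move=> m; rewrite aS.
- by move=> m; exact: Rintegral_nm_eeX.
Qed.

(* The quotient (h - h(l)) / (z - l), multiplied by z. *)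
Definition hquot (h : MR -> CC) (l : CC) (t : MR) : CC := (h t - hext h l) * ker l t.

Lemma hquotE h l t : h t * ker l t = hquot h l t + hext h l * ker l t.
Proof. by rewrite /hquot; ring. Qed.

(** The mean vanishes by the definition of [hext h l]. Each further moment is [l] times the
    preceding one, because the moments of [h] and of the constant that [kerE] adds are 0. *)
Lemma H2_hquot h l : nm l < 1 -> H2 h -> H2 (hquot h l) /\ cint leb I0 (hquot h l) = 0.
Proof.
move=> l1 Hh; have [Lh h0] := (H2P h).1 Hh; have ih := H2_L1 Hh.
have iK := L1_ker1 l1.
have iq : L1 leb (hquot h l).
  apply: L1_ker => //; apply: L1B => //; exact: L1_cst.
have q0 : cint leb I0 (hquot h l) = 0.
  rewrite (eq_cint _ (G := fun t => h t * ker l t - hext h l * ker l t)); last first.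
    by move=> t _; rewrite /hquot mulrBl.
  by rewrite cintB ?cintZ ?cauchy1 ?mulr1 ?subrr//; [exact: L1_ker|exact: L1Z].
split=> //; apply/H2P; split.
  rewrite /hquot; under eq_fun do rewrite mulrC; apply: (L2Ml (B := (1 - nm l)^-1)) => //.
  - exact: cmeas_ker.
  - by move=> t _; rewrite nm_ker_le.
  - by apply: L2B => //; apply: (L2_bdd (B := nm (hext h l))) => //; exact: cmeas_cst.
elim=> [|n IH].
  rewrite (eq_cint _ (G := fun t => h t * ee t ^+ 1 - hext h l * ee t ^+ 1 + l * hquot h l t)); last first.
    move=> t _; rewrite /hquot {1}kerE//.
    have -> : (h t - hext h l) * (1 + l * (ee t)^* * ker l t) * ee t ^+ 1 =
      h t * ee t - hext h l * ee t + l * ((h t - hext h l) * ker l t) * (ee t * (ee t)^*) by ring.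
    by rewrite eeJ mulr1 expr1.
  rewrite cintD; last 2 first.
  - apply: L1B; first exact: L1_eeX.
    by apply: L1Z; apply: (eq_L1 _ (L1_eeX 1 (L1_cst leb_I0_lty 1))) => t _; rewrite mul1r.
  - exact: L1Z.
  rewrite cintB ?h0 ?cintZ// ?cint_eeX ?q0 ?mulr0 ?subr0 ?addr0//.
  - by apply: (eq_L1 _ (L1_eeX 1 (L1_cst leb_I0_lty 1))) => t _; rewrite mul1r.
  - exact: L1_eeX.
  - by apply: L1Z; apply: (eq_L1 _ (L1_eeX 1 (L1_cst leb_I0_lty 1))) => t _; rewrite mul1r.
rewrite (eq_cint _ (G := fun t => h t * ee t ^+ n.+2 - hext h l * ee t ^+ n.+2 + l * (hquot h l t * ee t ^+ n.+1))); last first.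
  move=> t _; rewrite /hquot {1}kerE//.
  have -> : (h t - hext h l) * (1 + l * (ee t)^* * ker l t) * ee t ^+ n.+2 =
    h t * ee t ^+ n.+2 - hext h l * ee t ^+ n.+2 + l * ((h t - hext h l) * ker l t * ee t ^+ n.+1) * (ee t * (ee t)^*).
    by rewrite [ee t ^+ n.+2]exprS; ring.
  by rewrite eeJ mulr1.
have iE : L1 leb (fun t => ee t ^+ n.+2).
  by apply: (eq_L1 _ (L1_eeX n.+2 (L1_cst leb_I0_lty 1))) => t _; rewrite mul1r.
rewrite cintD; last 2 first.
- by apply: L1B; [exact: L1_eeX|exact: L1Z].
- by apply: L1Z; exact: L1_eeX.
rewrite cintB ?h0 ?cintZ// ?cint_eeX ?IH ?mulr0 ?subr0 ?addr0//; [exact: L1_eeX|exact: L1_eeX|exact: L1Z].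
Qed.

Lemma ae_mono d (T : measurableType d) (R : realType) (mu : set T -> \bar R) (P Q : T -> Prop) :
  (forall x, P x -> Q x) -> {ae mu, forall x, P x} -> {ae mu, forall x, Q x}.
Proof.
move=> PQ [N [mN N0 sN]]; exists N; split => // x nQ; apply: sN => Px; exact/nQ/PQ.
Qed.

Lemma ae_and d (T : measurableType d) (R : realType) (mu : {measure set T -> \bar R}) (P Q : T -> Prop) :
  {ae mu, forall x, P x} -> {ae mu, forall x, Q x} -> {ae mu, forall x, P x /\ Q x}.
Proof.
move=> hP hQ; have := negligibleU hP hQ; apply: negligibleS => x /= nPQ.
by apply: contrapT => /not_orP[/contrapT Px /contrapT Qx]; exact: nPQ.
Qed.


(** * Differentiation by Poisson integrals *)

Section sine_bounds.
Context {R : realType}.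

Lemma sin_MVT (u : R) : 0 < u -> exists2 c, 0 < c < u & sin u = u * cos c.
Proof.
move=> u0.
have [|c cu] := @MVT R sin cos 0 u u0 (fun x _ => is_derive_sin x).
  by apply: continuous_subspaceT => x; exact: continuous_sin.
rewrite sin0 !subr0 mulrC => h; exists c => //.
Qed.

Lemma sin_pi_upper (s : R) : 0 <= s -> sin (pi * s) <= pi * s.
Proof.
rewrite le_eqVlt => /orP[/eqP <-|s0]; first by rewrite mulr0 sin0.
have ps : 0 < pi * s by rewrite mulr_gt0// pi_gt0.
have [c _ ->] := sin_MVT ps; rewrite ler_piMr ?(ltW ps)//; exact: cos_le1.
Qed.

(** Up to 1/4 the mean value theorem gives the slope [pi * cos (pi / 4)]; between 1/4 and [a] the
    sine has a positive minimum by compactness. The condition [a < 1] keeps away from its second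
    zero. *)
Lemma sin_pi_lower (a : R) : a < 1 ->
  exists2 c, 0 < c & forall s, 0 <= s -> s <= a -> c * s <= sin (pi * s).
Proof.
move=> a1; have pi0 := pi_gt0 R.
pose b := Num.max a 4^-1.
have b1 : b < 1 by rewrite /b gt_max a1/= invf_lt1// ltr1n.
have b4 : 4^-1 <= b by rewrite /b le_max lexx orbT.
have [|m mb Hm] := @EVT_min R (fun s => sin (pi * s)) 4^-1 b b4.
  apply: continuous_subspaceT => x; apply: (continuous_comp (f := fun t => pi * t)); last exact: continuous_sin.
  by apply: cvgM; [exact: cvg_cst|exact: cvg_id].
move: mb; rewrite in_itv/= => /andP[m4 mb].
have m0 : 0 < m by rewrite (lt_le_trans _ m4)// invr_gt0.
have sm : 0 < sin (pi * m).
  by apply: sin_gt0_pi; rewrite mulr_gt0//= gtr_pMr// (le_lt_trans mb).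
have c4 : 0 < cos (pi / 4 : R).
  by apply: cos_gt0_pihalf; apply/andP; split; lra.
exists (Num.min (sin (pi * m)) (pi * cos (pi / 4))); first by rewrite lt_min sm mulr_gt0.
move=> s; rewrite le_eqVlt => /orP[/eqP <- _|s0 sa]; first by rewrite !mulr0 sin0.
have [s4|s4] := leP s 4^-1.
  apply: (@le_trans _ _ (pi * cos (pi / 4) * s)).
    by rewrite ler_wpM2r ?(ltW s0)// ge_min lexx orbT.
  have ps : 0 < pi * s by rewrite mulr_gt0.
  have [c /andP[c0 cs] ->] := sin_MVT ps.
  rewrite mulrAC ler_wpM2l ?(ltW ps)// leNgt ltr_cos ?in_itv/=; last 2 first.
    by apply/andP; split; lra.
    by rewrite (ltW c0)/= (le_trans (ltW cs))// ger_pMr// (ltW (le_lt_trans sa a1)).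
  by rewrite -leNgt (le_trans (ltW cs))// ler_wpM2l// ltW.
apply: (@le_trans _ _ (sin (pi * m) * s)).
  by rewrite ler_wpM2r ?(ltW s0)// ge_min lexx.
apply: (@le_trans _ _ (sin (pi * m))).
  by rewrite ler_piMr ?(ltW sm)// (le_trans sa)// ltW.
by apply: Hm; rewrite in_itv/= (ltW s4)/= /b le_max sa.
Qed.
End sine_bounds.

Lemma chordE x y : nm (ee y - ee x) = 2 * `|sin (pi * (y - x))|.
Proof.
rewrite /nm -[RHS]ger0_norm ?mulr_ge0// -sqrtr_sqr; congr Num.sqrt.
rewrite exprMn real_normK ?num_real// /sqn ReD ImD ReN ImN !Re_ee !Im_ee.
have -> : 2 * pi * y = 2 * pi * x + (pi * (y - x)) *+ 2.
  by rewrite -mulr_natl; ring.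
rewrite (trigo.cosD (2 * pi * x) (pi * (y - x) *+ 2)) (trigo.sinD (2 * pi * x) (pi * (y - x) *+ 2)).
rewrite cos_mulr2n sin_mulr2n.
have hA := cos2Dsin2 (2 * pi * x); have hB := cos2Dsin2 (pi * (y - x)).
have -> : cos (pi * (y - x)) ^+ 2 *+ 2 - 1 = 1 - 2 * sin (pi * (y - x)) ^+ 2 :> RR.
  by rewrite -mulr_natl; lra.
move: hA hB.
move: (cos (2 * pi * x)) (sin (2 * pi * x)) (cos (pi * (y - x))) (sin (pi * (y - x))) => a b c s hA hB.
rewrite -[c * s *+ 2]mulr_natl.
have -> : 2 ^+ 2 * s ^+ 2 = 2 ^+ 2 * s ^+ 2 * ((a ^+ 2 + b ^+ 2) * (c ^+ 2 + s ^+ 2)).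
  by rewrite hA hB !mulr1.
ring.
Qed.


(** For interior [x] the distance [|y - x|] is at most [max x (1 - x) < 1], which makes chord and
    parameter distance comparable. This fails at [x = 0], where parameters near 1 give points near
    [ee 0]. *)
Lemma chord_bounds (x : RR) : 0 < x -> x < 1 -> exists2 c, 0 < c & forall y, I0 y ->
  c * `|y - x| <= nm (ee y - ee x) /\ nm (ee y - ee x) <= 2 * pi * `|y - x|.
Proof.
move=> x0 x1.
have [|c c0 Hc] := @sin_pi_lower RR (Num.max x (1 - x)).
  by rewrite gt_max x1/=; lra.
exists (2 * c); first by rewrite mulr_gt0.
move=> y; rewrite /I0/= in_itv/= => /andP[y0 y1].
have sE : `|sin (pi * (y - x))| = sin (pi * `|y - x|) :> RR.
  have h : 0 <= sin (pi * `|y - x|) :> RR.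
    apply: sin_ge0_pi; rewrite mulr_ge0 ?pi_ge0//= ger_pMr ?pi_gt0//.
    by rewrite ler_norml; apply/andP; split; lra.
  case: (ler0P (y - x)) h => yx h; last by rewrite ger0_norm.
  by rewrite -[in LHS](opprK (y - x)) mulrN sinN normrN ger0_norm.
rewrite chordE sE; split.
  rewrite -mulrA ler_wpM2l//; apply: Hc => //.
  by rewrite le_max !ler_norml; case: (leP x y) => xy; apply/orP; [right|left]; apply/andP; split; lra.
by rewrite -mulrA ler_wpM2l//; exact: sin_pi_upper.
Qed.

Lemma chord_eq0 (x y : RR) : I0 x -> I0 y -> nm (ee y - ee x) = 0 -> y = x.
Proof.
rewrite /I0/= !in_itv/= => /andP[x0 x1] /andP[y0 y1].
rewrite chordE => /eqP; rewrite mulf_eq0 pnatr_eq0 normr_eq0 /= => /eqP s0.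
have [yx|xy|//] := ltgtP y x.
  have : 0 < sin (pi * (x - y)) :> RR.
    by apply: sin_gt0_pi; rewrite mulr_gt0 ?pi_gt0 ?subr_gt0//= gtr_pMr ?pi_gt0//; lra.
  by rewrite -[x - y]opprB mulrN sinN s0 oppr0 ltxx.
have : 0 < sin (pi * (y - x)) :> RR.
  by apply: sin_gt0_pi; rewrite mulr_gt0 ?pi_gt0 ?subr_gt0//= gtr_pMr ?pi_gt0//; lra.
by rewrite s0 ltxx.
Qed.

(* A superposition of indicators of dyadic intervals which is comparable to 1 / (1 + a)^2. *)
Definition dyadic {R : realType} (n : nat) (a : R) : R :=
  \sum_(k < n) 4^-1 ^+ k * (a < 2 ^+ k)%R%:R.

Section dyadic.
Context {R : realType}.
Implicit Types a : R.

(** Halving [a] against the weight 1/4 is the scaling of an inverse square; the estimates below are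
    inductions on this identity. *)
Lemma dyadicS n a : dyadic n.+1 a = (a < 1)%R%:R + 4^-1 * dyadic n (a / 2).
Proof.
rewrite /dyadic big_ord_recl expr0 mul1r; congr (_ + _).
rewrite mulr_sumr; apply: eq_bigr => i _; rewrite lift0 !exprS -mulrA.
by rewrite ltr_pdivrMr// [2 * _]mulrC.
Qed.

Lemma dyadic_ge0 n a : 0 <= dyadic n a.
Proof. by apply: sumr_ge0 => i _; rewrite mulr_ge0// exprn_ge0. Qed.

Lemma dyadic_lower n a : 0 <= a -> a < 2 ^+ n -> 1 <= 4 * dyadic n.+1 a * (1 + a) ^+ 2.
Proof.
move=> a0 an.
(* For [a >= 1] the induction runs on [a ^+ 2], which scales exactly under halving, instead of
   [(1 + a) ^+ 2]. *)
suff [h1 h2] : (a < 1 -> 1 <= dyadic n.+1 a) /\ (1 <= a -> 1 <= 4 * dyadic n.+1 a * a ^+ 2).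
  have [a1|a1] := ltP a 1.
    by have := h1 a1; move: (dyadic n.+1 a) => S; nra.
  have := h2 a1; have := dyadic_ge0 n.+1 a; move: (dyadic n.+1 a) => S S0; nra.
elim: n a a0 an => [|n IH] a a0 an.
  rewrite dyadicS /dyadic big_ord0 mulr0 addr0; split=> [->//|].
  by rewrite expr0 in an; rewrite leNgt an.
have a20 : 0 <= a / 2 by lra.
have an2 : a / 2 < 2 ^+ n by rewrite ltr_pdivrMr// mulrC -exprS.
have [IH1 IH2] := IH _ a20 an2.
rewrite dyadicS; split=> [->|a1].
  by rewrite lerDl mulr_ge0// dyadic_ge0.
rewrite ltNge a1 add0r; have S0 := dyadic_ge0 n.+1 (a / 2).
move: (dyadic n.+1 (a / 2)) S0 IH1 IH2 => S S0 IH1 IH2.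
have [h|h] := ltP (a / 2) 1; first by have := IH1 h; nra.
by have := IH2 h; nra.
Qed.

Lemma dyadic_le n a : dyadic n a <= 4 / 3.
Proof.
elim: n a => [|n IH] a; first by rewrite /dyadic big_ord0; lra.
rewrite dyadicS; have := IH (a / 2); have := dyadic_ge0 n (a / 2).
by case: (a < 1) => /=; lra.
Qed.

(** For [a < 1] the constant is [4 / 3] times [(1 + 1) ^+ 2]; for larger [a] the induction closes
    because [(1 + a) / 2 <= 1 + a / 2]. *)
Lemma dyadic_upper n a : 0 <= a -> dyadic n a * (1 + a) ^+ 2 <= 16 / 3.
Proof.
elim: n a => [|n IH] a a0; first by rewrite /dyadic big_ord0 mul0r; lra.
have a20 : 0 <= a / 2 by lra.
have [a1|a1] := ltP a 1.
  by have := dyadic_le n.+1 a; have := dyadic_ge0 n.+1 a; move: (dyadic _ _) => S; nra.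
have S0 := dyadic_ge0 n (a / 2); have := IH _ a20; rewrite dyadicS ltNge a1 add0r.
by move: (dyadic n (a / 2)) S0 => S S0; nra.
Qed.

End dyadic.

Lemma realCB (a b : RR) : (a - b)%:C%C = a%:C%C - b%:C%C. Proof. exact: rmorphB. Qed.
Lemma realCD (a b : RR) : (a + b)%:C%C = a%:C%C + b%:C%C. Proof. exact: rmorphD. Qed.
Lemma realCM (a b : RR) : (a * b)%:C%C = a%:C%C * b%:C%C. Proof. exact: rmorphM. Qed.
Lemma realCV (a : RR) : (a^-1)%:C%C = (a%:C%C)^-1. Proof. exact: fmorphV. Qed.
Lemma realC1 : (1 : RR)%:C%C = 1. Proof. by []. Qed.

Definition pk (l : CC) (t : MR) : RR := (1 - sqn l) / sqn (1 - l * (ee t)^*).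

Lemma pkE l t : nm l < 1 -> (pk l t)%:C%C = ker l t + (ker l t)^* - 1.
Proof.
move=> l1; rewrite /pk /ker; have := kernel_neq0 t l1; have hs := sqnE (1 - l * (ee t)^*).
have h1 : (1 - sqn l)%:C%C = (1 - l * (ee t)^*) + (1 - l * (ee t)^*)^* - (1 - l * (ee t)^*) * (1 - l * (ee t)^*)^*.
  rewrite realCB realC1 sqnE conjB conj1 conjM conjK.
  have -> : l * l^* = l * l^* * (ee t * (ee t)^*) by rewrite eeJ mulr1.
  ring.
rewrite realCM realCV h1 hs; move: (1 - l * (ee t)^*) => w w0.
have wc0 : w^* != 0 by rewrite -nm_eq0 nmJ nm_eq0.
by rewrite conjV; field; rewrite w0 wc0.
Qed.

Lemma pk_bounds l t : nm l < 1 ->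
  (1 - nm l) / nm (ee t - l) ^+ 2 <= pk l t /\ pk l t <= 2 * (1 - nm l) / nm (ee t - l) ^+ 2.
Proof.
move=> l1; rewrite /pk -!nm_sqr nm_kernel_dist.
have d0 : 0 < nm (ee t - l).
  by rewrite -nm_kernel_dist nm_gt0 kernel_neq0.
have i0 : 0 < nm (ee t - l) ^- 2 by rewrite invr_gt0 exprn_gt0.
by have := nm_ge0 l; move: (nm l) l1 => r r1 r0; split; rewrite ler_wpM2r ?(ltW i0)//; nra.
Qed.

Lemma pk_gt0 l t : nm l < 1 -> 0 < pk l t.
Proof.
move=> l1; apply: (lt_le_trans _ (pk_bounds t l1).1).
by rewrite divr_gt0 ?subr_gt0// exprn_gt0// -nm_kernel_dist nm_gt0 kernel_neq0.
Qed.

Lemma measurable_pk l : measurable_fun I0 (pk l).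
Proof.
apply: measurable_funM => //; apply: measurable_inv; last by move=> t; exact: sqn_ge0.
by apply: cmeas_sqn; exact: cmeas_kernel.
Qed.

Lemma dist_ge_nm l t : 1 - nm l <= nm (ee t - l).
Proof. by have := nm_dist (ee t) l; rewrite nm_ee; apply: le_trans; exact: ler_norm. Qed.

Lemma pk_le l t : nm l < 1 -> pk l t <= 2 / (1 - nm l).
Proof.
move=> l1; apply: (le_trans (pk_bounds t l1).2).
have y0 : 0 < 1 - nm l by rewrite subr_gt0.
have dy := dist_ge_nm l t; have d0 := lt_le_trans y0 dy.
rewrite -mulrA ler_wpM2l// ler_pdivrMr ?exprn_gt0//.
by rewrite ler_pdivlMl// -expr2 ler_sqr ?nnegrE ?(ltW y0) ?(ltW d0).
Qed.

Section pintegral.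
Variable mu : {measure set MR -> \bar RR}.
Hypothesis fmu : (mu I0 < +oo)%E.

Definition pint (G : MR -> CC) (l : CC) : CC := cint mu I0 (fun t => (pk l t)%:C%C * G t).

Lemma cmeas_pk l : cmeas (fun t => (pk l t)%:C%C).
Proof. by apply: cmeas_real; exact: measurable_pk. Qed.

Lemma nm_pk_le l t : nm l < 1 -> nm (pk l t)%:C%C <= 2 / (1 - nm l).
Proof. by move=> l1; rewrite nm_real ger0_norm ?pk_le// ltW// pk_gt0. Qed.

Lemma L1_pk G l : nm l < 1 -> L1 mu G -> L1 mu (fun t => (pk l t)%:C%C * G t).
Proof.
move=> l1; apply: (L1Ml (B := 2 / (1 - nm l))); first exact: cmeas_pk.
by move=> t _; exact: nm_pk_le.
Qed.

(** The decomposition of the Poisson kernel into an analytic and an antianalytic part; every passage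
    between Cauchy and Poisson integrals goes through it. *)
Lemma pintE G l : nm l < 1 -> L1 mu G ->
  pint G l = cauchy mu G l + (cauchy mu (fun t => (G t)^*) l)^* - cint mu I0 G.
Proof.
move=> l1 iG; have iJ := L1J iG.
have i1 := L1_ker l1 iG; have i2 := L1_ker l1 iJ.
rewrite /cauchy -cintJ// -cintD//; last exact: L1J.
rewrite -cintB//; last by apply: L1D => //; exact: L1J.
apply: eq_cint => t _; rewrite pkE// conjM conjK; ring.
Qed.
End pintegral.

Lemma Rintegral_pk_leb l : nm l < 1 -> Rintegral leb I0 (pk l) = 1.
Proof.
move=> l1.
have := pintE l1 (L1_cst leb_I0_lty 1); rewrite cint_leb_cst /cauchy.
rewrite (eq_cint _ (G := ker l)); last by move=> t _; rewrite mul1r.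
rewrite [X in _ + X^*](eq_cint _ (G := ker l)); last by move=> t _; rewrite conj1 mul1r.
rewrite cauchy1// conj1 addrK => h.
have -> : Rintegral leb I0 (pk l) = ReC (pint leb (fun _ => 1) l).
  by rewrite Re_cint; apply: eq_Rintegral => t _; rewrite mulr1.
by rewrite h.
Qed.

Lemma integral_pk_leb l : nm l < 1 -> (\int[leb]_(t in I0) (pk l t)%:E = 1)%E.
Proof.
move=> l1; rewrite -[LHS]fineK; last first.
  apply: integrable_fin_num => //.
  have [_] := L1_pk l1 (L1_cst leb_I0_lty 1); apply: eq_integrable => // t _.
  by rewrite mulr1 nm_real ger0_norm// ltW// pk_gt0.
by congr EFin; exact: Rintegral_pk_leb.
Qed.

Section poisson_differentiation.
Variable k : {finite_measure set MR -> \bar RR}.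
Hypothesis kI : k (~` I0) = 0%E.
Hypothesis leb_le_k : forall phi : MR -> RR, measurable_fun I0 phi -> (forall t, 0 <= phi t) ->
  (\int[leb]_(t in I0) (phi t)%:E <= \int[k]_(t in I0) (phi t)%:E)%E.

Let kpos a b : 0 <= a -> a < b -> b < 1 -> (0 < k `]a, b]%classic)%E.
Proof.
move=> a0 ab b1; apply: (@lt_le_trans _ _ (leb `]a, b]%classic)).
  by rewrite /leb lebesgue_measure_itv/= lte_fin ab -EFinB lte_fin subr_gt0.
have mab : measurable (`]a, b]%classic : set MR) by exact: measurable_itv.
have mi : measurable_fun I0 (\1_(`]a, b]%classic : set MR) : MR -> RR).
  exact: measurable_indic.
have := leb_le_k mi.
rewrite !integral_indic//= (_ : `]a, b]%classic `&` I0 = `]a, b]%classic)//.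
  by apply=> t; rewrite indicE.
apply/setIidPl => t /=; rewrite /I0/= !in_itv/= => /andP[? ?]; apply/andP; split; lra.
Qed.

Let pP z : \bar RR := (\int[k]_(t in I0) (pk z t)%:E)%E.

(** Since P[k] dominates P[m] = 1, every error of order [1 - |z|] is absorbed by a small multiple of
    P[k]. *)
Let pP1 z : nm z < 1 -> (1 <= pP z)%E.
Proof.
move=> z1; rewrite -(integral_pk_leb z1).
have := leb_le_k (phi := fun t => pk z t) (measurable_pk z); apply.
by move=> t; rewrite ltW// pk_gt0.
Qed.

(** In the Stolz region [|ee x - z|] is at most [al] times [1 - |z|], which in turn is at most
    [|ee t - z|] for every [t]. *)
Let nt_ineq x z al t : 1 < al -> nm (ee x - z) < al * (1 - nm z) ->
  nm (ee t - ee x) <= (1 + al) * nm (ee t - z) /\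
  nm (ee t - z) <= nm (ee t - ee x) + al * (1 - nm z).
Proof.
move=> a1 nt; have := dist_ge_nm z t; have h1 := nm_triangle z (ee t) (ee x).
have h2 := nm_triangle (ee x) (ee t) z; move: h1; rewrite [nm (z - ee x)]nmB => h1 h3.
by split; nra.
Qed.

Let pk_far x z al d t : nm z < 1 -> 1 < al -> nm (ee x - z) < al * (1 - nm z) ->
  0 < d -> d <= nm (ee t - ee x) ->
  pk z t <= 2 * (1 + al) ^+ 2 / d ^+ 2 * (1 - nm z).
Proof.
move=> z1 a1 nt d0 dt; have [h1 _] := nt_ineq t a1 nt.
apply: (le_trans (pk_bounds t z1).2).
have D0 : 0 < nm (ee t - z) by rewrite -nm_kernel_dist nm_gt0 kernel_neq0.
have y0 : 0 < 1 - nm z by rewrite subr_gt0.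
have key : (nm (ee t - z) ^+ 2)^-1 <= (1 + al) ^+ 2 / d ^+ 2.
  rewrite ler_pdivlMr ?exprn_gt0// mulrC ler_pdivrMr ?exprn_gt0// -exprMn.
  by rewrite ler_sqr ?nnegrE ?(ltW d0)//; lra.
have -> : 2 * (1 + al) ^+ 2 / d ^+ 2 * (1 - nm z) = 2 * (1 - nm z) * ((1 + al) ^+ 2 / d ^+ 2) by ring.
by rewrite ler_wpM2l// mulr_ge0// ltW.
Qed.

(* Split of the Poisson kernel into a part near x, dominated by s, and a part of size O(1 - |z|). *)
Let near_far z (h s : MR -> RR) C e : nm z < 1 -> 0 < e -> 0 <= C ->
  measurable_fun I0 h -> (forall t, 0 <= h t) -> k.-integrable I0 (EFin \o h) ->
  measurable_fun I0 s -> (forall t, 0 <= s t) ->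
  (forall t, I0 t -> pk z t <= s t + C * (1 - nm z)) ->
  (\int[k]_(t in I0) (s t * h t)%:E <= (e / 2)%:E * pP z)%E ->
  C * (1 - nm z) * fine (\int[k]_(t in I0) (h t)%:E)%E <= e / 2 ->
  (\int[k]_(t in I0) (pk z t * h t)%:E <= e%:E * pP z)%E.
Proof.
move=> z1 e0 C0 mh h0 ih ms s0 ps near far.
have y0 : 0 < 1 - nm z by rewrite subr_gt0.
apply: (@le_trans _ _ (\int[k]_(t in I0) ((s t * h t)%:E + (C * (1 - nm z))%:E * (h t)%:E))%E).
  apply: ge0_le_integral => //.
  - by move=> t _; rewrite lee_fin mulr_ge0// ltW// pk_gt0.
  - by apply/measurable_EFinP; apply: measurable_funM => //; exact: measurable_pk.
  - apply: emeasurable_funD; first by apply/measurable_EFinP; exact: measurable_funM.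
    by apply: measurable_funeM; exact/measurable_EFinP.
  - by move=> t It; rewrite -EFinM -EFinD lee_fin -mulrDl ler_wpM2r// ps.
rewrite ge0_integralD//; last 4 first.
- by move=> t _; rewrite lee_fin mulr_ge0.
- by apply/measurable_EFinP; exact: measurable_funM.
- by move=> t _; rewrite -EFinM lee_fin !mulr_ge0// ltW.
- by apply: measurable_funeM; exact/measurable_EFinP.
rewrite ge0_integralZl_EFin//; last 3 first.
- by move=> t _; rewrite lee_fin.
- exact/measurable_EFinP.
- by rewrite mulr_ge0// ltW.
have -> : (e%:E * pP z = (e / 2)%:E * pP z + (e / 2)%:E * pP z)%E.
  by rewrite -ge0_muleDl ?lee_fin ?divr_ge0 ?(ltW e0)// -EFinD -splitr.
apply: leeD => //; rewrite -[X in (_ * X)%E]fineK; last exact: integrable_fin_num.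
rewrite -EFinM; apply: (@le_trans _ _ (e / 2)%:E); first by rewrite lee_fin.
by rewrite -[leLHS]mule1; apply: lee_wpmul2l; rewrite ?lee_fin ?divr_ge0 ?(ltW e0)// pP1.
Qed.

(** Both sides are sums over the same centred intervals with the same weights, so the estimate is
    summed term by term and the masses of different intervals are never compared. *)
Let integral_dyadic x y n e (h : MR -> RR) : 0 < y -> 0 <= e ->
  measurable_fun I0 h -> (forall t, 0 <= h t) ->
  (forall j, (j <= n)%N -> `](x - 2 ^+ j * y), (x + 2 ^+ j * y)[%classic `<=` I0) ->
  (forall j, (j <= n)%N -> (\int[k]_(t in `](x - 2 ^+ j * y)%R, (x + 2 ^+ j * y)%R[) (h t)%:E
    <= e%:E * k `](x - 2 ^+ j * y)%R, (x + 2 ^+ j * y)%R[%classic)%E) ->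
  (\int[k]_(t in I0) (dyadic n.+1 (`|t - x| / y) * h t)%:E
    <= e%:E * \int[k]_(t in I0) (dyadic n.+1 (`|t - x| / y))%:E)%E.
Proof.
move=> y0 e0 mh h0 JI Jh.
pose J j : set MR := `](x - 2 ^+ j * y), (x + 2 ^+ j * y)[%classic.
have mJ j : measurable (J j) by exact: measurable_itv.
have JE j (t : RR) : (`|t - x| / y < 2 ^+ j) = (t \in J j).
  by rewrite ltr_pdivrMr// mem_setE in_itv/= ltr_norml ltrBlDl ltrBrDl addrC.
have JR j (g : MR -> RR) : measurable_fun I0 g -> (forall t, 0 <= g t) -> (j <= n)%N ->
    (\int[k]_(t in I0) ((4^-1 ^+ j * (`|t - x| / y < 2 ^+ j)%R%:R) * g t)%:E =
     (4^-1 ^+ j)%:E * \int[k]_(t in J j) (g t)%:E)%E.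
  move=> mg g0 jn; have -> : J j = I0 `&` J j by apply/esym/setIidPr; exact: JI.
  rewrite integral_mkcondr -ge0_integralZl_EFin ?exprn_ge0//.
  - apply: eq_integral => t _; rewrite JE patchE; case: ifP => _.
      by rewrite mulr1 EFinM.
    by rewrite mulr0 mul0r mule0.
  - by move=> t _; rewrite patchE; case: ifP => // _; rewrite lee_fin.
  - apply/measurable_restrict => //; apply/measurable_EFinP.
    by apply: measurable_funS mg => // ? [].
have S (g : MR -> RR) : measurable_fun I0 g -> (forall t, 0 <= g t) ->
    (\int[k]_(t in I0) (dyadic n.+1 (`|t - x| / y) * g t)%:E =
     \sum_(j < n.+1) (4^-1 ^+ j)%:E * \int[k]_(t in J j) (g t)%:E)%E.
  move=> mg g0.
  under eq_integral do rewrite /dyadic mulr_suml -sumEFin.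
  rewrite ge0_integral_sum//.
  - by apply: eq_bigr => j _; rewrite JR// -ltnS ltn_ord.
  - move=> j; apply/measurable_EFinP; apply: measurable_funM => //.
    apply: measurable_funM => //.
    under eq_fun do rewrite JE.
    have mi : measurable_fun I0 (\1_(J j) : MR -> RR) by exact: measurable_indic.
    exact: mi.
  - by move=> j t _; rewrite lee_fin !mulr_ge0// ?exprn_ge0// ler0n.
rewrite S//.
have -> : (\int[k]_(t in I0) (dyadic n.+1 (`|t - x| / y))%:E =
  \sum_(j < n.+1) (4^-1 ^+ j)%:E * k (J j))%E.
  under eq_integral do rewrite -[dyadic _ _]mulr1.
  rewrite (S (fun _ => 1))//.
  by apply: eq_bigr => j _; rewrite integral_cst// mul1e.
rewrite ge0_sume_distrr; last by move=> j _; rewrite mule_ge0// lee_fin exprn_ge0.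
apply: lee_sum => j _; rewrite muleCA; apply: lee_wpmul2l; first by rewrite lee_fin exprn_ge0.
by apply: Jh; rewrite -ltnS ltn_ord.
Qed.

Variable g : MR -> RR.
Hypothesis ig : k.-integrable I0 (EFin \o g).

Let mg : measurable_fun I0 g.
Proof. by have /measurable_EFinP := measurable_int k ig. Qed.

Let igB x : k.-integrable I0 (EFin \o (fun t => `|g t - g x|)).
Proof.
apply: (@integrable_norm _ _ _ k I0 (fun t => g t - g x)).
apply: (@integrableB _ _ _ k I0 mI0 (EFin \o g) (EFin \o cst (g x))) => //.
exact: finite_measure_integrable_cst.
Qed.

Let mgB x : measurable_fun I0 (fun t => `|g t - g x|).
Proof. by have /measurable_EFinP := measurable_int k (igB x). Qed.

Let good x := forall al e : RR, 1 < al -> 0 < e -> exists2 d, 0 < d & forall z,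
  nm z < 1 -> nm (ee x - z) < d -> nm (ee x - z) < al * (1 - nm z) ->
  (\int[k]_(t in I0) (pk z t * `|g t - g x|)%:E <= e%:E * pP z)%E.

Let good_of x (al e C d0 : RR) : 0 < e -> 0 <= C -> 0 < d0 ->
  (forall z, nm z < 1 -> nm (ee x - z) < d0 -> nm (ee x - z) < al * (1 - nm z) ->
     exists2 s : MR -> RR, [/\ measurable_fun I0 s, forall t, 0 <= s t &
       forall t, I0 t -> pk z t <= s t + C * (1 - nm z)] &
     (\int[k]_(t in I0) (s t * `|g t - g x|)%:E <= (e / 2)%:E * pP z)%E) ->
  exists2 d, 0 < d & forall z,
    nm z < 1 -> nm (ee x - z) < d -> nm (ee x - z) < al * (1 - nm z) ->
    (\int[k]_(t in I0) (pk z t * `|g t - g x|)%:E <= e%:E * pP z)%E.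
Proof.
move=> e0 C0 d00 H.
pose A := fine (\int[k]_(t in I0) (`|g t - g x|)%:E)%E.
have A0 : 0 <= A by apply: fine_ge0; apply: integral_ge0 => t _; rewrite lee_fin.
have CA : 0 < 2 * (C * A + 1) by rewrite mulr_gt0// ltr_wpDl// mulr_ge0.
(* As [1 - |z|] is at most the distance of [z] to [ee x], this radius makes the far part at most
   [e / 2]; the summand 1 covers [C * A = 0]. *)
exists (Num.min d0 (e / (2 * (C * A + 1)))); first by rewrite lt_min d00 divr_gt0.
move=> z z1; rewrite lt_min => /andP[zd zd'] nt.
have [s [ms s0 ps] Hs] := H z z1 zd nt.
apply: (@near_far z (fun t => `|g t - g x|) s C e) => //.
have y : 1 - nm z <= e / (2 * (C * A + 1)) by apply: (le_trans (dist_ge_nm z x)); exact: ltW.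
have y0 : 0 < 1 - nm z by rewrite subr_gt0.
rewrite -/A mulrAC; apply: (@le_trans _ _ ((C * A + 1) * (e / (2 * (C * A + 1))))).
  by apply: ler_pM => //; [exact: mulr_ge0|exact: ltW|rewrite lerDl].
by rewrite le_eqVlt; apply/orP; left; apply/eqP; field; rewrite gt_eqF// ltr_wpDl// mulr_ge0.
Qed.


Let far_ge0 (al d : RR) : 0 <= 2 * (1 + al) ^+ 2 / d ^+ 2.
Proof. by rewrite divr_ge0 ?sqr_ge0// mulr_ge0 ?sqr_ge0. Qed.

Let igBr x : k.-integrable setT (EFin \o ((fun t => `|g t - g x|) \_ I0)).
Proof. by rewrite -restrict_EFin; exact/(integrable_mkcond _ mI0). Qed.

(** The atom alone gives [P[k](z) >= pk z x * k [set x]], in the Stolz region at least [k [set x] /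
    (al^2 (1 - |z|))], while [pk z <= 2 / (1 - |z|)]. So it is enough that the integral over the
    neighbourhood [V n] be at most [e / (4 * al ^+ 2)] times the mass of the atom. *)
Let good_atom x : I0 x -> k [set x] != 0%E -> good x.
Proof.
move=> Ix kx al e a1 e0.
have fx : k [set x] \is a fin_num by exact: fin_num_measure.
have kx0 : 0 < fine (k [set x]) by rewrite fine_gt0// lt0e kx measure_ge0/= ltey_eq fx.
pose V n : set MR := I0 `&` [set t | nm (ee t - ee x) < n.+1%:R^-1].
have mV n : measurable (V n).
  have mn : measurable_fun I0 (fun t => nm (ee t - ee x)).
    by apply: cmeas_nm; cmeas_tac.
  have := mn mI0 _ (measurable_itv `]-oo, (n.+1%:R^-1 : RR)[); congr (measurable (_ `&` _)).
have al0 : 0 < al by lra.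
have e' : 0 < e / (4 * al ^+ 2) * fine (k [set x]).
  by rewrite mulr_gt0// divr_gt0// mulr_gt0// exprn_gt0.
have [||||||n Hn] := @shrinking_integral _ _ _ k V ((fun t => `|g t - g x|) \_ I0) (e / (4 * al ^+ 2) * fine (k [set x])).
- exact: mV.
- move=> i j ij; apply/subsetPset => t [It /= h]; split => //=; apply: (lt_le_trans h).
  by rewrite lef_pV2 ?posrE// ler_nat.
- exact: igBr.
- by move=> t; rewrite patchE; case: ifP.
- move=> t Ht; suff -> : t = x by rewrite patchE subrr normr0; case: ifP.
  have [It _] := Ht 0%N I; apply: chord_eq0 => //; apply/eqP.
  rewrite eq_le nm_ge0 andbT leNgt; apply/negP => h.
  have [N _ HN] := @near_infty_natSinv_lt RR (PosNum h).
  by have [_ /=] := Ht N I; have := HN N (leqnn N) => /= /ltW h1; rewrite ltNge h1.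
- exact: e'.
apply: (@good_of x al e (2 * (1 + al) ^+ 2 / n.+1%:R^-1 ^+ 2) 1 e0 _ ltr01).
  exact: far_ge0.
move=> z z1 _ nt; have y0 : 0 < 1 - nm z by rewrite subr_gt0.
have mi : measurable_fun I0 (\1_(V n) : MR -> RR) by apply: measurable_indic; exact: mV.
exists (fun t => 2 / (1 - nm z) * \1_(V n) t).
  split.
  - exact: (measurable_funM (measurable_cst _) mi).
  - by move=> t; rewrite mulr_ge0// divr_ge0// ltW.
  - move=> t It; rewrite indicE; case: (boolP (t \in V n)) => [_|h]; rewrite ?mulr1 ?mulr0 ?add0r.
      rewrite (le_trans (pk_le t z1))// lerDl mulr_ge0 ?(ltW y0)// far_ge0.
    apply: (@pk_far x) => //; rewrite ?invr_gt0// leNgt; apply/negP => h'; move/negP: h; apply.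
    by rewrite inE.
apply: (@le_trans _ _ ((2 / (1 - nm z))%:E * \int[k]_(t in V n) (((fun t => `|g t - g x|) \_ I0) t)%:E)%E).
  have hV : V n = I0 `&` V n by rewrite /V setIA setIid.
  rewrite [X in (_ <= _ * integral _ X _)%E]hV.
  rewrite integral_mkcondr -ge0_integralZl_EFin ?divr_ge0 ?(ltW y0)//.
  - apply: ge0_le_integral => //.
    + by move=> t _; rewrite lee_fin !mulr_ge0 ?invr_ge0 ?(ltW y0).
    + apply/measurable_EFinP; apply: measurable_funM; last exact: mgB.
      exact: (measurable_funM (measurable_cst _) mi).
    + apply: measurable_funeM; apply/measurable_restrict => //.
      apply/measurable_EFinP; have h := mgB x.
      apply: (@eq_measurable_fun _ _ _ _ _ (fun t => `|g t - g x|)).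
        by move=> t; rewrite inE => -[_ [It _]]; rewrite patchE mem_set.
      by apply: measurable_funS h => // ? [].
    + move=> t It; rewrite patchE !indicE; case: (boolP (t \in V n)) => h /=.
        by rewrite patchE mem_set// mulr1.
      by rewrite mulr0 mul0r mule0.
  - by move=> t _; rewrite patchE; case: ifP => // _; rewrite lee_fin patchE; case: ifP.
  - apply/measurable_restrict => //.
    apply/measurable_EFinP; have h := mgB x.
    apply: (@eq_measurable_fun _ _ _ _ _ (fun t => `|g t - g x|)).
      by move=> t; rewrite inE => -[_ [It _]]; rewrite patchE mem_set.
    by apply: measurable_funS h => // ? [].
apply: (@le_trans _ _ ((2 / (1 - nm z))%:E * (e / (4 * al ^+ 2) * fine (k [set x]))%:E)%E).
  by apply: lee_wpmul2l; [rewrite lee_fin divr_ge0// ltW|exact: ltW].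
apply: (@le_trans _ _ ((e / 2)%:E * (pk z x * fine (k [set x]))%:E)%E); last first.
  apply: lee_wpmul2l; first by rewrite lee_fin divr_ge0// ltW.
  rewrite EFinM fineK// /pP.
  have -> : ((pk z x)%:E * k [set x] = \int[k]_(t in [set x]) (pk z t)%:E)%E.
    rewrite (eq_integral (cst (pk z x)%:E)) ?integral_cst// => t.
    by rewrite inE => ->.
  apply: ge0_subset_integral => //.
  - by apply/measurable_EFinP; exact: measurable_pk.
  - by move=> t _; rewrite lee_fin ltW// pk_gt0.
  - by move=> t ->.
rewrite -!EFinM lee_fin mulrA [leRHS]mulrA ler_wpM2r ?(ltW kx0)//.
apply: (@le_trans _ _ (e / 2 * ((1 - nm z) / (al * (1 - nm z)) ^+ 2))).
  rewrite le_eqVlt; apply/orP; left; apply/eqP; field.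
  by rewrite !gt_eqF.
apply: ler_wpM2l; first by rewrite divr_ge0// ltW.
apply: le_trans (pk_bounds x z1).1; apply: ler_wpM2l; first exact: ltW.
have D0 : 0 < nm (ee x - z) by rewrite -nm_kernel_dist nm_gt0 kernel_neq0.
by rewrite lef_pV2 ?posrE ?exprn_gt0 ?mulr_gt0// ler_sqr ?nnegrE ?mulr_ge0 ?(ltW D0) ?ltW.
Qed.

Let dyadic_scale (y d : RR) : 0 < y -> y < d -> exists n, 2 ^+ n * y < d /\ d <= 2 ^+ n.+1 * y.
Proof.
move=> y0 yd.
have ex : exists m, d <= 2 ^+ m * y.
  have [N _ HN] := @near_infty_natSinv_lt RR (PosNum (divr_gt0 y0 (lt_trans y0 yd))).
  exists N; have /= := HN N (leqnn N).
  have d0 := lt_trans y0 yd.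
  rewrite ltr_pdivlMr// mulrC ltr_pdivrMr// => h.
  apply: (le_trans (ltW h)); rewrite mulrC ler_wpM2r ?(ltW y0)//.
  by rewrite -natrX ler_nat ltn_expl.
case: (ex_minnP ex) => -[|n] hn min; first by rewrite expr0 mul1r leNgt yd in hn.
by exists n; split => //; rewrite ltNge; apply/negP => /min; rewrite ltnn.
Qed.

Let good_pt x : 0 < x -> x < 1 ->
  (forall e, 0 < e -> exists2 d, 0 < d & forall r, 0 < r -> r < d ->
    (\int[k]_(y in `](x - r)%R, (x + r)%R[) `|g y - g x|%:E
       <= e%:E * k `](x - r)%R, (x + r)%R[%classic)%E) -> good x.
Proof.
move=> x0 x1 H al e a1 e0.
have [c c0 Hc] := chord_bounds x0 x1.
(* With [a = |t - x| / (1 - |z|)] these constants give [(1 - |z|) (1 + a) <= B |ee t - z|] and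
   [|ee t - z| <= L (1 + a) (1 - |z|)] in the Stolz region. *)
pose B : RR := 1 + (1 + al) / c; pose L : RR := 2 * pi + al.
have B0 : 0 < B by rewrite ltr_wpDr// divr_ge0 ?(ltW c0)//; lra.
have L0 : 0 < L by rewrite /L; have := pi_gt0 RR; lra.
(* The near part of the kernel is at most [8 * B ^+ 2 / (1 - |z|)] times the dyadic sum, and the
   dyadic sum at most [16 / 3 * L ^+ 2 * (1 - |z|)] times [pk z]; the product of both factors with
   [e1] is [e / 2]. *)
pose e1 : RR := 3 * e / (256 * B ^+ 2 * L ^+ 2).
have e10 : 0 < e1 by rewrite divr_gt0 ?mulr_gt0 ?exprn_gt0.
have [d d0 Hd] := H _ e10.
pose dl : RR := Num.min d (Num.min x (1 - x)).
have dl0 : 0 < dl by rewrite !lt_min d0 x0 subr_gt0.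
have cd : 0 < c * (dl / 2) by rewrite mulr_gt0// divr_gt0.
apply: (@good_of x al e (2 * (1 + al) ^+ 2 / (c * (dl / 2)) ^+ 2) dl e0 (far_ge0 _ _) dl0).
(* The inequality behind [pk z t <= A * dyadic n.+1 (a t)], with [D = |ee t - z|] and [S] the dyadic
   sum; its hypotheses are [dyadic_lower] and the property of [B]. *)
have alg (S a' D y : RR) : 0 < y -> 0 < D -> 1 <= 4 * S * (1 + a') ^+ 2 -> 0 <= S ->
    y * (1 + a') <= B * D -> 0 <= a' -> 2 * y <= 8 * B ^+ 2 / y * S * D ^+ 2.
  move=> y0 Dp hS S0 BD a'0.
  have h3 : (y * (1 + a')) ^+ 2 <= (B * D) ^+ 2.
    by rewrite ler_sqr ?nnegrE ?mulr_ge0 ?(ltW y0) ?(ltW B0) ?(ltW Dp)//; lra.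
  have h4 : y ^+ 2 <= 4 * S * (B * D) ^+ 2.
    apply: (@le_trans _ _ (4 * S * (y * (1 + a')) ^+ 2)); last by rewrite ler_wpM2l// mulr_ge0.
    by rewrite exprMn mulrCA -[leLHS]mulr1 ler_wpM2l ?sqr_ge0.
  have -> : 8 * B ^+ 2 / y * S * D ^+ 2 = (2 * (4 * S * (B * D) ^+ 2)) / y by ring.
  by rewrite ler_pdivlMr// -[leLHS]mulrA -expr2 ler_wpM2l.
move=> z z1 zd nt.
have y0 : 0 < 1 - nm z by rewrite subr_gt0.
(* [n] is the last dyadic scale below [dl], so the hypothesis on intervals applies up to it; points
   with [a t >= 2 ^+ n] have distance at least [dl / 2] from [x] and belong to [pk_far]. *)
have [n [n1 n2]] := dyadic_scale y0 (le_lt_trans (dist_ge_nm z x) zd).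
pose a t := `|t - x| / (1 - nm z).
have a0 t : 0 <= a t by rewrite divr_ge0// ltW.
have ta t : `|t - x| = a t * (1 - nm z) by rewrite /a divfK// gt_eqF.
have ma : measurable_fun I0 (fun t => dyadic n.+1 (a t)).
  rewrite /dyadic; apply: measurable_sum => j; apply: measurable_funM => //.
  pose J : set MR := `](x - 2 ^+ j * (1 - nm z)), (x + 2 ^+ j * (1 - nm z))[%classic.
  have mi : measurable_fun I0 (\1_J : MR -> RR).
    by apply: measurable_indic; exact: measurable_itv.
  apply: eq_measurable_fun mi => t _; rewrite indicE; congr (nat_of_bool _)%:R.
  by apply/esym; rewrite /a ltr_pdivrMr// mem_setE in_itv/= ltr_norml ltrBlDl ltrBrDl addrC.
pose A : RR := 8 * B ^+ 2 / (1 - nm z).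
have A0 : 0 <= A by rewrite divr_ge0 ?(ltW y0)// mulr_ge0 ?sqr_ge0.
exists (fun t => A * dyadic n.+1 (a t)).
  split; first exact: (measurable_funM (measurable_cst _) ma).
    by move=> t; rewrite mulr_ge0// dyadic_ge0.
  move=> t It; have [c1 c2] := Hc t It; have [h1 h2] := nt_ineq t a1 nt.
  have [an|an] := ltP (a t) (2 ^+ n); last first.
    apply: ler_wpDl; first by rewrite mulr_ge0// dyadic_ge0.
    apply: (@pk_far x) => //; apply: le_trans c1; rewrite ler_wpM2l ?(ltW c0)//.
    rewrite ler_pdivrMr// mulrC ta; apply: (le_trans n2); rewrite exprS -mulrA ler_wpM2l//.
    by rewrite ler_wpM2r// ltW.
  apply: ler_wpDr; first by rewrite mulr_ge0 ?(ltW y0)// far_ge0.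
  apply: (le_trans (pk_bounds t z1).2).
  have D0 := dist_ge_nm z t; have Dp := lt_le_trans y0 D0.
  have BD : (1 - nm z) * (1 + a t) <= B * nm (ee t - z).
    rewrite mulrDr mulr1 [_ * a t]mulrC -ta /B [leRHS]mulrDl mul1r.
    apply: lerD => //; rewrite mulrAC ler_pdivlMr// mulrC; exact: le_trans c1 h1.
  have S := dyadic_lower (a0 t) an; have S0 := dyadic_ge0 n.+1 (a t).
  rewrite /A ler_pdivrMr ?exprn_gt0//.
  exact: (alg _ _ _ _ y0 Dp S S0 BD (a0 t)).
have mh := mgB x.
have hJ j : (j <= n)%N -> 2 ^+ j * (1 - nm z) < dl.
  move=> jn; apply: le_lt_trans n1; rewrite ler_wpM2r ?(ltW y0)//.
  by rewrite ler_weXn2l// ler1n.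
have P := @integral_dyadic x (1 - nm z) n e1 (fun t => `|g t - g x|) y0 (ltW e10) mh (fun t => normr_ge0 _) _ _.
apply: (@le_trans _ _ (A%:E * (e1%:E * \int[k]_(t in I0) (dyadic n.+1 (a t))%:E))%E).
  under eq_integral do rewrite -mulrA EFinM.
  rewrite ge0_integralZl_EFin//; last 2 first.
  - by move=> t _; rewrite lee_fin mulr_ge0// dyadic_ge0.
  - by apply/measurable_EFinP; exact: measurable_funM.
  apply: lee_wpmul2l; first by rewrite lee_fin.
  apply: P => j jn; have := hJ j jn.
    rewrite !lt_min => /andP[_ /andP[j1 j2]] t /=; rewrite /I0/= !in_itv/= => /andP[? ?].
    by apply/andP; split; lra.
  rewrite lt_min => /andP[j1 _]; apply: Hd => //.
  by rewrite mulr_gt0// exprn_gt0.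
rewrite muleA -EFinM -ge0_integralZl_EFin//; last 3 first.
- by move=> t _; rewrite lee_fin dyadic_ge0.
- exact/measurable_EFinP.
- by rewrite mulr_ge0// ltW.
rewrite /pP -ge0_integralZl_EFin//; last 3 first.
- by move=> t _; rewrite lee_fin ltW// pk_gt0.
- by apply/measurable_EFinP; exact: measurable_pk.
- by rewrite divr_ge0// ltW.
apply: ge0_le_integral => //.
- by move=> t _; rewrite -EFinM lee_fin; apply: mulr_ge0 (dyadic_ge0 _ _); exact: mulr_ge0 (ltW e10).
- by apply: measurable_funeM; exact/measurable_EFinP.
- by apply: measurable_funeM; apply/measurable_EFinP; exact: measurable_pk.
move=> t It; have [c1 c2] := Hc t It; have [h1 h2] := nt_ineq t a1 nt.
rewrite -!EFinM lee_fin.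
have D0 := dist_ge_nm z t; have Dp := lt_le_trans y0 D0.
have DL : nm (ee t - z) <= L * (1 + a t) * (1 - nm z).
  have alg2 (p a' y D D' : RR) : 0 <= p -> 0 <= a' -> 0 <= y -> D' <= 2 * p * (a' * y) ->
      D <= D' + al * y -> D <= (2 * p + al) * (1 + a') * y.
    move=> p0 a'0 yy hD' hD; have p1 : 0 <= p * y by exact: mulr_ge0.
    have p2 : 0 <= al * (a' * y) by rewrite !mulr_ge0//; lra.
    lra.
  by rewrite ta in c2; exact: (alg2 _ _ _ _ _ (pi_ge0 RR) (a0 t) (ltW y0) c2 h2).
have S := dyadic_upper n.+1 (a0 t); have S0 := dyadic_ge0 n.+1 (a t).
apply: (@le_trans _ _ (e / 2 * ((1 - nm z) / nm (ee t - z) ^+ 2))); last first.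
  by apply: ler_wpM2l; [rewrite divr_ge0// ltW|exact: (pk_bounds t z1).1].
rewrite /A /e1.
have -> : 8 * B ^+ 2 / (1 - nm z) * (3 * e / (256 * B ^+ 2 * L ^+ 2)) * dyadic n.+1 (a t) =
   e / 2 * (3 / (16 * L ^+ 2) * (dyadic n.+1 (a t) / (1 - nm z))).
  by field; rewrite !gt_eqF.
apply: ler_wpM2l; first by rewrite divr_ge0// ltW.
rewrite ler_pdivlMr ?exprn_gt0//.
apply: (@le_trans _ _ (3 / (16 * L ^+ 2) * (dyadic n.+1 (a t) / (1 - nm z)) * (L * (1 + a t) * (1 - nm z)) ^+ 2)).
  apply: ler_wpM2l.
    apply: mulr_ge0; last exact: divr_ge0 S0 (ltW y0).
    by rewrite divr_ge0// mulr_ge0// sqr_ge0.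
  by rewrite ler_sqr ?nnegrE ?(ltW Dp)//; apply: le_trans DL; exact: ltW.
have -> : 3 / (16 * L ^+ 2) * (dyadic n.+1 (a t) / (1 - nm z)) * (L * (1 + a t) * (1 - nm z)) ^+ 2 =
  3 / 16 * (dyadic n.+1 (a t) * (1 + a t) ^+ 2) * (1 - nm z).
  by field; rewrite !gt_eqF.
by rewrite -[leRHS]mul1r ler_wpM2r ?(ltW y0)//; lra.
Qed.

Lemma poisson_differentiation : {ae k, forall x, I0 x -> good x}.
Proof.
have ig' : k.-integrable setT (EFin \o (g \_ I0)).
  by rewrite -restrict_EFin; exact/(integrable_mkcond _ mI0).
have := interval_differentiation kI kpos ig'.
apply: ae_mono => x Hx Ix; have [kx|[x0 H]] := Hx Ix; first exact: good_atom.
have x1 : x < 1 by move: Ix; rewrite /I0/= in_itv/= => /andP[].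
apply: good_pt => // e e0; have [d d0 Hd] := H e e0.
exists (Num.min d (Num.min x (1 - x))); first by rewrite !lt_min d0 x0 subr_gt0.
move=> r r0; rewrite !lt_min => /andP[rd /andP[rx r1]].
apply: le_trans (Hd r r0 rd); rewrite le_eqVlt; apply/orP; left; apply/eqP.
apply: eq_integral => t; rewrite inE/= in_itv/= => /andP[t1 t2].
by rewrite !patchE !mem_set//= /I0/= in_itv/=; apply/andP; split; lra.
Qed.
End poisson_differentiation.

(* The filter of nontangential approach to [ee x] within a Stolz region; the shift of the
   aperture makes the filter proper for every real [al]. *)
Definition ntf (x al : RR) : set_system CC := fun P => exists2 d : RR, 0 < d &
  forall z, nm z < 1 -> nm (ee x - z) < d -> nm (ee x - z) < (2 + `|al|) * (1 - nm z) -> P z.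

Lemma ntf_filter x al : Filter (ntf x al).
Proof.
split.
- by exists 1.
- move=> P Q [d d0 Hd] [e e0 He]; exists (Num.min d e); first by rewrite lt_min d0.
  by move=> z z1; rewrite lt_min => /andP[zd ze] nt; split; [exact: Hd|exact: He].
- by move=> P Q PQ [d d0 Hd]; exists d => // z z1 zd nt; apply: PQ; exact: Hd.
Qed.

(** Radii lie in every Stolz region. This gives both the properness of [ntf] and the passage from
    nontangential to radial limits. *)
Lemma radial_ntf x al P : ntf x al P -> \forall r \near (1 : RR)^'-, P (r%:C%C * ee x).
Proof.
move=> [d d0 Hd].
have h0 : \forall r \near (1 : RR)^'-, 0 < r by exact: nbhs_left_gt.
have h1 : \forall r \near (1 : RR)^'-, r < 1 by exact: nbhs_left_lt.
have hd : \forall r \near (1 : RR)^'-, 1 - d < r by apply: nbhs_left_gt; rewrite gtrBl.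
near=> r.
have r0 : 0 < r by near: r. have r1 : r < 1 by near: r. have rd : 1 - d < r by near: r.
have nz : nm (r%:C%C * ee x) = r by rewrite nmM nm_real nm_ee mulr1 ger0_norm// ltW.
have nd : nm (ee x - r%:C%C * ee x) = 1 - r.
  rewrite -[X in nm (X - _)]mul1r -mulrBl nmM nm_ee mulr1 -realC1 -realCB nm_real ger0_norm//.
  by rewrite subr_ge0 ltW.
apply: Hd; rewrite ?nz ?nd//; first lra.
by have := normr_ge0 al; nra.
Unshelve. all: by end_near.
Qed.

#[global] Instance ntf_proper x al : ProperFilter (ntf x al).
Proof.
apply: Build_ProperFilter (ntf_filter x al) => /radial_ntf h.
by have [] := filter_ex (F := (1 : RR)^'-) h.
Qed.

Lemma ntf_disc x al : \forall z \near ntf x al, nm z < 1.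
Proof. by exists 1. Qed.

Lemma ntlim_ntf (F : CC -> CC) x (L : CC) : (forall al, F @ ntf x al --> L) -> ntlim F (ee x) L.
Proof.
move=> H al a1 e e0; have /cvgCP/cvgr0Pnorm_lt/(_ e e0)[d d0 Hd] := H al.
exists d => // z; rewrite nm_lt1_norm !nm_lt_norm => z1 zd.
have -> : al%:C%C * (1 - `|z|) = (al * (1 - nm z))%:C%C by rewrite normCnm realCM realCB.
rewrite nm_lt_norm => nt.
have nt' : nm (ee x - z) < (2 + `|al|) * (1 - nm z).
  apply: (lt_le_trans nt); rewrite ler_wpM2r ?subr_ge0 ?ltW//.
  by have := ler_norm al; lra.
have := Hd z z1 zd nt'.
by rewrite /= ger0_norm ?nm_ge0.
Qed.

Lemma radial_cvg (F : CC -> CC) x (L : CC) : F @ ntf x 0 --> L -> (fun r : RR => F (r%:C%C * ee x)) @ (1 : RR)^'- --> L.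
Proof. by move=> h A /h; exact: radial_ntf. Qed.

(** * Nontangential limits of quotients of Poisson integrals *)

Lemma cint_real (k : {measure set MR -> \bar RR}) (phi : MR -> RR) :
  cint k I0 (fun t => (phi t)%:C%C) = (Rintegral k I0 phi)%:C%C.
Proof.
apply: CCext; first by rewrite Re_cint.
by rewrite Im_cint /Rintegral integral0.
Qed.

Lemma integrable_pk (k : {measure set MR -> \bar RR}) z : (k I0 < +oo)%E -> nm z < 1 ->
  k.-integrable I0 (EFin \o pk z).
Proof.
move=> fk z1; have := L1_Re (L1_pk z1 (L1_cst fk 1)).
by congr (_.-integrable _ (EFin \o _)); apply/funext => t; rewrite mulr1.
Qed.

Section nontangential_limit.
Variable k : {finite_measure set MR -> \bar RR}.
Hypothesis kI : k (~` I0) = 0%E.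
Hypothesis leb_le_k : forall phi : MR -> RR, measurable_fun I0 phi -> (forall t, 0 <= phi t) ->
  (\int[leb]_(t in I0) (phi t)%:E <= \int[k]_(t in I0) (phi t)%:E)%E.

Lemma nt_pint u : L1 k u -> {ae k, forall x, I0 x -> forall al,
  (fun z => pint k u z / (Rintegral k I0 (pk z))%:C%C) @ ntf x al --> u x}.
Proof.
move=> iu.
have fk : (k I0 < +oo)%E by rewrite ltey_eq fin_num_measure.
have := ae_and (poisson_differentiation kI leb_le_k (L1_Re iu))
               (poisson_differentiation kI leb_le_k (L1_Im iu)).
apply: ae_mono => x [HR HI] Ix al; apply/cvgCP/cvgr0Pnorm_lt => e e0.
have e3 : 0 < e / 3 by rewrite divr_gt0.
have a1 : 1 < 2 + `|al| by have := normr_ge0 al; lra.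
have [d1 d10 H1] := HR Ix _ _ a1 e3; have [d2 d20 H2] := HI Ix _ _ a1 e3.
exists (Num.min d1 d2); first by rewrite lt_min d10.
move=> z z1; rewrite lt_min => /andP[zd1 zd2] nt.
have := H1 z z1 zd1 nt; have := H2 z z1 zd2 nt; rewrite /=.
have ip := integrable_pk fk z1.
have P1 : 1 <= Rintegral k I0 (pk z).
  rewrite -lee_fin /Rintegral fineK ?integrable_fin_num//.
  rewrite -(integral_pk_leb z1); apply: leb_le_k; first exact: measurable_pk.
  by move=> t; rewrite ltW// pk_gt0.
have -> : (\int[k]_(t in I0) (pk z t)%:E = (Rintegral k I0 (pk z))%:E)%E.
  by rewrite /Rintegral fineK ?integrable_fin_num.
have iB : L1 k (fun t => u t - u x) by apply: L1B => //; exact: L1_cst.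
have iP := L1_pk z1 iB.
have iR : k.-integrable I0 (EFin \o (fun t => pk z t * `|ReC (u t) - ReC (u x)|)).
  have := L1_Re (L1_pk z1 (G := fun t => `|ReC (u t - u x)|%:C%C) _).
  have -> : (fun t => ReC ((pk z t)%:C%C * `|ReC (u t - u x)|%:C%C)) =
            (fun t => pk z t * `|ReC (u t) - ReC (u x)|).
    by apply/funext => t; rewrite -realCM ReR ReD ReN.
  apply; split; first by apply: cmeas_real; apply: measurableT_comp => //; case: iB => -[].
  have := integrable_norm (L1_Re iB); apply: eq_integrable => // t _.
  by rewrite nm_real normr_id.
have iI : k.-integrable I0 (EFin \o (fun t => pk z t * `|ImC (u t) - ImC (u x)|)).
  have := L1_Re (L1_pk z1 (G := fun t => `|ImC (u t - u x)|%:C%C) _).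
  have -> : (fun t => ReC ((pk z t)%:C%C * `|ImC (u t - u x)|%:C%C)) =
            (fun t => pk z t * `|ImC (u t) - ImC (u x)|).
    by apply/funext => t; rewrite -realCM ReR ImD ImN.
  apply; split; first by apply: cmeas_real; apply: measurableT_comp => //; case: iB => -[].
  have := integrable_norm (L1_Im iB); apply: eq_integrable => // t _.
  by rewrite nm_real normr_id.
have -> : (\int[k]_(t in I0) (pk z t * `|ReC (u t) - ReC (u x)|)%:E =
   (Rintegral k I0 (fun t => (pk z t * `|ReC (u t) - ReC (u x)|)%R))%:E)%E.
  by rewrite /Rintegral fineK ?integrable_fin_num.
have -> : (\int[k]_(t in I0) (pk z t * `|ImC (u t) - ImC (u x)|)%:E =
   (Rintegral k I0 (fun t => (pk z t * `|ImC (u t) - ImC (u x)|)%R))%:E)%E.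
  by rewrite /Rintegral fineK ?integrable_fin_num.
rewrite -!EFinM !lee_fin => hI hR.
have key : nm (pint k u z - u x * (Rintegral k I0 (pk z))%:C%C) <= (e / 3 + e / 3) * Rintegral k I0 (pk z).
  have -> : pint k u z - u x * (Rintegral k I0 (pk z))%:C%C = pint k (fun t => u t - u x) z.
    rewrite /pint.
    have -> : cint k I0 (fun t => (pk z t)%:C%C * (u t - u x)) =
      cint k I0 (fun t => (pk z t)%:C%C * u t - u x * ((pk z t)%:C%C * 1)).
      by apply: eq_cint => t _; ring.
    rewrite cintB ?cintZ//; last 3 first.
    - exact/L1_pk/L1_cst.
    - exact: L1_pk.
    - exact/L1Z/L1_pk/L1_cst.
    by congr (_ - _ * _); rewrite -cint_real; apply: eq_cint => t _; rewrite mulr1.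
  apply: (le_trans (nm_cint_le iP)).
  rewrite mulrDl; apply: le_trans (lerD hR hI); rewrite -RintegralD//.
  apply: le_Rintegral => //.
  - exact: L1_nm iP.
  - exact: (integrableD mI0 iR iI).
  - move=> t It; rewrite nmM nm_real gtr0_norm ?pk_gt0// -mulrDr ler_wpM2l ?(ltW (pk_gt0 _ _))//.
    by rewrite (le_trans (nm_le_ReIm _))// ReD ImD ReN ImN.
rewrite /= ger0_norm ?nm_ge0//.
have P0 : 0 < Rintegral k I0 (pk z) by exact: lt_le_trans P1.
have P0C : (Rintegral k I0 (pk z))%:C%C != 0 by rewrite -nm_eq0 nm_real normr_eq0 gt_eqF.
have -> : pint k u z / (Rintegral k I0 (pk z))%:C%C - u x =
   (pint k u z - u x * (Rintegral k I0 (pk z))%:C%C) / (Rintegral k I0 (pk z))%:C%C.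
  by field.
rewrite nmM nmV nm_real gtr0_norm// ltr_pdivrMr//; apply: (le_lt_trans key).
by rewrite ltr_pM2r//; lra.
Qed.
End nontangential_limit.

(** Differentiation is stated for finite measures carried by [[0, 1[], whereas [leb] lives on the
    whole line. *)
Definition lebI : {finite_measure set MR -> \bar RR} := mfrestr mI0 leb_I0_lty.

Lemma lebIE A : lebI A = leb (A `&` I0). Proof. by []. Qed.

Lemma integral_lebI (h : MR -> \bar RR) : (\int[lebI]_(t in I0) h t = \int[leb]_(t in I0) h t)%E.
Proof. by apply: eq_measure_integral => A mA AI; apply: (eq_trans (lebIE A)); congr (leb _); exact/setIidPl. Qed.

Lemma Rintegral_lebI (h : MR -> RR) : Rintegral lebI I0 h = Rintegral leb I0 h.
Proof. by rewrite /Rintegral integral_lebI. Qed.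

Lemma cint_lebI (h : MR -> CC) : cint lebI I0 h = cint leb I0 h.
Proof. by rewrite /cint !Rintegral_lebI. Qed.

Lemma integrable_lebI (h : MR -> \bar RR) : leb.-integrable I0 h -> lebI.-integrable I0 h.
Proof. by move=> /integrableP[mh fh]; apply/integrableP; split; rewrite ?integral_lebI. Qed.

Lemma ae_lebI (P : MR -> Prop) :
  {ae lebI, forall t, I0 t -> P t} -> {ae leb, forall t, I0 t -> P t}.
Proof.
move=> [N [mN N0 HN]]; exists (N `&` I0); split => //; first exact: measurableI.
move=> t nP; split; first exact: HN.
by apply: contrapT => nI; apply: nP => /nI.
Qed.

Lemma nt_pint_leb G : L1 leb G -> {ae leb, forall x, I0 x -> forall al,
  pint leb G @ ntf x al --> G x}.
Proof.
move=> [cG iG].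
have k0 : lebI (~` I0) = 0%E by rewrite lebIE setICl; exact: (measure0 (@lebesgue_measure RR)).
have := @nt_pint lebI k0 _ G (conj cG (integrable_lebI iG)).
have h (phi : MR -> RR) : (\int[leb]_(t in I0) (phi t)%:E <= \int[lebI]_(t in I0) (phi t)%:E)%E.
  by rewrite integral_lebI.
move=> /(_ (fun phi _ _ => h phi))/ae_lebI; apply: ae_mono => x Hx Ix al.
apply: (cvgC_near _ _ (Hx Ix al)); apply: filterS (ntf_disc x al) => z z1.
by rewrite /pint cint_lebI Rintegral_lebI Rintegral_pk_leb// realC1 divr1.
Qed.

(** * Fatou's theorem for bounded analytic functions *)

Lemma cint_ee_orth m n : cint leb I0 (fun t => ee t ^+ m * (ee t)^* ^+ n) = (m == n)%:R.
Proof.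
have [mn|nm] := leqP n m.
  rewrite (eq_cint _ (G := fun t => ee t ^+ (m - n))) ?cint_eeX ?subn_eq0.
    by rewrite eqn_leq mn andbT.
  by move=> t _; rewrite -{1}(subnK mn) exprD -mulrA -exprMn eeJ expr1n mulr1.
rewrite (eq_cint _ (G := fun t => (ee t)^* ^+ (n - m))) ?cint_eeJX ?subn_eq0.
  by rewrite (ltn_eqF nm) leqNgt nm.
by move=> t _; rewrite -{1}(subnK (ltnW nm)) exprD mulrCA -exprMn eeJ expr1n mulr1.
Qed.

Lemma L1_ee m n : L1 leb (fun t => ee t ^+ m * (ee t)^* ^+ n).
Proof.
have := L1_eeJX n (L1_eeX m (L1_cst leb_I0_lty 1)).
by apply: eq_L1 => t _; rewrite mul1r.
Qed.

(** Two radii occur because the distance of two dilations is controlled by comparing [<F_s, F_r>]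
    with [<F_r, F_r>]. *)
Lemma horner_parseval (p : {poly CC}) (r s : RR) :
  cint leb I0 (fun t => p.[s%:C%C * ee t] * (p.[r%:C%C * ee t])^*) =
  (\sum_(i < size p) sqn p`_i * (s * r) ^+ i)%:C%C.
Proof.
have pE (a : RR) t : p.[a%:C%C * ee t] = \sum_(i < size p) p`_i * a%:C%C ^+ i * ee t ^+ i.
  by rewrite horner_coef; apply: eq_bigr => i _; rewrite exprMn mulrA.
have pJ t : (p.[r%:C%C * ee t])^* = \sum_(j < size p) (p`_j)^* * r%:C%C ^+ j * (ee t)^* ^+ j.
  by rewrite pE rmorph_sum; apply: eq_bigr => i _; rewrite !rmorphM !rmorphXn/= conjR.
rewrite (eq_cint _ (G := fun t => \sum_(i < size p) \sum_(j < size p)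
    p`_i * s%:C%C ^+ i * ((p`_j)^* * r%:C%C ^+ j) * (ee t ^+ i * (ee t)^* ^+ j))); last first.
  move=> t _; rewrite pJ pE mulr_suml; apply: eq_bigr => i _.
  by rewrite mulr_sumr; apply: eq_bigr => j _; ring.
rewrite cint_sum; last by move=> i; apply: L1_sum => j; apply: L1Z; exact: L1_ee.
rewrite rmorph_sum; apply: eq_bigr => i _.
rewrite cint_sum; last by move=> j; apply: L1Z; exact: L1_ee.
rewrite (bigD1 i)//= big1 ?addr0; last first.
  move=> j ji; rewrite cintZ ?cint_ee_orth; last exact: L1_ee.
  by rewrite eq_sym (inj_eq val_inj) (negbTE ji) mulr0.
rewrite cintZ ?cint_ee_orth ?eqxx ?mulr1; last exact: L1_ee.
rewrite realCM sqnE rmorphXn/= realCM exprMn; ring.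
Qed.

Lemma horner_lipschitz (p : {poly CC}) : exists2 C : RR, 0 <= C &
  forall w z, nm w <= 1 -> nm z <= 1 -> nm (p.[w] - p.[z]) <= C * nm (w - z).
Proof.
elim/poly_ind: p => [|p c [C C0 HC]].
  by exists 0 => // w z _ _; rewrite !horner0 subrr nm0 mul0r.
pose D := \sum_(i < size p) nm p`_i.
have D0 : 0 <= D by apply: sumr_ge0 => i _; exact: nm_ge0.
exists (C + D); first exact: addr_ge0.
move=> w z w1 z1; rewrite !hornerMXaddC.
have -> : p.[w] * w + c - (p.[z] * z + c) = (p.[w] - p.[z]) * w + p.[z] * (w - z) by ring.
apply: (le_trans (nmD _ _)); rewrite [leRHS]mulrDl !nmM; apply: lerD.
  by rewrite -[leRHS]mulr1; apply: ler_pM; rewrite ?nm_ge0// HC.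
by apply: ler_pM; rewrite ?nm_ge0// nm_horner_le.
Qed.

Lemma discA_continuous F z (e : RR) : discA F -> nm z < 1 -> 0 < e ->
  exists2 d : RR, 0 < d & forall w, nm (w - z) < d -> nm (F w - F z) <= e.
Proof.
move=> dF z1 e0; pose r := (1 + nm z) / 2.
have r0 : 0 <= r by rewrite divr_ge0// addr_ge0// nm_ge0.
have r1 : r < 1 by rewrite /r; lra.
have e3 : 0 < e / 3 by rewrite divr_gt0.
have [p Hp] := dF r _ r0 r1 e3; have [C C0 HC] := horner_lipschitz p.
have C1 : 0 < C + 1 by rewrite ltr_wpDl.
exists (Num.min ((1 - nm z) / 2) (e / 3 / (C + 1))).
  by rewrite lt_min !divr_gt0// subr_gt0.
move=> w; rewrite lt_min => /andP[w1 w2].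
have wr : nm w <= r by have := nmD (w - z) z; rewrite subrK /r; lra.
have zr : nm z <= r by rewrite /r; lra.
have -> : F w - F z = (F w - p.[w]) + (p.[w] - p.[z]) - (F z - p.[z]) by ring.
apply: (le_trans (nmBle _ _)); have := nmD (F w - p.[w]) (p.[w] - p.[z]).
have := Hp w wr; have := Hp z zr.
have := HC w z (le_trans wr (ltW r1)) (ltW z1).
have : C * nm (w - z) <= e / 3.
  move: w2; rewrite ltr_pdivlMr// => h; apply: le_trans (ltW h).
  by rewrite mulrC ler_wpM2l ?nm_ge0// lerDl.
lra.
Qed.

Lemma cmeas_lim (f : nat -> MR -> CC) (g : MR -> CC) : (forall n, cmeas (f n)) ->
  (forall t, I0 t -> (fun n => f n t) @ \oo --> g t) -> cmeas g.
Proof.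
move=> mf fg; split.
  have h n : measurable_fun I0 (fun t => ReC (f n t)) by have [] := mf n.
  have := @measurable_fun_cvg _ MR RR I0 (fun n t => ReC (f n t)) (fun t => ReC (g t)) h; apply.
  by move=> t It; exact: (cvgC_Re _ (fg t It)).
have h n : measurable_fun I0 (fun t => ImC (f n t)) by have [] := mf n.
have := @measurable_fun_cvg _ MR RR I0 (fun n t => ImC (f n t)) (fun t => ImC (g t)) h; apply.
by move=> t It; exact: (cvgC_Im _ (fg t It)).
Qed.

Lemma cmeas_horner (p : {poly CC}) G : cmeas G -> cmeas (fun t => p.[G t]).
Proof.
move=> mG; elim/poly_ind: p => [|p c IH].
  by apply: (eq_cmeas (F := fun _ => 0)) => [t _|]; rewrite ?horner0//; exact: cmeas_cst.
apply: (eq_cmeas (F := fun t => p.[G t] * G t + c)) => [t _|].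
  by rewrite hornerMXaddC.
by apply: cmeasD; [exact: cmeasM|exact: cmeas_cst].
Qed.

Definition dil (F : CC -> CC) (r : RR) (t : MR) : CC := F (r%:C%C * ee t).

Lemma nm_dil (r : RR) t : 0 <= r -> nm (r%:C%C * ee t) = r.
Proof. by move=> r0; rewrite nmM nm_real nm_ee mulr1 ger0_norm. Qed.

Lemma cmeas_dil F r : discA F -> 0 <= r -> r < 1 -> cmeas (dil F r).
Proof.
move=> dF r0 r1; have pn n : {p : {poly CC} | forall z, nm z <= r -> nm (F z - p.[z]) <= n.+1%:R^-1}.
  by apply/cid; apply: dF => //; rewrite invr_gt0.
apply: (@cmeas_lim (fun n t => (sval (pn n)).[r%:C%C * ee t])) => [n|t It].
  by apply: cmeas_horner; apply: cmeasM; [exact: cmeas_cst|exact: cmeas_ee].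
apply/cvgCP; apply: (@squeeze_cvgr _ _ _ _ (fun=> 0) (fun n => n.+1%:R^-1)).
- near=> n; rewrite nm_ge0/= nmB; case: (pn n) => p /= Hp.
  by apply: Hp; rewrite nm_dil.
- exact: cvg_cst.
- exact: cvg_harmonic.
Unshelve. all: by end_near.
Qed.

Lemma integral_near0 (A B : MR -> CC) (C : RR) : L1 leb A -> L1 leb B ->
  (forall t, I0 t -> nm (A t - B t) <= C) -> nm (cint leb I0 A - cint leb I0 B) <= C.
Proof. by move=> iA iB H; rewrite -cintB//; apply: cint_bdd => //; exact: L1B. Qed.

Section dilations.
Variable F : CC -> CC.
Hypothesis dF : discA F.
Hypothesis F1 : forall z, nm z < 1 -> nm (F z) <= 1.

Lemma nm_dil_le r t : 0 <= r -> r < 1 -> nm (dil F r t) <= 1.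
Proof. by move=> r0 r1; apply: F1; rewrite nm_dil. Qed.

Lemma L1_dil2 r s : 0 <= r -> r < 1 -> 0 <= s -> s < 1 ->
  L1 leb (fun t => dil F s t * (dil F r t)^*).
Proof.
move=> r0 r1 s0 s1; apply: (L1_bdd leb_I0_lty (B := 1)).
  by apply: cmeasM; [|apply: cmeasJ]; exact: cmeas_dil.
by move=> t _; rewrite nmM nmJ mulr_ile1 ?nm_ge0 ?nm_dil_le.
Qed.

(** For polynomials both sides are Parseval sums, compared term by term through
    [(r * r) ^+ i <= (s * r) ^+ i]. *)
Lemma dil_corr (r s : RR) : 0 <= r -> r <= s -> s < 1 ->
  ReC (cint leb I0 (fun t => dil F r t * (dil F r t)^*)) <=
  ReC (cint leb I0 (fun t => dil F s t * (dil F r t)^*)).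
Proof.
move=> r0 rs s1; have s0 := le_trans r0 rs; have r1 := le_lt_trans rs s1.
(* Each of the two correlations changes by at most [2 d + d ^+ 2 <= 3 d] under approximation, in
   total by at most [e]. *)
apply/ler_addgt0Pr => e e0; pose d := Num.min 1 (e / 6).
have d0 : 0 < d by rewrite lt_min ltr01 divr_gt0.
have d1 : d <= 1 by rewrite ge_min lexx.
have de : d <= e / 6 by rewrite ge_min lexx orbT.
have [p Hp] := dF s0 s1 d0.
have iP a b : L1 leb (fun t => p.[a%:C%C * ee t] * (p.[b%:C%C * ee t])^*).
  have cP c : cmeas (fun t => p.[c%:C%C * ee t]).
    by apply: cmeas_horner; apply: cmeasM; [exact: cmeas_cst|exact: cmeas_ee].
  have bP (c : RR) : exists B, forall t, nm p.[c%:C%C * ee t] <= B.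
    exists (\sum_(i < size p) nm (p`_i) * `|c| ^+ i) => t; rewrite horner_coef.
    by apply: (le_trans (nm_sum _)); apply: ler_sum => i _; rewrite nmM nmX nmM nm_real nm_ee mulr1.
  have [A HA] := bP a; have [B HB] := bP b.
  apply: (L1_bdd leb_I0_lty (B := A * B)); first by apply: cmeasM; [|apply: cmeasJ]; exact: cP.
  by move=> t _; rewrite nmM nmJ; apply: ler_pM; rewrite ?nm_ge0.
have close a : 0 <= a -> a <= s ->
    nm (cint leb I0 (fun t => dil F a t * (dil F r t)^*) -
        cint leb I0 (fun t => p.[a%:C%C * ee t] * (p.[r%:C%C * ee t])^*)) <= 3 * d.
  move=> a0 as_; have a1 := le_lt_trans as_ s1.
  apply: integral_near0; [exact: L1_dil2|exact: iP|] => t _.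
  have ha : nm (dil F a t - p.[a%:C%C * ee t]) <= d by apply: Hp; rewrite nm_dil.
  have hr : nm (dil F r t - p.[r%:C%C * ee t]) <= d by apply: Hp; rewrite nm_dil.
  have ba := nm_dil_le t a0 a1; have br := nm_dil_le t r0 r1.
  move: ha hr ba br; move: (dil F a t) (dil F r t) => A R.
  move: p.[a%:C%C * ee t] p.[r%:C%C * ee t] => A' R' ha hr ba br.
  have -> : A * R^* - A' * R'^* = (A - A') * R^* + (A * (R - R')^* - (A - A') * (R - R')^*).
    by rewrite conjB; ring.
  apply: (le_trans (nmD _ _)).
  have := nmBle (A * (R - R')^*) ((A - A') * (R - R')^*); rewrite !nmM !nmJ.
  have := nm_ge0 (A - A'); have := nm_ge0 (R - R'); have := nm_ge0 A; have := nm_ge0 R.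
  by move: (nm (A - A')) (nm (R - R')) (nm A) (nm R) ha hr ba br => x y u v *; nra.
have h1 := close r r0 rs; have h2 := close s s0 (lexx s).
have hR := le_trans (Re_le_nm _) h1; have hS := le_trans (Re_le_nm _) h2.
move: hR hS; rewrite [ReC (_ - _)]ReD [ReC (- _)]ReN [ReC (cint _ _ (fun t => dil F s t * _) - _)]ReD [ReC (- _)]ReN !horner_parseval.
have : \sum_(i < size p) sqn p`_i * (r * r) ^+ i <= \sum_(i < size p) sqn p`_i * (s * r) ^+ i.
  apply: ler_sum => i _; rewrite ler_wpM2l ?sqn_ge0// lerXn2r ?nnegrE ?mulr_ge0//.
  by rewrite ler_wpM2r.
rewrite !ReR !ler_norml => hpq /andP[_ hR] /andP[hS _].
by move: hpq hR hS; move: (\sum_(i < _) _) (\sum_(i < _) _) => X Y; lra.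
Qed.
End dilations.

Lemma cvg_radii : (fun k => 1 - k.+2%:R^-1 : RR) @ \oo --> (1 : RR).
Proof.
rewrite -[X in _ --> X]subr0; apply: cvgB; first exact: cvg_cst.
by have := @cvg_harmonic RR; rewrite -cvg_shiftS.
Qed.

Lemma summable_cvg (f : nat -> CC) (B : RR) :
  (forall n, \sum_(k < n) nm (f k.+1 - f k) <= B) -> exists l : CC, f @ \oo --> l.
Proof.
move=> HB.
have R1 (u : nat -> RR) : (forall k, `|u k.+1 - u k| <= nm (f k.+1 - f k)) -> cvgn u.
  move=> hu.
  have h : cvgn (series (fun k => u k.+1 - u k)).
    apply: normed_cvg; apply: nondecreasing_is_cvgn.
      by move=> m n mn; apply: (nondecreasing_series (u_ := fun k => `|u k.+1 - u k|)) mn => k _ _.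
    exists B => _ [n _ <-].
    change (\sum_(0 <= k < n) `|u k.+1 - u k| <= B); rewrite big_mkord.
    by apply: le_trans (HB n); apply: ler_sum => k _.
  have -> : u = (fun n => series (fun k => u k.+1 - u k) n + u 0%N).
    by apply/funext => n; rewrite /series/= telescope_sumr// subrK.
  by apply: is_cvgD => //; exact: is_cvg_cst.
have hR : cvgn (fun k => ReC (f k)).
  by apply: R1 => k; rewrite -ReN -ReD; exact: Re_le_nm.
have hI : cvgn (fun k => ImC (f k)).
  by apply: R1 => k; rewrite -ImN -ImD; exact: Im_le_nm.
by exists (Complex (limn (fun k => ReC (f k))) (limn (fun k => ImC (f k)))); exact: cvgC_ReIm.
Qed.

Section boundary_values.
Variable F : CC -> CC.
Hypothesis dF : discA F.
Hypothesis F1 : forall z, nm z < 1 -> nm (F z) <= 1.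

Let M r := ReC (cint leb I0 (fun t => dil F r t * (dil F r t)^*)).

Let L1_sqdist r s : 0 <= r -> r < 1 -> 0 <= s -> s < 1 ->
  L1 leb (fun t => (dil F s t - dil F r t) * (dil F s t - dil F r t)^*).
Proof.
move=> r0 r1 s0 s1; apply: (L1_bdd leb_I0_lty (B := 2 * 2)).
  by apply: cmeasM; [|apply: cmeasJ]; apply: cmeasB; exact: cmeas_dil.
have h t : nm (dil F s t - dil F r t) <= 2.
  apply: (le_trans (nmBle _ _)).
  by have := nm_dil_le F1 t r0 r1; have := nm_dil_le F1 t s0 s1; lra.
by move=> t _; rewrite nmM nmJ; apply: ler_pM; rewrite ?nm_ge0.
Qed.

(** The expanded square is [M s - 2 Re <F_s, F_r> + M r], where by [dil_corr] the real part is at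
    least [M r]. *)
Let dil_dist_le r s : 0 <= r -> r <= s -> s < 1 ->
  Rintegral leb I0 (fun t => sqn (dil F s t - dil F r t)) <= M s - M r.
Proof.
move=> r0 rs s1; have s0 := le_trans r0 rs; have r1 := le_lt_trans rs s1.
have -> : Rintegral leb I0 (fun t => sqn (dil F s t - dil F r t)) =
    ReC (cint leb I0 (fun t => (dil F s t - dil F r t) * (dil F s t - dil F r t)^*)).
  by rewrite Re_cint; apply: eq_Rintegral => t _; rewrite -sqnE.
have := dil_corr dF F1 r0 rs s1.
set X := cint leb I0 (fun t => dil F s t * (dil F r t)^*) => hX.
have -> : cint leb I0 (fun t => (dil F s t - dil F r t) * (dil F s t - dil F r t)^*) =
  cint leb I0 (fun t => dil F s t * (dil F s t)^*) - X
  - (X^* - cint leb I0 (fun t => dil F r t * (dil F r t)^*)).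
  rewrite /X -cintJ; last exact: L1_dil2.
  have i1 := L1_dil2 dF F1 s0 s1 s0 s1; have i2 := L1_dil2 dF F1 r0 r1 r0 r1.
  have i3 := L1_dil2 dF F1 r0 r1 s0 s1; have i4 := L1J i3.
  rewrite -!cintB//; try exact: L1B.
  by apply: eq_cint => t _; rewrite conjB conjM conjK; ring.
rewrite ReD [ReC (- (_ - _))]ReN [ReC (_ - X)]ReD ReN [ReC (X^* - _)]ReD ReJ [ReC (- _)]ReN.
by move: hX; rewrite /M; lra.
Qed.

Let dil_dist r s : 0 <= r -> r < 1 -> 0 <= s -> s < 1 ->
  Rintegral leb I0 (fun t => sqn (dil F s t - dil F r t)) <= `|M s - M r|.
Proof.
move=> r0 r1 s0 s1; have [rs|sr] := leP r s.
  by apply: le_trans (ler_norm _); exact: dil_dist_le.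
rewrite distrC; apply: le_trans (ler_norm _); apply: le_trans (dil_dist_le s0 (ltW sr) r1).
by rewrite le_eqVlt; apply/orP; left; apply/eqP/eq_Rintegral => t _; rewrite -!nm_sqr nmB.
Qed.

(** The mean squares [M r] increase to a finite supremum and can be brought within 4^-k of it. The
    geometric rate will make the differences of dilations summable; the lower bound on [r k] sends
    the radii to 1. *)
Let radii : exists r : nat -> RR, forall k,
  [/\ 0 <= r k, r k < 1, 1 - k.+2%:R^-1 <= r k & `|M (r k.+1) - M (r k)| <= 4^-1 ^+ k].
Proof.
have alg (a b c d e : RR) : c - d <= a -> c - e <= b -> a <= c -> b <= c -> e <= d -> `|b - a| <= d.
  by move=> *; rewrite ler_norml; apply/andP; split; lra.
pose E : set RR := [set M r | r in [set r | 0 <= r /\ r < 1]].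
have M1 r : 0 <= r -> r < 1 -> M r <= 1.
  move=> r0 r1; apply: (le_trans (ler_norm _)); apply: (le_trans (Re_le_nm _)).
  apply: cint_bdd => [|t _]; first exact: L1_dil2.
  by rewrite nmM nmJ mulr_ile1 ?nm_ge0 ?nm_dil_le.
have Mmono r s : 0 <= r -> r <= s -> s < 1 -> M r <= M s.
  move=> r0 rs s1; rewrite -subr_ge0; apply: le_trans (dil_dist_le r0 rs s1).
  by apply: Rintegral_ge0 => t _; exact: sqn_ge0.
have sE : has_sup E.
  split; first by exists (M 0); exists 0.
  by exists 1 => _ [r [r0 r1] <-]; exact: M1.
have ex k : {t : RR | [/\ 0 <= t, t < 1 & sup E - 4^-1 ^+ k < M t]}.
  apply/cid; have e0 : 0 < 4^-1 ^+ k :> RR by rewrite exprn_gt0.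
  by have [_ [t [t0 t1] <-] h] := sup_adherent e0 sE; exists t.
pose r k := Num.max (sval (ex k)) (1 - k.+2%:R^-1).
have rP k : [/\ 0 <= r k, r k < 1, 1 - k.+2%:R^-1 <= r k & sup E - 4^-1 ^+ k <= M (r k)].
  rewrite /r; case: (ex k) => t [t0 t1 tM] /=.
  have r1 : Num.max t (1 - k.+2%:R^-1) < 1 by rewrite gt_max t1/= gtrBl invr_gt0 ltr0n.
  split => //; [by rewrite le_max t0|by rewrite le_max lexx orbT|].
  by apply: (le_trans (ltW tM)); apply: Mmono => //; rewrite le_max lexx.
exists r => k; have [a1 a2 a3 a4] := rP k; split => //.
have [b1 b2 b3 b4] := rP k.+1.
have uA : M (r k) <= sup E by apply: (ub_le_sup sE.2); exists (r k).
have uB : M (r k.+1) <= sup E by apply: (ub_le_sup sE.2); exists (r k.+1).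
have q : 4^-1 ^+ k.+1 <= 4^-1 ^+ k :> RR.
  by rewrite exprS ler_piMl ?exprn_ge0// ?invr_ge0 ?invf_le1 ?ler0n ?ler1n ?ltr0n.
exact: (alg _ _ _ _ _ a4 b4).
Qed.

(** The integrals of [|F_{r_{k+1}} - F_{r_k}|] have sum at most 2, so the telescoping series
    converges absolutely almost everywhere. A boundary function is thus obtained without weak
    compactness or maximal functions. *)
Lemma boundary_limit : exists Th : MR -> CC, [/\ cmeas Th, forall t, nm (Th t) <= 1 & exists r : nat -> RR,
  [/\ forall k, 0 <= r k /\ r k < 1, r @ \oo --> (1 : RR) &
  {ae leb, forall t, I0 t -> (fun k => dil F (r k) t) @ \oo --> Th t}]].
Proof.
have [r rP] := radii.
pose f k t := nm (dil F (r k.+1) t - dil F (r k) t).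
have f0 k t : 0 <= f k t by exact: nm_ge0.
have cD k : cmeas (dil F (r k)) by have [? ? _ _] := rP k; exact: cmeas_dil.
have mf k : measurable_fun I0 (EFin \o f k).
  by apply/measurable_EFinP; apply: cmeas_nm; exact: cmeasB.
have intf k : (\int[leb]_(t in I0) (f k t)%:E <= (2^-1 ^+ k)%:E)%E.
  have [r0 r1 _ hk] := rP k; have [s0 s1 _ _] := rP k.+1.
  have [cL iL] := L1_sqdist r0 r1 s0 s1.
  pose g t := (2 ^+ k * sqn (dil F (r k.+1) t - dil F (r k) t) + 2^-1 ^+ k) / 2.
  have iS : leb.-integrable I0 (EFin \o (fun t => sqn (dil F (r k.+1) t - dil F (r k) t))).
    by apply: eq_integrable iL => // t _; rewrite nmM nmJ -expr2 nm_sqr.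
  have fin : (\int[leb]_(t in I0) (sqn (dil F (r k.+1) t - dil F (r k) t))%:E <= (4^-1 ^+ k)%:E)%E.
    have := le_trans (dil_dist r0 r1 s0 s1) hk.
    by rewrite -lee_fin /Rintegral fineK ?integrable_fin_num.
  have mS := measurable_int _ iS.
  (* The inequality [x <= (2^k x^2 + 2^-k) / 2] turns the bound 4^-k for the square into 2^-k for
     the modulus. *)
  apply: (@le_trans _ _ (\int[leb]_(t in I0) ((2 ^+ k / 2)%:E * (sqn (dil F (r k.+1) t - dil F (r k) t))%:E + (2^-1 ^+ k / 2)%:E))%E).
    apply: ge0_le_integral => //.
    - by move=> t _; rewrite lee_fin.
    - exact: mf.
    - by apply: emeasurable_funD => //; exact: measurable_funeM.
    - move=> t _; rewrite -EFinM -EFinD lee_fin /f -nm_sqr.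
      have ab : 2 ^+ k * 2^-1 ^+ k = 1 :> RR by rewrite -exprMn mulfV// expr1n.
      have a0 : 0 < 2 ^+ k :> RR by rewrite exprn_gt0.
      have b0 : 0 < 2^-1 ^+ k :> RR by rewrite exprn_gt0.
      move: (nm _) (2 ^+ k) (2^-1 ^+ k) ab a0 b0 => x a b ab a0 b0.
      have h : 0 <= b * (a * x - 1) ^+ 2 by rewrite mulr_ge0 ?sqr_ge0 ?(ltW b0).
      have e : b * (a * x - 1) ^+ 2 = (a * b) * a * x ^+ 2 - 2 * (a * b) * x + b by ring.
      by move: h; rewrite e ab; lra.
  rewrite ge0_integralD//; last 2 first.
  - by move=> t _; rewrite -EFinM lee_fin mulr_ge0 ?sqn_ge0// divr_ge0// exprn_ge0.
  - exact: measurable_funeM.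
  rewrite ge0_integralZl_EFin//; last by move=> t _; rewrite lee_fin sqn_ge0.
  rewrite [X in (_ + X)%E](etrans (integral_cst _ mI0 _) (etrans (congr1 _ leb_I0) (mule1 _))).
  have -> : (2^-1 ^+ k)%:E = ((2 ^+ k / 2)%:E * (4^-1 ^+ k)%:E + (2^-1 ^+ k / 2)%:E)%E :> \bar RR.
    have -> : 4^-1 ^+ k = 2^-1 ^+ k * 2^-1 ^+ k :> RR by rewrite -exprMn; congr (_ ^+ _); lra.
    have ab : 2 ^+ k * 2^-1 ^+ k = 1 :> RR by rewrite -exprMn mulfV// expr1n.
    rewrite -EFinM -EFinD; congr EFin.
    move: (2 ^+ k) (2^-1 ^+ k) ab => a b ab.
    have -> : a / 2 * (b * b) = (a * b) * b / 2 by ring.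
    by rewrite ab; lra.
  by apply: leeD => //; apply: lee_wpmul2l.
pose S (t : MR) : \bar RR := (\sum_(0 <= k <oo) (f k t)%:E)%E.
have S0 t : (0 <= S t)%E by apply: nneseries_ge0 => k _ _; rewrite lee_fin.
have mS : measurable_fun I0 S.
  have f0' k t : I0 t -> predT k -> (0 <= (f k t)%:E)%E by rewrite lee_fin.
  exact: (@ge0_emeasurable_sum _ MR RR I0 (fun k t => (f k t)%:E) predT f0' (fun k _ => mf k)).
have geo n : \sum_(0 <= k < n) 2^-1 ^+ k = 2 - 2 * 2^-1 ^+ n :> RR.
  elim: n => [|n IH]; first by rewrite big_nil expr0; lra.
  by rewrite big_nat_recr//= IH exprS; lra.
have intS : (\int[leb]_(t in I0) S t <= 2%:E)%E.
  rewrite integral_nneseries//; last by move=> k t _; rewrite lee_fin.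
  apply: lime_le; first by apply: is_cvg_nneseries => k _ _; apply: integral_ge0 => t _; rewrite lee_fin.
  near=> n.
  apply: (@le_trans _ _ (\sum_(0 <= k < n) (2^-1 ^+ k)%:E)%E); first exact: lee_sum.
  by rewrite sumEFin lee_fin geo gerBl mulr_ge0// exprn_ge0.
have aeS : {ae leb, forall t, I0 t -> S t \is a fin_num}.
  apply: integrable_ae => //; apply/integrableP; split => //.
  under eq_integral do rewrite gee0_abs//.
  by apply: le_lt_trans intS _; rewrite ltry.
(* Cutting off where the series diverges gives convergence at every point, hence a [Th] that is
   measurable and bounded by 1 everywhere. *)
pose A : set MR := I0 `&` [set t | (S t < +oo)%E].
have mA : measurable A by exact: emeasurable_fun_infty_o.
pose G k t := (\1_A t)%:C%C * dil F (r k) t.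
have cG k : cmeas (G k).
  by apply: cmeasM => //; apply: cmeas_real; exact: measurable_indic.
have limG t : I0 t -> exists l : CC, (fun k => G k t) @ \oo --> l.
  move=> It; rewrite /G indicE; case: (boolP (t \in A)) => tA; last first.
    by exists 0; under eq_fun do rewrite mul0r; exact: cvgC_cst.
  have [_ /= St] := set_mem tA.
  apply: (@summable_cvg _ (fine (S t))) => n.
  have -> : \sum_(k < n) nm (1%:R%:C%C * dil F (r k.+1) t - 1%:R%:C%C * dil F (r k) t) = \sum_(0 <= k < n) f k t.
    by rewrite big_mkord; apply: eq_bigr => k _; rewrite !mul1r.
  rewrite -lee_fin fineK; last by rewrite ge0_fin_numE.
  by rewrite -sumEFin; apply: nneseries_lim_ge => k _ _; rewrite lee_fin.
pose Th t : CC := if pselect (I0 t) is left It then sval (cid (limG t It)) else 0.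
have GTh t : I0 t -> (fun k => G k t) @ \oo --> Th t.
  by rewrite /Th; case: pselect => // It _; case: cid.
exists Th; split; first exact: cmeas_lim cG GTh.
  move=> t; have [It|nI] := pselect (I0 t); last by rewrite /Th; case: pselect => // _; rewrite nm0.
  apply: (cvgC_le _ (GTh t It)); near=> k.
  have [r0 r1 _ _] := rP k; rewrite /G nmM nm_real indicE normr_nat mulr_ile1 ?nm_ge0 ?nm_dil_le//.
  by case: (_ \in _).
exists r; split.
- by move=> k; have [? ? _ _] := rP k.
- apply: (@squeeze_cvgr _ _ _ _ (fun k => 1 - k.+2%:R^-1) (fun=> 1)).
  + by near=> k; have [_ h1 h2 _] := rP k; rewrite h2 ltW.
  + exact: cvg_radii.
  + exact: cvg_cst.
- apply: ae_mono aeS => t St It; have {}St := St It.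
  have tA : t \in A by rewrite inE; split => //=; rewrite ltey_eq St.
  have -> : (fun k => dil F (r k) t) = (fun k => G k t).
    by apply/funext => k; rewrite /G indicE tA mul1r.
  exact: GTh.
Unshelve. all: by end_near.
Qed.
End boundary_values.

Lemma cauchy_eeX n z : nm z < 1 -> cauchy leb (fun t => ee t ^+ n) z = z ^+ n.
Proof.
move=> z1; elim: n => [|n IH].
  by rewrite /cauchy (eq_cint _ (G := ker z)) ?cauchy1// => t _; rewrite mul1r.
have iX k : L1 leb (fun t => ee t ^+ k).
  by have := L1_ee k 0; apply: eq_L1 => t _; rewrite mulr1.
rewrite /cauchy (eq_cint _ (G := fun t => ee t ^+ n.+1 + z * (ee t ^+ n * ker z t))).
  rewrite cintD ?cintZ; [|exact: L1_ker|exact: iX|exact/L1Z/L1_ker].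
  by rewrite cint_eeX add0r -/(cauchy leb _ z) IH -exprS.
move=> t _; rewrite [in LHS]kerE// mulrDr mulr1; congr (_ + _).
rewrite exprS; have -> : ee t * ee t ^+ n * (z * (ee t)^* * ker z t) =
  (ee t * (ee t)^*) * (z * (ee t ^+ n * ker z t)) by ring.
by rewrite eeJ mul1r.
Qed.

Lemma cint_kerJ n z : nm z < 1 -> cint leb I0 (fun t => (ee t)^* ^+ n.+1 * ker z t) = 0.
Proof.
move=> z1.
have h1 : H2 (fun=> 1).
  apply/H2P; split; first by apply: (L2_bdd leb_I0_lty (B := 1)) => [|t _]; [exact: cmeas_cst|rewrite nm1].
  by move=> k; rewrite -[RHS](cint_eeX k.+1); apply: eq_cint => t _; rewrite mul1r.
have /H2P[_ /(_ n)] := H2_kerJ z1 h1.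
move=> /(congr1 Num.conj); rewrite conjC0 -cintJ; last by apply/L1_eeX/L1_kerJ/L1_cst.
by move=> <-; apply: eq_cint => t _; rewrite mul1r conjM conjK rmorphXn/= mulrC.
Qed.

Lemma pint_eeX n z : nm z < 1 -> pint leb (fun t => ee t ^+ n) z = z ^+ n.
Proof.
move=> z1; have iX k : L1 leb (fun t => ee t ^+ k).
  by have := L1_ee k 0; apply: eq_L1 => t _; rewrite mulr1.
rewrite pintE// cauchy_eeX// cint_eeX -addrA; apply/eqP; rewrite addrC -subr_eq0 addrK; apply/eqP.
case: n => [|n].
  rewrite /cauchy (eq_cint _ (G := ker z)) ?cauchy1// ?conj1 ?subrr//.
  by move=> t _; rewrite conj1 mul1r.
rewrite subr0 -[RHS]conjC0; congr (_^*); rewrite -(cint_kerJ n z1).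
by apply: eq_cint => t _; rewrite rmorphXn.
Qed.

Lemma pint_le G B z : nm z < 1 -> L1 leb G -> (forall t, I0 t -> nm (G t) <= B) ->
  nm (pint leb G z) <= B.
Proof.
move=> z1 iG hB; have iP := L1_pk z1 iG.
apply: (le_trans (nm_cint_le iP)).
rewrite -[leRHS]mulr1 -(Rintegral_pk_leb z1) -RintegralZl//; last exact: integrable_pk.
apply: le_Rintegral => //.
- exact: L1_nm iP.
- have h := integrable_pk leb_I0_lty z1.
  by have := integrableZl mI0 B h; apply: eq_integrable.
- by move=> t It; rewrite nmM nm_real gtr0_norm ?pk_gt0// mulrC ler_wpM2r ?hB// ltW// pk_gt0.
Qed.

Lemma pintB G H z : nm z < 1 -> L1 leb G -> L1 leb H ->
  pint leb (fun t => G t - H t) z = pint leb G z - pint leb H z.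
Proof.
move=> z1 iG iH; rewrite /pint -cintB; [|exact: L1_pk|exact: L1_pk].
by apply: eq_cint => t _; ring.
Qed.

Lemma pint_horner (p : {poly CC}) (r : RR) z : nm z < 1 ->
  pint leb (fun t => p.[r%:C%C * ee t]) z = p.[r%:C%C * z].
Proof.
move=> z1; have iX k : L1 leb (fun t => ee t ^+ k).
  by have := L1_ee k 0; apply: eq_L1 => t _; rewrite mulr1.
rewrite /pint (eq_cint _ (G := fun t => \sum_(i < size p) (p`_i * r%:C%C ^+ i) * ((pk z t)%:C%C * ee t ^+ i))).
  rewrite cint_sum; last by move=> i; exact/L1Z/L1_pk.
  rewrite horner_coef; apply: eq_bigr => i _.
  rewrite cintZ ?exprMn ?mulrA; last exact: L1_pk.
  by congr (_ * _); rewrite -[RHS](pint_eeX _ z1).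
by move=> t _; rewrite horner_coef mulr_sumr; apply: eq_bigr => i _; rewrite exprMn; ring.
Qed.

Lemma nm_small_eq (a b : CC) : (forall e : RR, 0 < e -> nm (a - b) <= e) -> a = b.
Proof.
move=> h; apply/eqP; rewrite -subr_eq0 -nm_eq0 eq_le nm_ge0 andbT.
by apply/ler_addgt0Pr => e /h; rewrite add0r.
Qed.

Lemma L1_dil F r : discA F -> 0 <= r -> r < 1 -> L1 leb (dil F r).
Proof.
move=> dF r0 r1; have [B B0 HB] := discA_bdd dF r0 r1.
apply: (L1_bdd leb_I0_lty (B := B)); first exact: cmeas_dil.
by move=> t _; apply: HB; rewrite nm_dil.
Qed.

(** Poisson's formula, known for monomials from [pint_eeX], passes to the limit because Poisson
    integrals do not increase the supremum. *)
Lemma pint_dil F r z : discA F -> 0 <= r -> r < 1 -> nm z < 1 ->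
  pint leb (dil F r) z = F (r%:C%C * z).
Proof.
move=> dF r0 r1 z1; apply: nm_small_eq => e e0.
have e2 : 0 < e / 2 by rewrite divr_gt0.
have [p Hp] := dF r _ r0 r1 e2.
have iF := L1_dil dF r0 r1.
have iP : L1 leb (fun t => p.[r%:C%C * ee t]) := L1_dil (discA_poly p) r0 r1.
have -> : pint leb (dil F r) z - F (r%:C%C * z) =
    pint leb (fun t => dil F r t - p.[r%:C%C * ee t]) z - (F (r%:C%C * z) - p.[r%:C%C * z]).
  by rewrite pintB// pint_horner//; ring.
apply: (le_trans (nmBle _ _)).
have h1 : nm (pint leb (fun t => dil F r t - p.[r%:C%C * ee t]) z) <= e / 2.
  by apply: pint_le => // [|t _]; [exact: L1B|apply: Hp; rewrite nm_dil].
have h2 : nm (F (r%:C%C * z) - p.[r%:C%C * z]) <= e / 2.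
  apply: Hp; rewrite nmM nm_real ger0_norm//; apply: ler_piMr => //; exact: ltW.
by lra.
Qed.

Lemma discA_cvg F z (T : Type) (f : set_system T) (FF : ProperFilter f) (g : T -> CC) :
  discA F -> nm z < 1 -> g @ f --> z -> (fun t => F (g t)) @ f --> F z.
Proof.
move=> dF z1 /cvgCP/cvgr0Pnorm_lt gz; apply/cvgCP/cvgr0Pnorm_le => e e0.
have [d d0 Hd] := discA_continuous dF z1 e0.
by apply: filterS (gz d d0) => t /=; rewrite !ger0_norm ?nm_ge0//; exact: Hd.
Qed.

Lemma cvg_dilate z (r : nat -> RR) : r @ \oo --> (1 : RR) -> (fun k => (r k)%:C%C * z) @ \oo --> z.
Proof.
move=> r1.
have h : (fun k => (r k)%:C%C * z) @ \oo --> (1 : RR)%:C%C * z.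
  by apply: cvgCM; [exact: cvgC_real|exact: cvgC_cst].
by move: h; rewrite realC1 mul1r.
Qed.

Lemma bval_eq F x (L : CC) : (fun r : RR => F (r%:C%C * ee x)) @ (1 : RR)^'- --> L -> bval F x = L.
Proof. by move=> h; refine (cvgC_unique _ (cvgP _ h) h). Qed.

Section fatou.
Variable F : CC -> CC.
Hypothesis dF : discA F.
Hypothesis F1 : forall z, nm z < 1 -> nm (F z) <= 1.

(** Dominated convergence along the radii of [boundary_limit] turns [P[F_r](z) = F (r z)] into [F =
    P[Th]]. Differentiation of Poisson integrals gives the nontangential limit [Th], and its radial
    case identifies [Th] with [bval F]. *)
Lemma fatou : {ae leb, forall x, I0 x -> forall al, F @ ntf x al --> bval F x}.
Proof.
have [Th [cTh Th1 [r [r01 r1 lim]]]] := boundary_limit dF F1.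
have iTh : L1 leb Th by exact: (L1_bdd leb_I0_lty (B := 1)).
have rep z : nm z < 1 -> pint leb Th z = F z.
  move=> z1.
  have c1 : (fun k => pint leb (dil F (r k)) z) @ \oo --> pint leb Th z.
    apply: (cint_dct (G := fun=> 2 / (1 - nm z))).
    - by move=> k; have [r0 r1'] := r01 k; apply: cmeasM; [exact: cmeas_pk|exact: cmeas_dil].
    - by apply: cmeasM => //; exact: cmeas_pk.
    - exact: integrable_cstI0.
    - move=> k t _; have [r0 r1'] := r01 k.
      rewrite nmM -[leRHS]mulr1; apply: ler_pM; rewrite ?nm_ge0 ?nm_pk_le//.
      exact: nm_dil_le.
    - by apply: ae_mono lim => t h It; apply: cvgCM; [exact: cvgC_cst|exact: h].
  have c2 : (fun k => pint leb (dil F (r k)) z) @ \oo --> F z.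
    have -> : (fun k => pint leb (dil F (r k)) z) = (fun k => F ((r k)%:C%C * z)).
      by apply/funext => k; have [r0 r1'] := r01 k; rewrite pint_dil.
    exact: (@discA_cvg F z nat \oo _ (fun k => (r k)%:C%C * z) dF z1 (@cvg_dilate z r r1)).
  exact: cvgC_unique c1 c2.
apply: ae_mono (nt_pint_leb iTh) => x h Ix.
have nt al : F @ ntf x al --> Th x.
  by apply: (cvgC_near _ _ (h Ix al)); apply: filterS (ntf_disc x al) => z; exact: rep.
have rad := radial_cvg (nt 0).
by rewrite (bval_eq rad).
Qed.
End fatou.

(** * Bounded analytic functions and their boundary values *)

(* Measurability of [bval F]: radial convergence is tested on a countable set of radii. *)
Definition qrad (n : nat) : RR := ratr (odflt 0 (unpickle n)).

Lemma qrad_dense (x y : RR) : x < y -> exists n, x < qrad n < y.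
Proof.
move=> xy; have [q] := rat_in_itvoo xy; rewrite in_itv/= => h.
by exists (pickle q); rewrite /qrad pickleK.
Qed.

Lemma radii_bounds n : 0 <= 1 - n.+2%:R^-1 :> RR /\ 1 - n.+2%:R^-1 < 1 :> RR.
Proof.
by split; [rewrite subr_ge0 invf_le1 ?ler1n ?ltr0n|rewrite gtrBl invr_gt0 ltr0n].
Qed.

Section bval_measurable.
Variable F : CC -> CC.
Hypothesis dF : discA F.

Let S k n i j : set MR := [set t | I0 t /\
  (1 - n.+1%:R^-1 < qrad i < 1 -> 1 - n.+1%:R^-1 < qrad j < 1 ->
   nm (dil F (qrad i) t - dil F (qrad j) t) <= k.+1%:R^-1)].

Let mS k n i j : measurable (S k n i j).
Proof.
have [hi|hi] := boolP (1 - n.+1%:R^-1 < qrad i < 1); last first.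
  suff -> : S k n i j = I0 by exact: mI0.
  by apply/seteqP; split=> t; [case|split => //; rewrite (negbTE hi)].
have [hj|hj] := boolP (1 - n.+1%:R^-1 < qrad j < 1); last first.
  suff -> : S k n i j = I0 by exact: mI0.
  by apply/seteqP; split=> t; [case|split => // _; rewrite (negbTE hj)].
have n0 : 0 <= 1 - n.+1%:R^-1 :> RR by rewrite subr_ge0 invf_le1 ?ler1n ?ltr0n.
have cd q : 1 - n.+1%:R^-1 < q < 1 -> cmeas (dil F q).
  by move=> /andP[q0 q1]; apply: cmeas_dil => //; exact: le_trans (ltW q0).
have mn : measurable_fun I0 (fun t => nm (dil F (qrad i) t - dil F (qrad j) t)).
  by apply: cmeas_nm; apply: cmeasB; exact: cd.
have := mn mI0 _ (measurable_itv `]-oo, (k.+1%:R^-1 : RR)]).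
suff -> : S k n i j = I0 `&` (fun t => nm (dil F (qrad i) t - dil F (qrad j) t)) @^-1` `]-oo, (k.+1%:R^-1 : RR)] by [].
apply/seteqP; split=> t [It] /=; rewrite in_itv/=; first by move=> /(_ hi hj).
by move=> h; split.
Qed.

Let Om : set MR := \bigcap_k \bigcup_n \bigcap_i \bigcap_j S k n i j.

Let mOm : measurable Om.
Proof.
apply: bigcapT_measurable => k; apply: bigcupT_measurable => n.
by apply: bigcapT_measurable => i; apply: bigcapT_measurable => j; exact: mS.
Qed.

Let dil_continuous t (r e : RR) : 0 <= r -> r < 1 -> 0 < e ->
  exists2 d : RR, 0 < d & forall s, `|s - r| < d -> nm (dil F s t - dil F r t) <= e.
Proof.
move=> r0 r1 e0; have z1 : nm (r%:C%C * ee t) < 1 by rewrite nm_dil.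
have [d d0 Hd] := discA_continuous dF z1 e0; exists d => // s sr; apply: Hd.
by rewrite -mulrBl -realCB nmM nm_ee mulr1 nm_real.
Qed.

(** Continuity inside the disc carries the Cauchy condition from rational radii to all radii. *)
Let Om_real t : Om t -> forall e : RR, 0 < e -> exists2 a : RR, 0 <= a < 1 &
  forall r s, a < r -> r < 1 -> a < s -> s < 1 -> nm (dil F r t - dil F s t) <= e.
Proof.
move=> Ot e e0; have e2 : 0 < e / 3 by rewrite divr_gt0.
have [k _ Hk] := @near_infty_natSinv_lt RR (PosNum e2).
have {Hk}ke := Hk k (leqnn k); rewrite /= in ke.
have [n _ Hn] := Ot k I; exists (1 - n.+1%:R^-1).
  by rewrite subr_ge0 invf_le1 ?ler1n ?ltr0n// gtrBl invr_gt0 ltr0n.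
have n0 : 0 <= 1 - n.+1%:R^-1 :> RR by rewrite subr_ge0 invf_le1 ?ler1n ?ltr0n.
have appr r : 1 - n.+1%:R^-1 < r -> r < 1 -> exists i, 1 - n.+1%:R^-1 < qrad i < 1 /\
    nm (dil F (qrad i) t - dil F r t) <= e / 3.
  move=> ar r1; have r0 : 0 <= r by exact: le_trans (ltW ar).
  have [d d0 Hd] := dil_continuous t r0 r1 e2.
  have h : Num.max (1 - n.+1%:R^-1) (r - d) < r by rewrite gt_max ar gtrBl.
  have [i /andP[i1 i2]] := qrad_dense h; exists i.
  move: i1; rewrite gt_max => /andP[i1 i3]; split; first by rewrite i1 (lt_trans i2 r1).
  by apply: Hd; rewrite ltr_norml; apply/andP; split; lra.
move=> r s ar r1 as_ s1; have [i [hi Hi]] := appr r ar r1; have [j [hj Hj]] := appr s as_ s1.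
have [_ Hij] := Hn i I j I; have {}Hij := Hij hi hj.
have -> : dil F r t - dil F s t = (dil F (qrad i) t - dil F (qrad j) t)
  - (dil F (qrad i) t - dil F r t) + (dil F (qrad j) t - dil F s t) by ring.
apply: (le_trans (nmD _ _)); have := nmBle (dil F (qrad i) t - dil F (qrad j) t) (dil F (qrad i) t - dil F r t).
move=> h; apply: (le_trans (lerD (le_trans h (lerD Hij Hi)) Hj)).
by move: ke; move: (k.+1%:R^-1) => c; lra.
Qed.

Let Om_cvg t : Om t -> exists l : CC, (fun r : RR => dil F r t) @ (1 : RR)^'- --> l.
Proof.
move=> Ot.
have near_left (a : RR) : a < 1 -> \forall r \near (1 : RR)^'-, a < r /\ r < 1.
  by move=> a1; exact: (filterI (nbhs_left_gt a1) (nbhs_left_lt 1)).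
have C (p : CC -> RR) : (forall x y, `|p x - p y| <= nm (x - y)) ->
    cvg ((fun r : RR => p (dil F r t)) @ (1 : RR)^'-).
  move=> hp; apply: cauchy_cvg; apply: cauchy_exP => e e0.
  have e2 : 0 < e / 2 by rewrite divr_gt0.
  have [a /andP[a0 a1] Ha] := Om_real Ot e2.
  exists (p (dil F ((1 + a) / 2) t)).
  apply: filterS (near_left a a1) => r [ar r1].
  rewrite /ball/= /ball_; apply: (le_lt_trans (hp _ _)).
  have : nm (dil F ((1 + a) / 2) t - dil F r t) <= e / 2 by apply: Ha => //; lra.
  by move=> h; lra.
have hR := C (fun z => ReC z) _; have hI := C (fun z => ImC z) _.
exists (Complex (lim ((fun r : RR => ReC (dil F r t)) @ (1 : RR)^'-))
                (lim ((fun r : RR => ImC (dil F r t)) @ (1 : RR)^'-))).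
apply: cvgC_ReIm.
  by apply: hR => x y; rewrite -ReN -ReD; exact: Re_le_nm.
by apply: hI => x y; rewrite -ImN -ImD; exact: Im_le_nm.
Qed.

Let cvg_Om t : I0 t -> (exists l : CC, (fun r : RR => dil F r t) @ (1 : RR)^'- --> l) -> Om t.
Proof.
move=> It [l hl] k _; have e0 : 0 < k.+1%:R^-1 / 2 :> RR by rewrite divr_gt0.
move: hl => /cvgCP/cvgr0Pnorm_le/(_ _ e0)[d /= d0 Hd].
have [n _ Hn] := @near_infty_natSinv_lt RR (PosNum d0).
have {Hn}nd := Hn n (leqnn n); rewrite /= in nd.
exists n => // i _ j _; split => // /andP[i1 i2] /andP[j1 j2].
have h q : 1 - n.+1%:R^-1 < q -> q < 1 -> nm (dil F q t - l) <= k.+1%:R^-1 / 2.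
  move=> q1 q2; rewrite -[leLHS]ger0_norm ?nm_ge0//; apply: Hd => //=.
  have q3 : 0 <= 1 - q by rewrite subr_ge0 ltW.
  by rewrite /ball_/= (ger0_norm q3); move: nd q1; move: (n.+1%:R^-1) => c; lra.
have -> : dil F (qrad i) t - dil F (qrad j) t = (dil F (qrad i) t - l) - (dil F (qrad j) t - l) by ring.
by apply: (le_trans (nmBle _ _)); apply: (le_trans (lerD (h _ i1 i2) (h _ j1 j2))); rewrite -splitr.
Qed.

(** Where no limit exists, [lim] returns the default point of [CC], which is 0. *)
Lemma bval_dvg t : ~ (exists l : CC, (fun r : RR => dil F r t) @ (1 : RR)^'- --> l) -> bval F t = 0.
Proof. by move=> h; apply: dvgP => c; apply: h; exists (lim ((fun r : RR => dil F r t) @ (1 : RR)^'-)). Qed.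

Lemma nm_bval_le t : (forall z, nm z < 1 -> nm (F z) <= 1) -> nm (bval F t) <= 1.
Proof.
move=> F1; have [[l hl]|/bval_dvg ->] := pselect (exists l : CC, (fun r : RR => dil F r t) @ (1 : RR)^'- --> l); last by rewrite nm0.
rewrite (bval_eq hl); apply: (cvgC_le _ hl); near=> r.
have r0 : 0 < r by near: r; exact: nbhs_left_gt.
have r1 : r < 1 by near: r; exact: nbhs_left_lt.
by apply: nm_dil_le => //; exact: ltW.
Unshelve. all: by end_near.
Qed.

Let radii_left (P : set RR) : (1 : RR)^'- P -> \forall n \near \oo, P (1 - n.+2%:R^-1).
Proof.
move=> [d /= d0 Hd].
have /cvgrPdist_lt/(_ d d0)[N _ HN] := cvg_radii.
exists N => // n Nn; apply: Hd; last exact: (radii_bounds n).2.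
by rewrite /ball_/=; exact: HN.
Qed.

Lemma dil_radii_cvg t (l : CC) : (fun r : RR => dil F r t) @ (1 : RR)^'- --> l ->
  (fun n => dil F (1 - n.+2%:R^-1) t) @ \oo --> l.
Proof. by move=> h A /h; exact: radii_left. Qed.

Lemma cmeas_bval : cmeas (bval F).
Proof.
(* The indicator reproduces the default value 0 of [bval F] off [Om], so the sequence converges to
   [bval F] at every point of [I0]. *)
pose f n t := (\1_Om t)%:C%C * dil F (1 - n.+2%:R^-1) t.
apply: (@cmeas_lim f) => [n|t It].
  apply: cmeasM; first by apply: cmeas_real; exact: measurable_indic.
  by have [h1 h2] := radii_bounds n; exact: cmeas_dil.
rewrite /f indicE; have [tO|tO] := boolP (t \in Om); last first.
  have -> : bval F t = 0.
    by apply: bval_dvg => h; move/negP: tO; apply; rewrite inE; exact: cvg_Om.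
  have -> : (fun n => (false%:R : RR)%:C%C * dil F (1 - n.+2%:R^-1) t) = (fun=> 0).
    by apply/funext => n; rewrite mul0r.
  exact: cvgC_cst.
have [l hl] := Om_cvg (set_mem tO); rewrite (bval_eq hl).
have -> : (fun n => (true%:R : RR)%:C%C * dil F (1 - n.+2%:R^-1) t) = (fun n => dil F (1 - n.+2%:R^-1) t).
  by apply/funext => n; rewrite mul1r.
exact: dil_radii_cvg.
Qed.
End bval_measurable.

(** * Boundary values of bounded analytic functions as multipliers of the Hardy space *)

Section multiplier.
Variable F : CC -> CC.
Hypothesis dF : discA F.
Hypothesis F1 : forall z, nm z < 1 -> nm (F z) <= 1.

Lemma L1_bvalM h : L1 leb h -> L1 leb (fun t => bval F t * h t).
Proof. by apply: (L1Ml (B := 1)) => [|t _]; [exact: cmeas_bval|exact: nm_bval_le]. Qed.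

Lemma L2_bvalM h : L2 leb h -> L2 leb (fun t => bval F t * h t).
Proof. by apply: (L2Ml (B := 1)) => [|t _]; [exact: cmeas_bval|exact: nm_bval_le]. Qed.

Lemma fatou_radii : {ae leb, forall t, I0 t -> (fun n => dil F (1 - n.+2%:R^-1) t) @ \oo --> bval F t}.
Proof.
apply: ae_mono (fatou dF F1) => t h It.
exact: (dil_radii_cvg (radial_cvg (h It 0))).
Qed.

Lemma L1_polyM (p : {poly CC}) (r : RR) h : L1 leb h -> 0 <= r -> r < 1 ->
  L1 leb (fun t => p.[r%:C%C * ee t] * h t).
Proof.
move=> ih r0 r1; have [B B0 HB] := discA_bdd (discA_poly p) r0 r1.
apply: (L1Ml (B := B)) => // [|t _]; last by apply: HB; rewrite nm_dil.
exact: (cmeas_dil (discA_poly p)).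
Qed.

(** An evaluation formula for polynomials extends to [bval F] in two limits: uniform approximation
    of each dilation, then dominated convergence of the dilations. It serves with [c = 0] for
    vanishing moments and with [c] a Cauchy integral for values in the disc. *)
Lemma bval_pairing h l c : L1 leb h -> nm l < 1 ->
  (forall (p : {poly CC}) (r : RR), 0 <= r -> r < 1 ->
    cint leb I0 (fun t => p.[r%:C%C * ee t] * h t) = p.[r%:C%C * l] * c) ->
  cint leb I0 (fun t => bval F t * h t) = F l * c.
Proof.
move=> ih l1 H.
pose A := Rintegral leb I0 (fun t => nm (h t)).
have A0 : 0 <= A by apply: Rintegral_ge0 => t _; exact: nm_ge0.
have iD r : 0 <= r -> r < 1 -> L1 leb (fun t => dil F r t * h t).
  move=> r0 r1; apply: (L1Ml (B := 1)) => // [|t _]; first exact: cmeas_dil.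
  exact: nm_dil_le.
have step r : 0 <= r -> r < 1 -> cint leb I0 (fun t => dil F r t * h t) = F (r%:C%C * l) * c.
  move=> r0 r1; apply: nm_small_eq => e e0.
  have D0 : 0 < A + nm c + 1 by rewrite ltr_wpDl// addr_ge0// nm_ge0.
  have d0 : 0 < e / (A + nm c + 1) by rewrite divr_gt0.
  have [p Hp] := dF r0 r1 d0.
  have iP := L1_polyM p ih r0 r1.
  have -> : cint leb I0 (fun t => dil F r t * h t) - F (r%:C%C * l) * c =
     cint leb I0 (fun t => (dil F r t - p.[r%:C%C * ee t]) * h t) - (F (r%:C%C * l) - p.[r%:C%C * l]) * c.
    have -> : cint leb I0 (fun t => (dil F r t - p.[r%:C%C * ee t]) * h t) =
        cint leb I0 (fun t => dil F r t * h t) - cint leb I0 (fun t => p.[r%:C%C * ee t] * h t).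
      by rewrite -cintB//; [apply: eq_cint => t _; ring|exact: iD].
    by rewrite H//; ring.
  apply: (le_trans (nmBle _ _)).
  have i3 : L1 leb (fun t => (dil F r t - p.[r%:C%C * ee t]) * h t).
    by have := L1B (iD r r0 r1) iP; apply: eq_L1 => t _; ring.
  have b1 : nm (cint leb I0 (fun t => (dil F r t - p.[r%:C%C * ee t]) * h t)) <= e / (A + nm c + 1) * A.
    apply: (le_trans (nm_cint_le i3)); rewrite /A -RintegralZl//; last exact: (L1_nm ih).
    apply: le_Rintegral => //; first exact: L1_nm i3.
      by have := integrableZl mI0 (e / (A + nm c + 1)) (L1_nm ih); apply: eq_integrable.
    by move=> t It; rewrite nmM ler_wpM2r ?nm_ge0//; apply: Hp; rewrite nm_dil.
  have b2 : nm ((F (r%:C%C * l) - p.[r%:C%C * l]) * c) <= e / (A + nm c + 1) * nm c.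
    rewrite nmM ler_wpM2r ?nm_ge0//; apply: Hp; rewrite nmM nm_real ger0_norm//.
    by apply: ler_piMr => //; exact: ltW.
  have : e / (A + nm c + 1) * (A + nm c + 1) = e by rewrite divfK// gt_eqF.
  by move: b1 b2 d0; rewrite !mulrDr mulr1; lra.
have c1 : (fun n => cint leb I0 (fun t => dil F (1 - n.+2%:R^-1) t * h t)) @ \oo -->
    cint leb I0 (fun t => bval F t * h t).
  apply: (cint_dct (G := fun t => nm (h t))).
  - by move=> n; have [r0 r1] := radii_bounds n; have [] := iD _ r0 r1.
  - by have [] := L1_bvalM ih.
  - exact: L1_nm.
  - move=> n t _; have [r0 r1] := radii_bounds n; rewrite nmM -[leRHS]mul1r.
    by rewrite ler_wpM2r ?nm_ge0// nm_dil_le.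
  - apply: ae_mono fatou_radii => t ht It.
    by apply: cvgCM; [exact: ht|exact: cvgC_cst].
have c2 : (fun n => cint leb I0 (fun t => dil F (1 - n.+2%:R^-1) t * h t)) @ \oo --> F l * c.
  have -> : (fun n => cint leb I0 (fun t => dil F (1 - n.+2%:R^-1) t * h t)) =
     (fun n => F ((1 - n.+2%:R^-1)%:C%C * l) * c).
    by apply/funext => n; have [r0 r1] := radii_bounds n; rewrite step.
  apply: cvgCM; last exact: cvgC_cst.
  exact: (@discA_cvg F l nat \oo _ (fun n => (1 - n.+2%:R^-1)%:C%C * l) dF l1 (@cvg_dilate l _ cvg_radii)).
exact: cvgC_unique c1 c2.
Qed.

Lemma H2_eeM h : H2 h -> H2 (fun t => ee t * h t).
Proof.
move=> /H2P[Lh Hh]; apply/H2P; split.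
  by apply: (L2Ml (B := 1)) => // [|t _]; [exact: cmeas_ee|rewrite nm_ee].
by move=> n; rewrite -[RHS](Hh n.+1); apply: eq_cint => t _; rewrite [in RHS]exprS; ring.
Qed.

Lemma H2_Z c h : H2 h -> H2 (fun t => c * h t).
Proof.
move=> /H2P[Lh Hh]; apply/H2P; split; first exact: L2Z.
move=> n; rewrite (eq_cint _ (G := fun t => c * (h t * ee t ^+ n.+1))); last by move=> t _; ring.
by rewrite cintZ ?Hh ?mulr0//; apply: L1_eeX; exact: L2_L1.
Qed.

Lemma poly_coef0 (p : {poly CC}) (r : RR) h n : 0 <= r -> r < 1 -> H2 h ->
  cint leb I0 (fun t => p.[r%:C%C * ee t] * (h t * ee t ^+ n.+1)) = 0.
Proof.
move=> r0 r1; elim/poly_ind: p h => [|p c IH] h hh.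
  rewrite (eq_cint _ (G := fun=> 0)) ?cint_leb_cst// => t _.
  by rewrite horner0 mul0r.
have iK k : H2 k -> L1 leb (fun t => k t * ee t ^+ n.+1).
  by move=> [Lk _]; apply: L1_eeX; exact: L2_L1.
rewrite (eq_cint _ (G := fun t => r%:C%C * (p.[r%:C%C * ee t] * ((ee t * h t) * ee t ^+ n.+1)) + c * (h t * ee t ^+ n.+1))).
  have iP : L1 leb (fun t => p.[r%:C%C * ee t] * ((ee t * h t) * ee t ^+ n.+1)).
    by apply: L1_polyM => //; apply: (iK (fun t => ee t * h t)); exact: H2_eeM.
  have ih := iK h hh.
  rewrite cintD ?cintZ; try solve [exact: ih | exact: iP | exact: L1Z ih | exact: L1Z iP].
  rewrite (IH (fun t => ee t * h t)); last exact: H2_eeM.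
  by have /H2P[_ ->] := hh; rewrite !mulr0 addr0.
by move=> t _; rewrite hornerMXaddC; ring.
Qed.

Lemma hext_eeM h l : nm l < 1 -> H2 h -> cauchy leb (fun t => ee t * h t) l = l * cauchy leb h l.
Proof.
move=> l1 /H2P[Lh Hh]; have iL := L2_L1 leb_I0_lty Lh.
rewrite /cauchy -cintZ; last exact: L1_ker.
rewrite (eq_cint _ (G := fun t => h t * ee t ^+ 1 + l * (h t * ker l t))).
  rewrite cintD; [|exact: L1_eeX|exact/L1Z/L1_ker].
  by rewrite (Hh 0%N) add0r.
move=> t _; rewrite [in LHS]kerE// expr1.
have -> : ee t * h t * (1 + l * (ee t)^* * ker l t) = h t * ee t + (ee t * (ee t)^*) * (l * (h t * ker l t)) by ring.
by rewrite eeJ mul1r.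
Qed.

Lemma poly_hext (p : {poly CC}) (r : RR) h l : 0 <= r -> r < 1 -> nm l < 1 -> H2 h ->
  cint leb I0 (fun t => p.[r%:C%C * ee t] * (h t * ker l t)) = p.[r%:C%C * l] * cauchy leb h l.
Proof.
move=> r0 r1 l1; elim/poly_ind: p h => [|p c IH] h hh.
  rewrite (eq_cint _ (G := fun=> 0)) ?cint_leb_cst ?horner0 ?mul0r// => t _.
  by rewrite horner0 mul0r.
have iK k : H2 k -> L1 leb (fun t => k t * ker l t).
  by move=> [Lk _]; apply: L1_ker => //; exact: L2_L1.
rewrite (eq_cint _ (G := fun t => r%:C%C * (p.[r%:C%C * ee t] * ((ee t * h t) * ker l t)) + c * (h t * ker l t))).
  have iP : L1 leb (fun t => p.[r%:C%C * ee t] * ((ee t * h t) * ker l t)).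
    by apply: L1_polyM => //; apply: (iK (fun t => ee t * h t)); exact: H2_eeM.
  have ih := iK h hh.
  rewrite cintD ?cintZ; try solve [exact: ih | exact: iP | exact: L1Z ih | exact: L1Z iP].
  rewrite (IH (fun t => ee t * h t)); last exact: H2_eeM.
  by rewrite hext_eeM// -/(cauchy leb h l) hornerMXaddC; ring.
by move=> t _; rewrite hornerMXaddC; ring.
Qed.

Lemma H2_bvalM h : H2 h -> H2 (fun t => bval F t * h t).
Proof.
move=> hh; have [Lh _] := hh; apply/H2P; split; first exact: L2_bvalM.
move=> n; have z1 : nm 0 < 1 by rewrite nm0.
have iK : L1 leb (fun t => h t * ee t ^+ n.+1) by apply: L1_eeX; exact: L2_L1.
have := @bval_pairing (fun t => h t * ee t ^+ n.+1) 0 0 iK z1; rewrite mulr0 => <-.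
  by apply: eq_cint => t _; rewrite mulrA.
by move=> p r r0 r1; rewrite mulr0 poly_coef0.
Qed.

Lemma cauchy_bvalM h l : nm l < 1 -> H2 h ->
  cauchy leb (fun t => bval F t * h t) l = F l * cauchy leb h l.
Proof.
move=> l1 hh; have [Lh _] := hh.
have iK : L1 leb (fun t => h t * ker l t) by apply: L1_ker => //; exact: L2_L1.
rewrite -(bval_pairing iK l1); first by apply: eq_cint => t _; rewrite mulrA.
by move=> p r r0 r1; rewrite poly_hext.
Qed.

Lemma H2_1 : H2 (fun=> 1).
Proof.
apply/H2P; split; first by apply: (L2_bdd leb_I0_lty (B := 1)) => [|t _]; [exact: cmeas_cst|rewrite nm1].
by move=> k; rewrite -[RHS](cint_eeX k.+1); apply: eq_cint => t _; rewrite mul1r.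
Qed.

Lemma cauchy_0 (mu : {measure set MR -> \bar RR}) h : cauchy mu h 0 = cint mu I0 h.
Proof. by apply: eq_cint => t _; rewrite /ker mul0r subr0 invr1 mulr1. Qed.

Lemma cint_bvalM h : H2 h -> cint leb I0 (fun t => bval F t * h t) = F 0 * cint leb I0 h.
Proof. by move=> hh; rewrite -!cauchy_0 cauchy_bvalM ?nm0. Qed.
End multiplier.

(** * The characteristic function *)

Section theta.
Variable mu : {measure set MR -> \bar RR}.
Hypothesis hmu : mu I0 = 1%E.

Let fmu : (mu I0 < +oo)%E. Proof. by rewrite hmu ltry. Qed.

Definition Rmu (l : CC) : CC := cauchy mu (fun=> 1) l.
Definition Pmu (l : CC) : RR := Rintegral mu I0 (pk l).

Lemma cint_mu1 : cint mu I0 (fun=> 1) = 1.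
Proof.
rewrite -[LHS]/(cint mu I0 (fun=> (1 : RR)%:C%C)) cint_real.
by rewrite (_ : Rintegral mu I0 (fun=> 1) = 1)// (@Rintegral_cst _ _ _ mu I0 mI0 1) mul1r hmu.
Qed.

Lemma PmuE l : nm l < 1 -> (Pmu l)%:C%C = Rmu l + (Rmu l)^* - 1.
Proof.
move=> l1; have := pintE l1 (L1_cst fmu 1); rewrite cint_mu1.
rewrite [X in _ = _ + X^* - _ -> _](_ : _ = Rmu l); last first.
  by apply: eq_cint => t _; rewrite conj1.
move=> <-; rewrite /pint -cint_real; apply: eq_cint => t _; by rewrite mulr1.
Qed.

Lemma Re_Rmu l : nm l < 1 -> 2 * ReC (Rmu l) = Pmu l + 1.
Proof.
move=> l1; have := congr1 (fun z => ReC z) (PmuE l1); rewrite addCJ ReR => ->.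
by rewrite -realC1 -realCB ReR subrK.
Qed.

Lemma Pmu_gt0 l : nm l < 1 -> 0 < Pmu l.
Proof.
move=> l1; have y0 : 0 < 1 - nm l by rewrite subr_gt0.
apply: (@lt_le_trans _ _ ((1 - nm l) / 4)); first by rewrite divr_gt0.
have -> : (1 - nm l) / 4 = Rintegral mu I0 (fun=> (1 - nm l) / 4).
  by rewrite (@Rintegral_cst _ _ _ mu I0 mI0) hmu mulr1.
apply: le_Rintegral => //; [exact: integrable_cstI0|exact: integrable_pk|].
move=> t It; apply: le_trans (pk_bounds t l1).1.
rewrite ler_wpM2l ?(ltW y0)//; have D0 := lt_le_trans y0 (dist_ge_nm l t).
rewrite lef_pV2 ?posrE ?exprn_gt0//.
have D2 : nm (ee t - l) <= 2 by apply: (le_trans (nmBle _ _)); rewrite nm_ee; lra.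
have -> : 4 = 2 ^+ 2 :> RR by ring.
by rewrite ler_sqr ?nnegrE ?(ltW D0).
Qed.

Lemma R2E l : nm l < 1 -> R2 mu l = 2 * Rmu l - 1.
Proof.
move=> l1; rewrite /R2 (eq_cint _ (G := fun t => 2 * (1 * ker l t) - 1)).
  have ik := L1_ker l1 (L1_cst fmu 1); have i1 := L1_cst fmu 1.
  by rewrite (cintB (L1Z 2 ik) i1) (cintZ 2 ik) cint_mu1.
by move=> t _; rewrite /ker; have := kernel_neq0 t l1; rewrite [l * _]mulrC => k0; field.
Qed.

Lemma Rmu0 : Rmu 0 = 1.
Proof. by rewrite /Rmu cauchy_0 cint_mu1. Qed.

Variable g : CC.
Hypothesis g1 : nm g < 1.

Definition Qmu (l : CC) : CC := (1 - g^*) * Rmu l + g^*.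

Lemma one_sub_neq0 (c : CC) : nm c < 1 -> 1 - c != 0.
Proof.
move=> c1; rewrite -nm_eq0 gt_eqF//; apply: (@lt_le_trans _ _ (1 - nm c)); first by rewrite subr_gt0.
by have := nm_dist 1 c; rewrite nm1; apply: le_trans; exact: ler_norm.
Qed.

Let gJ1 : nm (g^*) < 1. Proof. by rewrite nmJ. Qed.

Let gJ0 : 1 - g^* != 0. Proof. exact: one_sub_neq0. Qed.

(** The source of [kap]: the summand [conj(gamma) / (1 - conj(gamma))] of [Nmu] contributes this
    much to twice its real part, and it is positive because [|gamma| < 1]. *)
Lemma Re_quot (c : CC) : nm c < 1 -> 2 * ReC (c / (1 - c)) + 1 = (1 - sqn c) / sqn (1 - c).
Proof.
move=> c1; have c0 := one_sub_neq0 c1.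
have s0 : sqn (1 - c) != 0 by rewrite -nm_sqr expf_neq0// nm_eq0.
rewrite ReM ReV ImV.
have -> : ReC (1 - c) = 1 - ReC c by rewrite ReD ReN.
have -> : ImC (1 - c) = - ImC c by rewrite ImD ImN add0r.
have -> : sqn c = ReC c ^+ 2 + ImC c ^+ 2 by [].
have e : sqn (1 - c) = (1 - ReC c) ^+ 2 + ImC c ^+ 2.
  by rewrite /sqn ReD ReN ImD ImN; congr (_ + _); rewrite add0r sqrrN.
move: s0 e; move: (sqn (1 - c)) (ReC c) (ImC c) => s a b s0 e.
apply: (mulfI s0); rewrite [RHS]mulrC divfK//.
have -> : s * (2 * (a * ((1 - a) / s) - b * (- - b / s)) + 1) = 2 * (a * (1 - a) - b ^+ 2) + s.
  by field.
by rewrite e; ring.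
Qed.

Definition Nmu (l : CC) : CC := Qmu l / (1 - g^*).

Lemma NmuE l : Nmu l = Rmu l + g^* / (1 - g^*).
Proof. by rewrite /Nmu /Qmu; field. Qed.

Definition kap : RR := (1 - sqn g) / sqn (1 - g^*).

Lemma sqng : 0 < 1 - sqn g.
Proof. by rewrite -nm_sqr subr_gt0 expr_lt1// nm_ge0. Qed.

Lemma kap_gt0 : 0 < kap.
Proof.
rewrite divr_gt0 ?sqng// -nm_sqr exprn_gt0// nm_gt0.
exact: gJ0.
Qed.

Lemma Re_Nmu l : nm l < 1 -> 2 * ReC (Nmu l) = Pmu l + kap.
Proof.
move=> l1; rewrite NmuE ReD mulrDr Re_Rmu// -addrA; congr (_ + _).
by rewrite addrC Re_quot// /kap -[sqn g^*]nm_sqr nmJ nm_sqr.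
Qed.

Lemma Qmu_neq0 l : nm l < 1 -> Qmu l != 0.
Proof.
move=> l1; apply: contraTneq (addr_gt0 (Pmu_gt0 l1) kap_gt0) => Q0.
by rewrite -Re_Nmu// /Nmu Q0 mul0r mulr0 ltxx.
Qed.

Lemma thetaE l : nm l < 1 -> theta mu g l = ((1 - g) * Rmu l - 1) / Qmu l.
Proof.
move=> l1; rewrite /theta R2E//.
have -> : (1 - g) * (2 * Rmu l - 1) - (1 + g) = 2 * ((1 - g) * Rmu l - 1) by ring.
have -> : (1 - g^*) * (2 * Rmu l - 1) + (1 + g^*) = 2 * Qmu l by rewrite /Qmu; ring.
by have Q0 := Qmu_neq0 l1; field.
Qed.

(** The difference of the squared moduli of denominator and numerator is [1 - |gamma|^2] times
    P[mu]; positivity of P[mu] is what bounds theta by 1. *)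
Lemma sqn_theta l : nm l < 1 -> 1 - sqn (theta mu g l) = (1 - sqn g) * Pmu l / sqn (Qmu l).
Proof.
move=> l1; have Q0 := Qmu_neq0 l1.
have s0 : sqn (Qmu l) != 0 by rewrite -nm_sqr expf_neq0// nm_eq0.
have -> : sqn (theta mu g l) = sqn ((1 - g) * Rmu l - 1) / sqn (Qmu l).
  by rewrite thetaE// -!nm_sqr nmM nmV expr_div_n.
apply: (mulIf s0); rewrite divfK// mulrBl mul1r divfK//.
apply: (@complexI RR); rewrite realCB realCM realCB realC1 !sqnE PmuE//.
by rewrite /Qmu; move: (Rmu l) => R; rewrite !(conjD, conjN, conjM, conj1, conjK); ring.
Qed.

Lemma nm_theta l : nm l < 1 -> nm (theta mu g l) <= 1.
Proof.
move=> l1; have h : 0 <= 1 - sqn (theta mu g l).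
  by rewrite sqn_theta// divr_ge0 ?sqn_ge0// mulr_ge0 ?(ltW sqng)// ltW// Pmu_gt0.
by rewrite -(@expr_le1 _ 2)// ?nm_ge0// nm_sqr -subr_ge0.
Qed.

Lemma theta0 : theta mu g 0 = - g.
Proof. by rewrite thetaE ?nm0// /Qmu Rmu0 !mulr1 subrK divr1; ring. Qed.

Lemma discA_Rmu : discA Rmu. Proof. exact/discA_cauchy/L1_cst. Qed.

(** The denominator is inverted in the form [Nmu], whose real part is at least [kap / 2], as
    [discAV] requires. *)
Lemma discA_theta : discA (theta mu g).
Proof.
have dN : discA Nmu.
  apply: (eq_discA (F := fun l => Rmu l + g^* / (1 - g^*))) => [l _|]; first by rewrite NmuE.
  by apply: discAD; [exact: discA_Rmu|exact: discA_cst].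
have dV : discA (fun l => (Nmu l)^-1).
  apply: (discAV (d := kap / 2)) => //; first by rewrite divr_gt0// kap_gt0.
  by move=> l l1; have := Re_Nmu l1; have := Pmu_gt0 l1; lra.
apply: (eq_discA (F := fun l => (((1 - g) * Rmu l - 1) * (1 - g^*)^-1) * (Nmu l)^-1)) => [l l1|].
  by rewrite thetaE// /Nmu; have Q0 := Qmu_neq0 l1; field; rewrite Q0.
apply: discAM => //; apply: discAM; last exact: discA_cst.
by apply: discAB; [apply: discAM; [exact: discA_cst|exact: discA_Rmu]|exact: discA_cst].
Qed.

Lemma thetab_le t : nm (thetab mu g t) <= 1.
Proof. exact: (nm_bval_le t nm_theta). Qed.

Lemma cmeas_thetab : cmeas (thetab mu g).
Proof. exact: cmeas_bval discA_theta. Qed.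

Lemma cmeas_Deltab : cmeas (Deltab mu g).
Proof.
apply: cmeas_real; apply: measurable_sqrt; apply: measurable_funB => //.
by apply: cmeas_sqn; exact: cmeas_thetab.
Qed.

Lemma Deltab_sqr t : Deltab mu g t * Deltab mu g t = 1 - thetab mu g t * (thetab mu g t)^*.
Proof.
rewrite /Deltab -realCM -expr2 sqr_sqrtr ?realCB ?sqnE//.
by rewrite subr_ge0 -nm_sqr expr_le1 ?nm_ge0 ?thetab_le.
Qed.

Lemma DeltabJ t : (Deltab mu g t)^* = Deltab mu g t.
Proof. by rewrite /Deltab conjR. Qed.

Lemma Deltab_le t : nm (Deltab mu g t) <= 1.
Proof.
rewrite nm_real ger0_norm ?sqrtr_ge0// -[leRHS]sqrtr1 ler_wsqrtr//.
by rewrite gerBl sqn_ge0.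
Qed.
End theta.

(** * The model space and the Clark operator *)

Lemma L2_mulb (mu : {measure set MR -> \bar RR}) F G (B : RR) : cmeas F -> (forall t, nm (F t) <= B) ->
  L2 mu G -> L2 mu (fun t => F t * G t).
Proof. by move=> cF bF; apply: (L2Ml (B := B)) => // t _; exact: bF. Qed.

Lemma nm_kerJ_le l t : nm l < 1 -> nm (ker l t)^* <= (1 - nm l)^-1.
Proof. by move=> l1; rewrite nmJ; exact: nm_ker_le. Qed.

Lemma cmeas_kerJ l : cmeas (fun t => (ker l t)^*).
Proof. by apply: cmeasJ; exact: cmeas_ker. Qed.

Lemma L2_kerJM (mu : {measure set MR -> \bar RR}) G l : nm l < 1 -> L2 mu G -> L2 mu (fun t => G t * (ker l t)^*).
Proof.
move=> l1 LG; have := L2_mulb (cmeas_kerJ l) (fun t => nm_kerJ_le t l1) LG.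
by apply: eq_L2 => t _; rewrite mulrC.
Qed.

Lemma kerJE l t : nm l < 1 -> l^* * ee t * (ker l t)^* = (ker l t)^* - 1.
Proof.
move=> l1; have h := kerE t l1; rewrite {2}h conjD conj1 !conjM conjK; ring.
Qed.

Lemma kerJ_inv l t : nm l < 1 -> (1 - l^* * ee t) * (ker l t)^* = 1.
Proof. by move=> l1; rewrite mulrBl mul1r kerJE//; ring. Qed.

Section closure.
Variable D : MR -> CC.
Hypothesis cD : cmeas D.
Hypothesis D1 : forall t, nm (D t) <= 1.

Lemma integrable_sqn G : L2 leb G -> leb.-integrable I0 (EFin \o (fun t => sqn (G t))).
Proof. by case. Qed.

Lemma closDL2P G : closDL2 D G <-> L2 leb G /\ forall e : RR, 0 < e ->
  exists2 h, L2 leb h & Rintegral leb I0 (fun t => sqn (G t - D t * h t)) < e.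
Proof.
have R0 h : 0 <= Rintegral leb I0 (fun t => sqn (G t - D t * h t)).
  by apply: Rintegral_ge0 => t _; exact: sqn_ge0.
split=> -[LG H]; split => // e e0.
  have s0 : 0 < Num.sqrt e by rewrite sqrtr_gt0.
  have [h Lh hh] := H _ s0; exists h => //.
  by move: hh; rewrite /nrm ltr_sqrt.
have e2 : 0 < e ^+ 2 by rewrite exprn_gt0.
have [h Lh hh] := H _ e2; exists h => //.
by rewrite /nrm -[ltRHS](ger0_norm (ltW e0)) -sqrtr_sqr ltr_sqrt.
Qed.

Lemma closDL2_lin a G H : closDL2 D G -> closDL2 D H -> closDL2 D (fun t => a * G t + H t).
Proof.
move=> /closDL2P[LG hG] /closDL2P[LH hH]; apply/closDL2P; split.
  by apply: L2D => //; exact: L2Z.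
have alg (s x y z : RR) : 0 <= s -> 0 <= x -> 0 <= y -> 0 <= z -> s <= x * z + y ->
    s ^+ 2 <= 2 * (x ^+ 2 + 1) * z ^+ 2 + 2 * y ^+ 2.
  move=> s0 x0 y0 z0 hs.
  have h2 : s ^+ 2 <= (x * z + y) ^+ 2 by rewrite ler_sqr ?nnegrE// addr_ge0// mulr_ge0.
  have h3 : 0 <= (x * z - y) ^+ 2 by exact: sqr_ge0.
  have h4 : 0 <= z ^+ 2 by exact: sqr_ge0.
  by apply: (le_trans h2); nra.
move=> e e0; pose A := 2 * (sqn a + 1).
have A0 : 0 < A by rewrite mulr_gt0// ltr_wpDl// sqn_ge0.
have e1 : 0 < e / A / 2 by rewrite !divr_gt0.
have e2 : 0 < e / 4 by rewrite divr_gt0.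
have [h Lh Hh] := hG _ e1; have [k Lk Hk] := hH _ e2.
exists (fun t => a * h t + k t); first by apply: L2D => //; exact: L2Z.
have LX : L2 leb (fun t => G t - D t * h t) by apply: L2B => //; exact: L2_mulb cD D1 Lh.
have LY : L2 leb (fun t => H t - D t * k t) by apply: L2B => //; exact: L2_mulb cD D1 Lk.
have iX := integrable_sqn LX; have iY := integrable_sqn LY.
have iXA : leb.-integrable I0 (EFin \o (fun t => A * sqn (G t - D t * h t))).
  by have := integrableZl mI0 A iX; apply: eq_integrable.
have iY2 : leb.-integrable I0 (EFin \o (fun t => 2 * sqn (H t - D t * k t))).
  by have := integrableZl mI0 2 iY; apply: eq_integrable.
apply: (@le_lt_trans _ _ (Rintegral leb I0 (fun t => A * sqn (G t - D t * h t) + 2 * sqn (H t - D t * k t)))).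
  apply: le_Rintegral => //.
  - apply: integrable_sqn; have := L2D (L2Z a LX) LY; apply: eq_L2 => t _; ring.
  - exact: (integrableD mI0 iXA iY2).
  - move=> t _; rewrite -!nm_sqr.
    have -> : a * G t + H t - D t * (a * h t + k t) = a * (G t - D t * h t) + (H t - D t * k t) by ring.
    have := nmD (a * (G t - D t * h t)) (H t - D t * k t); rewrite nmM /A -nm_sqr.
    by apply: alg; exact: nm_ge0.
rewrite RintegralD// !RintegralZl//.
have -> : e = A * (e / A / 2) + 2 * (e / 4) by field; rewrite gt_eqF.
by apply: ltrD; rewrite ltr_pM2l.
Qed.

Lemma closDL2_mulr G h (B : RR) : cmeas h -> (forall t, nm (h t) <= B) -> 0 < B ->
  closDL2 D G -> closDL2 D (fun t => G t * h t).
Proof.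
move=> ch bh B0 /closDL2P[LG hG]; apply/closDL2P.
have Lm k : L2 leb k -> L2 leb (fun t => k t * h t).
  by move=> Lk; have := L2_mulb ch bh Lk; apply: eq_L2 => t _; rewrite mulrC.
split; first exact: Lm.
move=> e e0; have e1 : 0 < e / B ^+ 2 by rewrite divr_gt0// exprn_gt0.
have [k Lk Hk] := hG _ e1; exists (fun t => k t * h t); first exact: Lm.
have LX : L2 leb (fun t => G t - D t * k t) by apply: L2B => //; exact: L2_mulb cD D1 Lk.
have iX := integrable_sqn LX.
apply: (@le_lt_trans _ _ (Rintegral leb I0 (fun t => B ^+ 2 * sqn (G t - D t * k t)))).
  apply: le_Rintegral => //.
  - by apply: integrable_sqn; have := Lm _ LX; apply: eq_L2 => t _; ring.
  - by have := integrableZl mI0 (B ^+ 2) iX; apply: eq_integrable.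
  - move=> t _; have -> : G t * h t - D t * (k t * h t) = h t * (G t - D t * k t) by ring.
    rewrite -!nm_sqr nmM exprMn ler_wpM2r ?sqr_ge0// ler_sqr ?nnegrE ?nm_ge0//.
    exact: ltW.
by rewrite RintegralZl// mulrC -ltr_pdivlMr// exprn_gt0.
Qed.

Lemma closDL2_D h : L2 leb h -> closDL2 D (fun t => D t * h t).
Proof.
move=> Lh; apply/closDL2P; split; first exact: L2_mulb cD D1 Lh.
move=> e e0; exists h => //.
have -> : (fun t => sqn (D t * h t - D t * h t)) = (fun=> 0).
  by apply/funext => t; rewrite subrr /sqn !expr0n addr0.
by rewrite Rintegral_leb_cst.
Qed.
End closure.

Section clark.
Variable mu : probability MR RR.
Hypothesis hmu : mu I0 = 1%E.
Variable gam : CC.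
Hypothesis hgam : nm gam < 1.

Let fmu : (mu I0 < +oo)%E. Proof. by rewrite hmu ltry. Qed.
Let th := thetab mu gam.
Let De := Deltab mu gam.
Let F := theta mu gam.
Let K := Kmodel th De.
Let kk : RR := Num.sqrt (1 - sqn gam).

Let cth : cmeas th. Proof. exact: cmeas_thetab. Qed.
Let cDe : cmeas De. Proof. exact: cmeas_Deltab. Qed.
Let th1 t : nm (th t) <= 1. Proof. exact: thetab_le. Qed.
Let De1 t : nm (De t) <= 1. Proof. exact: Deltab_le. Qed.
Let DD t : De t * De t = 1 - th t * (th t)^*. Proof. exact: Deltab_sqr. Qed.
Let DJ t : (De t)^* = De t. Proof. exact: DeltabJ. Qed.
Let dF : discA F. Proof. exact: discA_theta. Qed.
Let F1 z : nm z < 1 -> nm (F z) <= 1. Proof. exact: nm_theta. Qed.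

Let H2_th h : H2 h -> H2 (fun t => th t * h t). Proof. exact: (H2_bvalM dF F1). Qed.

Let kk0 : 0 < kk. Proof. by rewrite sqrtr_gt0 sqng. Qed.
Let kkC : kk%:C%C != 0. Proof. by rewrite -nm_eq0 nm_real normr_eq0 gt_eqF. Qed.

Lemma orthE u h : L2 leb u.1 -> L2 leb u.2 -> L2 leb h ->
  pip u (fun t => th t * h t, fun t => De t * h t) =
  (cint leb I0 (fun t => ((u.1 t)^* * th t + (u.2 t)^* * De t) * h t))^*.
Proof.
move=> L1u L2u Lh; rewrite /pip /ip /=.
have i1 := L2MJ L1u (L2_mulb cth th1 Lh); have i2 := L2MJ L2u (L2_mulb cDe De1 Lh).
rewrite -cintD// -cintJ; last first.
  have := L1J (L1D i1 i2); apply: eq_L1 => t _.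
  by rewrite !(conjD, conjM, conjK); ring.
by apply: eq_cint => t _; rewrite !(conjD, conjM, conjK); ring.
Qed.

Lemma KP u : K u <-> [/\ H2 u.1, closDL2 De u.2 & forall h, H2 h ->
  cint leb I0 (fun t => ((u.1 t)^* * th t + (u.2 t)^* * De t) * h t) = 0].
Proof.
split=> [[h1 [h2 h3]]|[h1 h2 h3]].
  split => // h hh; have := h3 h hh.
  have [[[L1u _] [L2u _]] [Lh _]] := (h1, h2, hh).
  by rewrite orthE// => /(congr1 Num.conj); rewrite conjK conjC0.
split => //; split => // h hh.
have [[[L1u _] [L2u _]] [Lh _]] := (h1, h2, hh).
by rewrite orthE// h3// conjC0.
Qed.

Lemma K_L2 u : K u -> L2 leb u.1 /\ L2 leb u.2.
Proof. by move=> [[L1u _] [[L2u _] _]]. Qed.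

Lemma K_lin a u v : K u -> K v -> K (fun t => a * u.1 t + v.1 t, fun t => a * u.2 t + v.2 t).
Proof.
move=> Ku Kv; have [Lu1 Lu2] := K_L2 Ku; have [Lv1 Lv2] := K_L2 Kv.
have [hu cu ou] := (KP u).1 Ku; have [hv cv ov] := (KP v).1 Kv.
apply/KP; split => /=.
- have /H2P[_ c1] := hu; have /H2P[_ c2] := hv; apply/H2P; split.
    by apply: L2D => //; exact: L2Z.
  have iX G n : L2 leb G -> L1 leb (fun t => G t * ee t ^+ n.+1) by move=> LG; exact/L1_eeX/L2_L1.
  move=> n; rewrite (eq_cint _ (G := fun t => a * (u.1 t * ee t ^+ n.+1) + v.1 t * ee t ^+ n.+1)); last by move=> t _; ring.
  have i1 := iX _ n Lu1; have i2 := iX _ n Lv1.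
  by rewrite cintD ?cintZ ?c1 ?c2 ?mulr0 ?addr0//; exact: L1Z.
- exact: closDL2_lin.
- move=> h hh; have [Lh _] := hh.
  have iX (p : (MR -> CC) * (MR -> CC)) : L2 leb p.1 -> L2 leb p.2 ->
      L1 leb (fun t => ((p.1 t)^* * th t + (p.2 t)^* * De t) * h t).
    move=> Lp1 Lp2; have := L1D (L2M (L2J Lp1) (L2_mulb cth th1 Lh)) (L2M (L2J Lp2) (L2_mulb cDe De1 Lh)).
    by apply: eq_L1 => t _; ring.
  have i1 := iX u Lu1 Lu2; have i2 := iX v Lv1 Lv2.
  rewrite (eq_cint _ (G := fun t => a^* * (((u.1 t)^* * th t + (u.2 t)^* * De t) * h t) + ((v.1 t)^* * th t + (v.2 t)^* * De t) * h t)).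
    by rewrite cintD ?cintZ ?ou ?ov ?mulr0 ?addr0//; exact: L1Z.
  by move=> t _; rewrite !(conjD, conjM); ring.
Qed.

Lemma H2_lin a G H : H2 G -> H2 H -> H2 (fun t => a * G t + H t).
Proof.
move=> /H2P[LG hG] /H2P[LH hH]; apply/H2P; split; first by apply: L2D => //; exact: L2Z.
move=> n; have iX k : L2 leb k -> L1 leb (fun t => k t * ee t ^+ n.+1) by move=> Lk; exact/L1_eeX/L2_L1.
rewrite (eq_cint _ (G := fun t => a * (G t * ee t ^+ n.+1) + H t * ee t ^+ n.+1)); last by move=> t _; ring.
have i1 := iX _ LG; have i2 := iX _ LH.
by rewrite cintD ?cintZ ?hG ?hH ?mulr0 ?addr0//; exact: L1Z.
Qed.

(** The reproducing kernel of the model space: its pairing with [(g1, g2)] is the conjugate of the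
    value of [g1] at [l]. At [l = 0] it is a multiple of the defect vector [cg]. *)
Definition kvec (l : CC) : (MR -> CC) * (MR -> CC) :=
  (fun t => (1 - (F l)^* * th t) * (ker l t)^*, fun t => - (F l)^* * De t * (ker l t)^*).

(** By [|theta|^2 + Delta^2 = 1] on the circle, orthogonality reduces to the evaluation
    [(theta h)(l) = theta(l) h(l)]. *)
Lemma K_kvec l : nm l < 1 -> K (kvec l).
Proof.
move=> l1; apply/KP; split => /=.
- have := H2_kerJ l1 (H2_lin (- (F l)^*) (H2_th H2_1) H2_1).
  by congr H2; apply/funext => t; ring.
- have Lk : L2 leb (fun t => - (F l)^* * (ker l t)^*).
    by apply: L2Z; have := L2_kerJM l1 (H2_1).1; apply: eq_L2 => t _; rewrite mul1r.
  by have := closDL2_D cDe De1 Lk; congr closDL2; apply/funext => t; ring.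
- move=> h hh; have [Lh _] := hh; have iL := L2_L1 leb_I0_lty Lh.
  have iK := L1_ker l1 iL; have iT := L1_ker l1 (L1_bvalM dF F1 iL).
  rewrite (eq_cint _ (G := fun t => th t * h t * ker l t - F l * (h t * ker l t))).
    rewrite cintB ?cintZ//; last exact: L1Z.
    by have := cauchy_bvalM dF F1 l1 hh; rewrite /cauchy => ->; rewrite subrr.
  move=> t _; rewrite !(conjB, conjM, conjN, conj1, conjK) DJ.
  have -> : - F l * De t * ker l t * De t = - F l * ker l t * (De t * De t) by ring.
  by rewrite DD; ring.
Qed.

Lemma theta0E : F 0 = - gam. Proof. exact: theta0. Qed.

Lemma cgE t : (kvec 0).1 t = kk%:C%C * (cg mu gam).1 t /\ (kvec 0).2 t = kk%:C%C * (cg mu gam).2 t.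
Proof.
rewrite /kvec /cg /= -/F theta0E.
have -> : sqn (- gam) = sqn gam by rewrite -!nm_sqr nmN.
rewrite -/kk realCV /ker mul0r subr0 invr1 conj1 !mulr1.
by split; rewrite mulrA mulfV// mul1r.
Qed.

Lemma K_c1g : K (c1g mu gam).
Proof.
rewrite /c1g -/F theta0E.
have -> : sqn (- gam) = sqn gam by rewrite -!nm_sqr nmN.
rewrite -/kk; apply/KP; split => /=.
- have hh : H2 (fun t => gam * 1 + th t * 1) by apply: H2_lin; [exact: H2_1|exact/H2_th/H2_1].
  have /H2P[Lh h0] := hh.
  have LV G : L2 leb G -> L2 leb (fun t => (kk^-1)%:C%C * ((ee t)^-1 * G t)).
    move=> LG; apply: L2Z; apply: (L2_mulb (B := 1)) => // [|t].
      by apply: cmeasV; exact: cmeas_ee.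
    by rewrite nmV nm_ee invr1.
  apply/H2P; split.
    by have := LV _ Lh; apply: eq_L2 => t _; rewrite /th; ring.
  move=> n; rewrite (eq_cint _ (G := fun t => (kk^-1)%:C%C * ((gam * 1 + th t * 1) * ee t ^+ n))).
    rewrite cintZ; last by apply: L1_eeX; exact: L2_L1.
    case: n => [|n]; last by rewrite h0 mulr0.
    have -> : cint leb I0 (fun t => (gam * 1 + th t * 1) * ee t ^+ 0) = gam + cint leb I0 (fun t => th t * 1).
      have iT := L1_bvalM dF F1 (L1_cst leb_I0_lty 1).
      rewrite -[X in X + _](cint_leb_cst gam) -cintD//; last exact: L1_cst.
      by apply: eq_cint => t _; rewrite expr0 !mulr1.
    by rewrite (cint_bvalM dF F1 H2_1) cint_leb_cst theta0E mulr1 subrr mulr0.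
  move=> t _; rewrite exprS; have e0 := ee_neq0 t; rewrite -/th.
  by move: ((kk^-1)%:C%C) (ee t ^+ n) => c E; field.
- have Lk : L2 leb (fun t => (kk^-1)%:C%C * (ee t)^-1).
    apply: (L2_bdd leb_I0_lty (B := `|kk^-1|)).
      by apply: cmeasM; [exact: cmeas_cst|apply: cmeasV; exact: cmeas_ee].
    by move=> t _; rewrite nmM nm_real nmV nm_ee invr1 mulr1.
  by have := closDL2_D cDe De1 Lk; congr closDL2; apply/funext => t; rewrite /De; ring.
- move=> h hh; have he := H2_eeM hh; have [Lh _] := hh; have [Le _] := he.
  have iE := L2_L1 leb_I0_lty Le.
  have E0 : cint leb I0 (fun t => ee t * h t) = 0.
    have /H2P[_ /(_ 0%N) <-] := hh; apply: eq_cint => t _; by rewrite expr1 mulrC.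
  rewrite (eq_cint _ (G := fun t => (kk^-1)%:C%C * (ee t * h t + gam^* * (th t * (ee t * h t))))).
    have iT := L1_bvalM dF F1 iE.
    rewrite cintZ; last by apply: L1D => //; exact: L1Z.
    by rewrite cintD ?cintZ// ?(cint_bvalM dF F1 he) ?E0 ?mulr0 ?addr0 ?mulr0//; exact: L1Z.
  have cJ : ((kk^-1)%:C%C)^* = (kk^-1)%:C%C by exact: conjR.
  move: ((kk^-1)%:C%C) cJ => c cJ t _; rewrite eeV -/th -/De.
  have -> : (c * ((ee t)^* * (th t - - gam)))^* * th t + (c * ((ee t)^* * De t))^* * De t =
    c * ee t * ((th t * (th t)^* + De t * De t) + gam^* * th t).
    by rewrite !conjM conjB conjN conjK cJ DJ; ring.
  by rewrite DD; ring.
Qed.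

(** * Action of the Clark operator on model vectors *)

Variable Phi : (MR -> CC) * (MR -> CC) -> (MR -> CC).
Hypothesis hPhi : IsClark mu gam Phi.

Let PhiL u : K u -> L2 mu (Phi u). Proof. by have [h _] := hPhi; exact: h. Qed.
Let Phi_lin u v (a : CC) : K u -> K v ->
  aeq mu (Phi (fun x => a * u.1 x + v.1 x, fun x => a * u.2 x + v.2 x)) (fun x => a * Phi u x + Phi v x).
Proof. by have [_ [h _]] := hPhi; exact: h. Qed.
Let Phi_iso u : K u -> ip mu (Phi u) (Phi u) = pip u u.
Proof. by have [_ [_ [h _]]] := hPhi; exact: h. Qed.
Let Phi_onto G : L2 mu G -> exists2 u, K u & aeq mu (Phi u) G.
Proof. by have [_ [_ [_ [h _]]]] := hPhi; exact: h. Qed.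
Let Phi_inter u w : K u -> K w ->
  (forall v, K v -> pip (fun x => (mulz u).1 x - w.1 x, fun x => (mulz u).2 x - w.2 x) v = 0) ->
  aeq mu (Phi w) (Ug mu gam (Phi u)).
Proof. by have [_ [_ [_ [_ [h _]]]]] := hPhi; exact: h. Qed.
Let Phi_cg : aeq mu (Phi (cg mu gam)) (fun=> 1).
Proof. by have [_ [_ [_ [_ [_ [h _]]]]]] := hPhi. Qed.
Let Phi_c1g : aeq mu (Phi (c1g mu gam)) bb1.
Proof. by have [_ [_ [_ [_ [_ [_ h]]]]]] := hPhi. Qed.

Lemma ip_aeql G G' H : L2 mu G -> L2 mu G' -> L2 mu H -> aeq mu G G' -> ip mu G H = ip mu G' H.
Proof.
move=> [cG _] [cG' _] [cH _] e; apply: ae_eq_cint.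
- by apply: cmeasM => //; exact: cmeasJ.
- by apply: cmeasM => //; exact: cmeasJ.
- by apply: ae_mono e => t e It; rewrite e.
Qed.

Lemma ip_aeqr G G' H : L2 mu G -> L2 mu G' -> L2 mu H -> aeq mu G G' -> ip mu H G = ip mu H G'.
Proof.
by move=> LG LG' LH e; rewrite (ipC LG LH) (ipC LG' LH) (ip_aeql LG LG' LH e).
Qed.

Let L2_bb1 : L2 mu bb1.
Proof.
apply: (L2_bdd fmu (B := 1)) => [|t _]; first by apply: cmeasJ; exact: cmeas_ee.
by rewrite nmJ nm_ee.
Qed.

(** Polarisation of the isometry with the coefficients 1 and i. *)
Lemma Phi_polar u v : K u -> K v -> ip mu (Phi u) (Phi v) = pip u v.
Proof.
move=> Ku Kv.
have pol a : a * ip mu (Phi u) (Phi v) + a^* * ip mu (Phi v) (Phi u) = a * pip u v + a^* * pip v u.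
  have Kw := K_lin a Ku Kv; have := Phi_iso Kw.
  have LU := PhiL Ku; have LV := PhiL Kv; have LaU := L2Z a LU; have LS := L2D LaU LV.
  have LW := PhiL Kw; have e := Phi_lin a Ku Kv.
  rewrite (ip_aeql LW LS LW e) (ip_aeqr LW LS LS e).
  have ex (nu : {measure set MR -> \bar RR}) (A B : MR -> CC) : L2 nu A -> L2 nu B ->
     ip nu (fun x => a * A x + B x) (fun x => a * A x + B x) =
     a * a^* * ip nu A A + ip nu B B + (a * ip nu A B + a^* * ip nu B A).
    move=> LA LB; have LZ := L2Z a LA; have LZB := L2D LZ LB.
    rewrite ipDl// !ipDr// !ipZl//.
    rewrite (ipC LZ LB) ipZl// (ipC LB LA) conjM conjK.
    rewrite (ipC LZ LA) ipZl// conjM -(ipC LA LA).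
    ring.
  have [Lu1 Lu2] := K_L2 Ku; have [Lv1 Lv2] := K_L2 Kv.
  rewrite ex// /pip /= !ex// Phi_iso// Phi_iso// /pip => h.
  apply: (addrI (a * a^* * (ip leb u.1 u.1 + ip leb u.2 u.2) + (ip leb v.1 v.1 + ip leb v.2 v.2))).
  by rewrite h; ring.
have h1 := pol 1; have hi := pol 'i%C.
move: h1 hi; rewrite conj1 !mul1r.
have -> : ('i%C : CC)^* = - 'i%C by apply: CCext; rewrite ?ReJ ?ImJ ?ReN ?ImN//= ?oppr0.
move: (ip mu (Phi u) (Phi v)) (ip mu (Phi v) (Phi u)) (pip u v) (pip v u) => x y p q h1 hi.
have i0 : ('i%C : CC) != 0 by rewrite -nm_eq0 /nm /sqn /= expr0n/= add0r expr1n sqrtr1 oner_eq0.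
have h2 : x - y = p - q by apply: (mulfI i0); rewrite !mulrBr; move: hi; rewrite !mulNr.
have h3 : 2 * x = 2 * p.
  have -> : 2 * x = (x + y) + (x - y) by ring.
  by rewrite h1 h2; ring.
by apply: (mulfI _ h3); rewrite pnatr_eq0.
Qed.

Lemma K_orth v c : K v -> pip (fun t => c * th t, fun t => c * De t) v = 0.
Proof.
move=> Kv; have [Lv1 Lv2] := K_L2 Kv.
have hc : H2 (fun=> c).
  by have := H2_Z c H2_1; congr H2; apply/funext => t; rewrite mulr1.
have [_ [_ /(_ _ hc)]] := Kv; rewrite /pip /= => h0.
have [Lc _] := hc.
have LA := L2_mulb cth th1 Lc; have LB := L2_mulb cDe De1 Lc.
have -> : (fun t => c * th t) = (fun t => th t * c) by apply/funext => t; rewrite mulrC.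
have -> : (fun t => c * De t) = (fun t => De t * c) by apply/funext => t; rewrite mulrC.
by rewrite (ipC Lv1 LA) (ipC Lv2 LB) -conjD h0 conjC0.
Qed.

(** The two equations say that [u] solves [(1 - conj(l) M) u = z] for the model operator [M], since
    multiples of [(theta, Delta)] are orthogonal to the model space. The intertwining relation
    transports this to [Ug], a rank-one perturbation of multiplication by xi, so [Phi u] is known up
    to the scalar [ip mu (Phi u) bb1]. *)
Lemma resolvent u z Fz l c : K u -> K z -> aeq mu (Phi z) Fz -> nm l < 1 -> l != 0 ->
  (forall t, l^* * ee t * u.1 t - u.1 t + z.1 t = c * th t) ->
  (forall t, l^* * ee t * u.2 t - u.2 t + z.2 t = c * De t) ->
  aeq mu (Phi u) (fun t => (Fz t + l^* * (gam - 1) * ip mu (Phi u) bb1) * (ker l t)^*).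
Proof.
move=> Ku Kz ez l1 l0 h1 h2.
have lc0 : l^* != 0 by rewrite conjC_eq0.
pose y : (MR -> CC) * (MR -> CC) := (fun t => (-1) * z.1 t + u.1 t, fun t => (-1) * z.2 t + u.2 t).
have Ky : K y by exact: K_lin.
(* [w] is [(u - z) / conj(l)], spelled as a combination [a * y + y] to fit [K_lin]. It differs from
   [mulz u] by a multiple of [(theta, Delta)], hence is the image of [u] under the model operator;
   the division is why [l] must not be 0. *)
pose w : (MR -> CC) * (MR -> CC) := (fun t => ((l^*)^-1 - 1) * y.1 t + y.1 t, fun t => ((l^*)^-1 - 1) * y.2 t + y.2 t).
have Kw : K w by exact: K_lin.
have wE1 t : w.1 t = (l^*)^-1 * (u.1 t - z.1 t) by rewrite /w /y /=; ring.
have wE2 t : w.2 t = (l^*)^-1 * (u.2 t - z.2 t) by rewrite /w /y /=; ring.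
have inter : aeq mu (Phi w) (Ug mu gam (Phi u)).
  apply: Phi_inter => // v Kv; rewrite -[RHS](K_orth ((l^*)^-1 * c) Kv).
  apply: (f_equal (pip^~ v)); apply: f_equal2; apply/funext => t.
    by rewrite wE1 -mulrA -h1 [(mulz u).1 t]/=; field.
  by rewrite wE2 -mulrA -h2 [(mulz u).2 t]/=; field.
have lin := Phi_lin l^* Kw Kz.
have uE : (fun x => l^* * w.1 x + z.1 x, fun x => l^* * w.2 x + z.2 x) = u.
  rewrite [RHS]surjective_pairing; congr pair; apply/funext => t; rewrite ?wE1 ?wE2.
    by field.
  by field.
rewrite uE in lin.
apply: ae_mono (ae_and lin (ae_and inter ez)) => t [e1 [e2 e3]] It.
have {}e1 := e1 It; have {}e2 := e2 It; have {}e3 := e3 It.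
rewrite /Ug in e2; rewrite e2 e3 in e1.
have kI := kerJ_inv t l1.
have e4 : Phi u t * (1 - l^* * ee t) = Fz t + l^* * (gam - 1) * ip mu (Phi u) bb1.
  by rewrite mulrBr mulr1 {1}e1; ring.
by rewrite -e4 -mulrA kI mulr1.
Qed.

Lemma Phi_kvec0 : aeq mu (Phi (kvec 0)) (fun=> kk%:C%C).
Proof.
have z1 : nm 0 < 1 by rewrite nm0.
have Kc : K (cg mu gam).
  have := K_lin ((kk%:C%C)^-1 - 1) (K_kvec z1) (K_kvec z1).
  have -> : (fun t => ((kk%:C%C)^-1 - 1) * (kvec 0).1 t + (kvec 0).1 t) = (cg mu gam).1.
    apply/funext => t; have [-> _] := cgE t; move: ((cg mu gam).1 t) => X.
    by rewrite mulrBl mul1r subrK mulKf.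
  have -> : (fun t => ((kk%:C%C)^-1 - 1) * (kvec 0).2 t + (kvec 0).2 t) = (cg mu gam).2.
    apply/funext => t; have [_ ->] := cgE t; move: ((cg mu gam).2 t) => X.
    by rewrite mulrBl mul1r subrK mulKf.
  by rewrite -surjective_pairing.
have := Phi_lin (kk%:C%C - 1) Kc Kc.
have -> : (fun x => (kk%:C%C - 1) * (cg mu gam).1 x + (cg mu gam).1 x,
   fun x => (kk%:C%C - 1) * (cg mu gam).2 x + (cg mu gam).2 x) = kvec 0.
  rewrite [RHS]surjective_pairing; congr pair; apply/funext => t; have [e1 e2] := cgE t.
    by rewrite e1; ring.
  by rewrite e2; ring.
move=> e; apply: ae_mono (ae_and e Phi_cg) => t [e1 e2] It.
by rewrite (e1 It) (e2 It); ring.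
Qed.

Lemma pip_lin a u v w : L2 leb u.1 -> L2 leb u.2 -> L2 leb v.1 -> L2 leb v.2 ->
  L2 leb w.1 -> L2 leb w.2 ->
  pip (fun t => a * u.1 t + v.1 t, fun t => a * u.2 t + v.2 t) w = a * pip u w + pip v w.
Proof.
move=> Lu1 Lu2 Lv1 Lv2 Lw1 Lw2; rewrite /pip /=.
have L1' := L2Z a Lu1; have L2' := L2Z a Lu2.
by rewrite !ipDl// !ipZl//; ring.
Qed.

Lemma pipC u v : L2 leb u.1 -> L2 leb u.2 -> L2 leb v.1 -> L2 leb v.2 ->
  pip v u = (pip u v)^*.
Proof. by move=> *; rewrite /pip conjD -!ipC. Qed.

(** * Disc identities for the adjoint of the Clark operator *)

Variable f : MR -> CC.
Hypothesis hf : L2 mu f.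
Variables g1 g2 : MR -> CC.
Hypothesis Kg : K (g1, g2).
Hypothesis adj : forall v, K v -> ip mu (Phi v) f = pip v (g1, g2).

Let Lg1 : L2 leb g1. Proof. by have [] := K_L2 Kg. Qed.
Let Lg2 : L2 leb g2. Proof. by have [] := K_L2 Kg. Qed.
Let hg1 : H2 g1. Proof. by have [] := Kg. Qed.

Lemma ip_self_eq0 G : L2 mu G -> ip mu G G = 0 -> aeq mu G (fun=> 0).
Proof.
move=> [cG iG] /(congr1 (fun z => ReC z)); rewrite Re_cint => h.
have {}h : Rintegral mu I0 (fun t => sqn (G t)) = 0.
  by rewrite -[RHS]h; apply: eq_Rintegral => t _; rewrite -sqnE.
have mS : measurable_fun I0 (fun t => (sqn (G t))%:E) := measurable_int _ iG.
have h0 : (\int[mu]_(t in I0) `|(sqn (G t))%:E| = 0)%E.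
  under eq_integral do rewrite gee0_abs ?lee_fin ?sqn_ge0//.
  by rewrite -[LHS]fineK ?integrable_fin_num//; congr EFin.
have := (ae_eq_integral_abs mu mI0 mS).1 h0.
apply: ae_mono => t e It; have := e It => -[s0].
have : nm (G t) ^+ 2 == 0 by rewrite nm_sqr s0.
by rewrite expf_eq0 /= nm_eq0 => /eqP.
Qed.

(** A preimage [u] of [f] and the vector [(g1, g2)] have the same pairings with the model space, so
    their difference is orthogonal to itself. *)
Lemma Phi_adj : aeq mu (Phi (g1, g2)) f.
Proof.
have [u Ku eu] := Phi_onto hf.
have Kd := K_lin (-1) Kg Ku; set d := (X in K X) in Kd.
have [Lu1 Lu2] := K_L2 Ku; have [Ld1 Ld2] := K_L2 Kd.
have pd : pip d u = pip d (g1, g2).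
  rewrite -adj// -Phi_polar//; apply: ip_aeqr => //; exact: PhiL.
have d0 : pip d d = 0.
  have := @pip_lin (-1) (g1, g2) u d Lg1 Lg2 Lu1 Lu2 Ld1 Ld2; rewrite -/d => ->.
  have -> := @pipC d (g1, g2) Ld1 Ld2 Lg1 Lg2; have -> := @pipC d u Ld1 Ld2 Lu1 Lu2.
  by rewrite pd mulN1r addNr.
have e0 := ip_self_eq0 (PhiL Kd) (etrans (Phi_iso Kd) d0).
have el := Phi_lin (-1) Kg Ku.
apply: ae_mono (ae_and e0 (ae_and el eu)) => t [h0 [h1 h2]] It.
have := h1 It; rewrite (h0 It) (h2 It) mulN1r addrC => /esym/eqP.
by rewrite subr_eq0 => /eqP.
Qed.

Definition gm (t : MR) : CC := (th t)^* * g1 t + De t * g2 t.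

Let L2_gm : L2 leb gm.
Proof.
apply: L2D; last exact: L2_mulb cDe De1 Lg2.
by apply: (L2_mulb (B := 1)) => // [|t]; [exact: cmeasJ|rewrite nmJ].
Qed.

(** Orthogonality of [(g1, g2)] to all [(theta h, Delta h)] says precisely that g_- is orthogonal to
    the Hardy space. *)
Lemma gm_orth h : H2 h -> cint leb I0 (fun t => (gm t)^* * h t) = 0.
Proof.
move=> hh; have [_ _ o] := (KP _).1 Kg; rewrite -[RHS](o h hh).
by apply: eq_cint => t _; rewrite /gm !(conjD, conjM, conjK) DJ; ring.
Qed.

Lemma H2_kerJ1 l : nm l < 1 -> H2 (fun t => (ker l t)^*).
Proof. by move=> l1; have := H2_kerJ l1 H2_1; congr H2; apply/funext => t; rewrite mul1r. Qed.

Lemma cauchy_gm l : nm l < 1 -> cauchy leb gm l = 0.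
Proof.
move=> l1; have := gm_orth (H2_kerJ1 l1) => /(congr1 Num.conj); rewrite conjC0 => <-.
have i := L1_ker l1 (L2_L1 leb_I0_lty L2_gm).
rewrite -cintJ; first by apply: eq_cint => t _; rewrite conjM !conjK.
by have := L1J i; apply: eq_L1 => t _; rewrite conjM.
Qed.

Lemma cint_gm : cint leb I0 gm = 0.
Proof. by rewrite -cauchy_0 cauchy_gm ?nm0. Qed.

(** The value at [l] of the antianalytic extension of g_-, which is also its Poisson integral
    because the Cauchy integral and the mean of g_- vanish. *)
Definition ec (l : CC) : CC := cint leb I0 (fun t => gm t * (ker l t)^*).

(** The solution in the model space of [(1 - conj(l) M) v = (g1, g2)] for the model operator [M].
    Division by [1 - conj(l) z] alone leaves the model space; the multiple [ec l] of
    [(theta, Delta)] corrects this. *)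
Definition vvec (l : CC) : (MR -> CC) * (MR -> CC) :=
  (fun t => (g1 t - ec l * th t) * (ker l t)^*, fun t => (g2 t - ec l * De t) * (ker l t)^*).

Let H2_g1e c : H2 (fun t => g1 t - c * th t).
Proof.
have := H2_lin (- c) (H2_th H2_1) hg1; congr H2; apply/funext => t; ring.
Qed.

Lemma cint_kerJ1 l : nm l < 1 -> cint leb I0 (fun t => (ker l t)^*) = 1.
Proof. by move=> l1; rewrite cintJ ?cauchy1 ?conj1//; exact: L1_ker1. Qed.

(** With [h * ker l = hquot + h(l) * ker l], the first term is analytic of mean 0 and gives nothing;
    on [ker l] the pairing is [conj(ec l) - conj(ec l)], which fixes the coefficient [ec l]. *)
Lemma K_vvec l : nm l < 1 -> K (vvec l).
Proof.
move=> l1; apply/KP; split => /=.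
- exact: H2_kerJ l1 (H2_g1e _).
- have B0 : 0 < (1 - nm l)^-1 by rewrite invr_gt0 subr_gt0.
  apply: (closDL2_mulr cDe De1 (cmeas_kerJ l) (fun t => nm_kerJ_le t l1) B0).
  have hD : closDL2 De (fun t => De t * 1) by apply: closDL2_D => //; exact: H2_1.1.
  have [_ cg2 _] := (KP _).1 Kg.
  by have := closDL2_lin cDe De1 (- ec l) hD cg2; congr closDL2; apply/funext => t /=; ring.
- move=> h hh; have [hq h0] := H2_hquot l1 hh.
  have iq := L2_L1 leb_I0_lty hq.1.
  have igq : L1 leb (fun t => (gm t)^* * hquot h l t) := L2M (L2J L2_gm) hq.1.
  have igk : L1 leb (fun t => (gm t)^* * ker l t).
    by have := L1J (L2_L1 leb_I0_lty (L2_kerJM l1 L2_gm)); apply: eq_L1 => t _; rewrite conjM conjK.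
  have ik := L1_ker1 l1.
  have e1 : cint leb I0 (fun t => (gm t)^* * ker l t) = (ec l)^*.
    rewrite /ec -cintJ; first by apply: eq_cint => t _; rewrite conjM conjK.
    exact: L2_L1 (L2_kerJM l1 L2_gm).
  rewrite (eq_cint _ (G := fun t => ((gm t)^* * hquot h l t - (ec l)^* * hquot h l t)
       + (hext h l * ((gm t)^* * ker l t) - hext h l * (ec l)^* * ker l t))).
    have iz := L1Z (ec l)^* iq; have iz1 := L1Z (hext h l) igk; have iz2 := L1Z (hext h l * (ec l)^*) ik.
    have ib1 := L1B igq iz; have ib2 := L1B iz1 iz2.
    rewrite cintD// cintB// cintB// !cintZ// gm_orth// h0 e1 cauchy1//.
    by ring.
  move=> t _; rewrite !(conjB, conjM, conjK) DJ.
  have -> : ((g1 t)^* - (ec l)^* * (th t)^*) * ker l t * th t + ((g2 t)^* - (ec l)^* * De t) * ker l t * De t =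
     ((gm t)^* - (ec l)^* * (th t * (th t)^* + De t * De t)) * ker l t.
    by rewrite /gm !(conjD, conjM, conjK) DJ; ring.
  have -> : th t * (th t)^* + De t * De t = 1 by rewrite DD; ring.
  rewrite mulr1 -mulrA [ker l t * h t]mulrC hquotE; ring.
Qed.

Let cmk (c : CC) l : nm l < 1 -> L2 mu (fun t => c * (ker l t)^*).
Proof.
move=> l1; apply: L2Z; apply: (L2_bdd fmu (B := (1 - nm l)^-1)); first exact: cmeas_kerJ.
by move=> t _; exact: nm_kerJ_le.
Qed.

Lemma cint_kerJ_mu l : nm l < 1 -> cint mu I0 (fun t => (ker l t)^*) = (Rmu mu l)^*.
Proof.
move=> l1; have ik := L1_ker l1 (L1_cst fmu 1).
by rewrite /Rmu /cauchy -cintJ//; apply: eq_cint => t _; rewrite mul1r.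
Qed.

(** The factor [conj(l) xi] telescopes against the kernel by [kerJE]. *)
Lemma ip_kerJ_bb1 H l : nm l < 1 -> L2 mu H ->
  l^* * ip mu (fun t => H t * (ker l t)^*) bb1 = cint mu I0 (fun t => H t * (ker l t)^*) - cint mu I0 H.
Proof.
move=> l1 LH; have LK := L2_kerJM l1 LH.
have iH := L2_L1 fmu LH; have iK := L2_L1 fmu LK.
rewrite /ip -cintZ; last by exact: L2MJ LK L2_bb1.
rewrite -cintB//; apply: eq_cint => t _; rewrite /bb1 conjK.
have -> : l^* * (H t * (ker l t)^* * ee t) = H t * (l^* * ee t * (ker l t)^*) by ring.
by rewrite kerJE//; ring.
Qed.

(** [resolvent] leaves the scalar [C] undetermined; inserting the formula into its own inner product
    with [bb1] gives a linear equation for [C] whose coefficient is [conj(Q)]. *)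
Lemma Phi_kvec l : nm l < 1 -> l != 0 ->
  aeq mu (Phi (kvec l)) (fun t => kk%:C%C / (Qmu mu gam l)^* * (ker l t)^*).
Proof.
move=> l1 l0; have Kk := K_kvec l1; have z1 : nm 0 < 1 by rewrite nm0.
have k0 t : (ker 0 t)^* = 1 by rewrite /ker mul0r subr0 invr1 conj1.
have c1 t : l^* * ee t * (kvec l).1 t - (kvec l).1 t + (kvec 0).1 t = ((F l)^* - (F 0)^*) * th t.
  rewrite /kvec /= k0; have := kerJE t l1; set X := (ker l t)^* => hX.
  have -> : l^* * ee t * ((1 - (F l)^* * th t) * X) = (1 - (F l)^* * th t) * (l^* * ee t * X) by ring.
  by rewrite hX; ring.
have c2 t : l^* * ee t * (kvec l).2 t - (kvec l).2 t + (kvec 0).2 t = ((F l)^* - (F 0)^*) * De t.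
  rewrite /kvec /= k0; have := kerJE t l1; set X := (ker l t)^* => hX.
  have -> : l^* * ee t * (- (F l)^* * De t * X) = (- (F l)^* * De t) * (l^* * ee t * X) by ring.
  by rewrite hX; ring.
have := resolvent Kk (K_kvec z1) Phi_kvec0 l1 l0 c1 c2.
set C := kk%:C%C + _ => e.
have eb : l^* * ip mu (Phi (kvec l)) bb1 = C * ((Rmu mu l)^* - 1).
  have LC : L2 mu (fun=> C) by apply: (L2_bdd fmu (B := nm C)) => // [|t _]; exact: cmeas_cst.
  rewrite (ip_aeql (PhiL Kk) (cmk C l1) L2_bb1 e) (ip_kerJ_bb1 l1 LC).
  rewrite cintZ; last by have := L2_L1 fmu (cmk 1 l1); apply: eq_L1 => t _; rewrite mul1r.
  rewrite cint_kerJ_mu//.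
  have -> : cint mu I0 (fun=> C) = C.
    rewrite (eq_cint _ (G := fun=> C * 1)); last by move=> t _; rewrite mulr1.
    by rewrite cintZ ?cint_mu1 ?mulr1//; exact: L1_cst.
  by ring.
have Q0 := Qmu_neq0 hmu hgam l1.
have Qc0 : (Qmu mu gam l)^* != 0 by rewrite conjC_eq0.
have CE : C = kk%:C%C / (Qmu mu gam l)^*.
  apply: (canRL (mulfK Qc0)).
  have h : C = kk%:C%C + (gam - 1) * (C * ((Rmu mu l)^* - 1)).
    by rewrite -eb /C; ring.
  have -> : (Qmu mu gam l)^* = 1 - (gam - 1) * ((Rmu mu l)^* - 1).
    by rewrite /Qmu !(conjD, conjM, conjN, conj1, conjK); ring.
  by rewrite mulrBr mulr1 {1}h; ring.
by rewrite CE in e.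
Qed.

(** Both sides come from pairing [f] with the reproducing kernel: in [L^2(mu)] by [Phi_kvec], in the
    model space by evaluation at [l]. *)
Lemma clark_plus l : nm l < 1 -> l != 0 ->
  kk%:C%C * cauchy mu f l = Qmu mu gam l * cauchy leb g1 l.
Proof.
move=> l1 l0; have Kk := K_kvec l1.
have Q0 := Qmu_neq0 hmu hgam l1; have Qc0 : (Qmu mu gam l)^* != 0 by rewrite conjC_eq0.
have iF := L1_ker l1 (L2_L1 fmu hf).
have iG := L1_ker l1 (L2_L1 leb_I0_lty Lg1); have iM := L1_ker l1 (L2_L1 leb_I0_lty L2_gm).
have := adj Kk; rewrite (ip_aeql (PhiL Kk) (cmk _ l1) hf (Phi_kvec l1 l0)).
have -> : ip mu (fun t => kk%:C%C / (Qmu mu gam l)^* * (ker l t)^*) f =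
    kk%:C%C / (Qmu mu gam l)^* * (cauchy mu f l)^*.
  rewrite /cauchy -cintJ// -cintZ; last exact: L1J.
  by apply: eq_cint => t _; rewrite conjM; ring.
have [Lk1 Lk2] := K_L2 Kk.
have -> : pip (kvec l) (g1, g2) = (cauchy leb g1 l)^* - (F l)^* * (cauchy leb gm l)^*.
  rewrite /pip /ip -cintD; [|exact: L2MJ Lk1 Lg1|exact: L2MJ Lk2 Lg2].
  rewrite /cauchy -!cintJ// -cintZ; last exact: L1J.
  rewrite -cintB; [|exact: L1J|exact/L1Z/L1J].
  apply: eq_cint => t _; rewrite /= /gm !(conjD, conjM, conjK) DJ; ring.
rewrite cauchy_gm// conjC0 mulr0 subr0 => /(congr1 Num.conj).
rewrite !(conjM, conjV, conjK, conjR) => <-; by field.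
Qed.

(** Since [Phi] sends [c1g] to [bb1], this computes in the model space the scalar that [resolvent]
    leaves open for [vvec]. *)
Lemma vvec_c1g l : nm l < 1 -> l^* * pip (vvec l) (c1g mu gam) = (kk^-1)%:C%C * ec l.
Proof.
move=> l1; have [Lv1 Lv2] := K_L2 (K_vvec l1); have [Lc1 Lc2] := K_L2 K_c1g.
have LgK := L2_kerJM l1 L2_gm; have igK := L2_L1 leb_I0_lty LgK; have ig := L2_L1 leb_I0_lty L2_gm.
have iK : L1 leb (fun t => (ker l t)^*) by exact: L1J (L1_ker1 l1).
have hge := H2_kerJ l1 (H2_g1e (ec l)); have [Lge _] := hge.
have ige : L1 leb (fun t => (g1 t - ec l * th t) * (ker l t)^* * ee t ^+ 1) by apply: L1_eeX; exact: L2_L1.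
have /H2P[_ /(_ 0%N) z] := hge.
rewrite /pip /ip -cintD; [|exact: L2MJ Lv1 Lc1|exact: L2MJ Lv2 Lc2].
rewrite -cintZ; last exact: L1D (L2MJ Lv1 Lc1) (L2MJ Lv2 Lc2).
rewrite (eq_cint _ (G := fun t => (kk^-1)%:C%C * (((gm t * (ker l t)^* - ec l * (ker l t)^*) - (gm t - ec l))
   + l^* * gam^* * ((g1 t - ec l * th t) * (ker l t)^* * ee t ^+ 1)))).
  have iz := L1Z (ec l) iK; have ic := L1_cst leb_I0_lty (ec l).
  have b1 := L1B igK iz; have b2 := L1B ig ic; have b3 := L1B b1 b2; have b4 := L1Z (l^* * gam^*) ige.
  rewrite cintZ; last exact: L1D.
  rewrite cintD// cintB// cintB// cintB// !cintZ// z cint_kerJ1// cint_gm cint_leb_cst -/(ec l).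
  by ring.
move=> t _; rewrite /c1g /= -/F theta0E.
have -> : sqn (- gam) = sqn gam by rewrite -!nm_sqr nmN.
rewrite -/kk -/th -/De eeV expr1.
have hX := kerJE t l1; set X := (ker l t)^* in hX *.
have cJ : ((kk^-1)%:C%C)^* = (kk^-1)%:C%C by exact: conjR.
move: ((kk^-1)%:C%C) cJ => c cJ.
have -> : (c * ((ee t)^* * (th t - - gam)))^* = c * (ee t * ((th t)^* - - gam^*)).
  by rewrite !conjM conjB conjN conjK cJ.
have -> : (c * ((ee t)^* * De t))^* = c * (ee t * De t) by rewrite !conjM conjK cJ DJ.
have -> : l^* * ((g1 t - ec l * th t) * X * (c * (ee t * ((th t)^* - - gam^*))) + (g2 t - ec l * De t) * X * (c * (ee t * De t))) =
  c * ((gm t - ec l * (th t * (th t)^* + De t * De t)) * (l^* * ee t * X) + l^* * gam^* * ((g1 t - ec l * th t) * X * ee t)).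
  by rewrite /gm; ring.
have -> : th t * (th t)^* + De t * De t = 1 by rewrite DD; ring.
by rewrite hX; ring.
Qed.

(** The term [conj(l) * (gam - 1) * <Phi (vvec l), b_1>] of [resolvent], with the inner product
    evaluated by [vvec_c1g]. *)
Definition cc (l : CC) : CC := (gam - 1) * (kk^-1)%:C%C * ec l.

Lemma Phi_vvec l : nm l < 1 -> l != 0 ->
  aeq mu (Phi (vvec l)) (fun t => (f t + cc l) * (ker l t)^*) /\
  l^* * ip mu (Phi (vvec l)) bb1 = (kk^-1)%:C%C * ec l.
Proof.
move=> l1 l0; have Kv := K_vvec l1.
have c1 t : l^* * ee t * (vvec l).1 t - (vvec l).1 t + (g1, g2).1 t = ec l * th t.
  rewrite /vvec /=; have := kerJE t l1; set X := (ker l t)^* => hX.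
  have -> : l^* * ee t * ((g1 t - ec l * th t) * X) = (g1 t - ec l * th t) * (l^* * ee t * X) by ring.
  by rewrite hX; ring.
have c2 t : l^* * ee t * (vvec l).2 t - (vvec l).2 t + (g1, g2).2 t = ec l * De t.
  rewrite /vvec /=; have := kerJE t l1; set X := (ker l t)^* => hX.
  have -> : l^* * ee t * ((g2 t - ec l * De t) * X) = (g2 t - ec l * De t) * (l^* * ee t * X) by ring.
  by rewrite hX; ring.
have eb : l^* * ip mu (Phi (vvec l)) bb1 = (kk^-1)%:C%C * ec l.
  rewrite -(ip_aeqr (PhiL K_c1g) L2_bb1 (PhiL Kv) Phi_c1g).
  by rewrite Phi_polar ?vvec_c1g//; exact: K_c1g.
split => //; have := resolvent Kv Kg Phi_adj l1 l0 c1 c2.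
have -> : l^* * (gam - 1) * ip mu (Phi (vvec l)) bb1 = cc l by rewrite /cc -!mulrA -eb; ring.
by [].
Qed.

Let LfcK l : nm l < 1 -> L2 mu (fun t => f t + cc l).
Proof.
move=> l1; apply: L2D => //.
by apply: (L2_bdd fmu (B := nm (cc l))) => [|t _//]; exact: cmeas_cst.
Qed.

Let cint_fc l : cint mu I0 (fun t => f t + cc l) = cint mu I0 f + cc l.
Proof.
have i := L2_L1 fmu hf; have ic := L1_cst fmu (cc l).
rewrite cintD//; congr (_ + _).
rewrite (eq_cint _ (G := fun=> cc l * 1)); last by move=> t _; rewrite mulr1.
by rewrite cintZ ?cint_mu1 ?mulr1//; exact: L1_cst.
Qed.

(** The inner product of [Phi (vvec l)] with [bb1] is computed a second time, now in [L^2(mu)] from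
    the explicit form of [Phi (vvec l)], and compared with its value in the model space. *)
Lemma clark_minus l : nm l < 1 -> l != 0 ->
  kk%:C%C * (cint mu I0 (fun t => f t * (ker l t)^*) - cint mu I0 f) = (Qmu mu gam l)^* * ec l.
Proof.
move=> l1 l0; have [e eb] := Phi_vvec l1 l0; have Kv := K_vvec l1.
have LfK := L2_kerJM l1 (LfcK l1).
have ik := L2_L1 fmu (cmk (cc l) l1); have ifk := L2_L1 fmu (L2_kerJM l1 hf).
move: eb; rewrite (ip_aeql (PhiL Kv) LfK L2_bb1 e) (ip_kerJ_bb1 l1 (LfcK l1)) cint_fc.
have -> : cint mu I0 (fun t => (f t + cc l) * (ker l t)^*) =
   cint mu I0 (fun t => f t * (ker l t)^*) + cc l * (Rmu mu l)^*.
  rewrite -cint_kerJ_mu// -cintZ; last by have := L2_L1 fmu (cmk 1 l1); apply: eq_L1 => t _; rewrite mul1r.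
  by rewrite -cintD//; apply: eq_cint => t _; ring.
have -> : (Qmu mu gam l)^* = 1 - (gam - 1) * ((Rmu mu l)^* - 1).
  by rewrite /Qmu !(conjD, conjM, conjN, conj1, conjK); ring.
rewrite /cc realCV; move: (cint mu I0 _) (cint mu I0 f) (Rmu mu l)^* (ec l) => A B R E h.
have -> : A - B = (kk%:C%C)^-1 * E - (gam - 1) * (kk%:C%C)^-1 * E * (R - 1).
  by rewrite -h; ring.
by field.
Qed.

Lemma clark_poisson l : nm l < 1 -> l != 0 ->
  kk%:C%C * pint mu f l = Qmu mu gam l * cauchy leb g1 l + (Qmu mu gam l)^* * ec l.
Proof.
move=> l1 l0; have iF := L2_L1 fmu hf.
rewrite pintE// -addrA mulrDr clark_plus//; congr (_ + _).
rewrite -clark_minus//; congr (_ * (_ - _)).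
rewrite /cauchy -cintJ; last by apply: L1_ker => //; exact: L1J.
by apply: eq_cint => t _; rewrite conjM conjK.
Qed.

Definition hh (t : MR) : CC := (sqn (g1 t))%:C%C + (sqn (g2 t))%:C%C.

Lemma L1_sqn (nu : {measure set MR -> \bar RR}) G : L2 nu G -> L1 nu (fun t => (sqn (G t))%:C%C).
Proof. by move=> LG; have := L2MJ LG LG; apply: eq_L1 => t _; rewrite sqnE. Qed.

Lemma L1_hh : L1 leb hh.
Proof. by apply: L1D; exact: L1_sqn. Qed.

(** Pairing [Phi (vvec l)] with [f] itself, in both spaces, gives an identity between Cauchy
    integrals. Adding its conjugate and subtracting the equality [h0] of total energies, which is
    unitarity, produces Poisson integrals. *)
Lemma clark_energy l : nm l < 1 -> l != 0 ->
  pint leb hh l = pint mu (fun t => (sqn (f t))%:C%C) l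
    + ((cc l)^* * cauchy mu f l + ((cc l)^* * cauchy mu f l)^*).
Proof.
move=> l1 l0; have [e _] := Phi_vvec l1 l0; have Kv := K_vvec l1; have [Lv1 Lv2] := K_L2 Kv.
have LfK := L2_kerJM l1 (LfcK l1).
have i2 := L1_sqn hf; have ih := L1_hh; have iF := L1_ker l1 (L2_L1 fmu hf).
have iM := L1_ker l1 (L2_L1 leb_I0_lty L2_gm).
have i2K := L1_ker l1 i2; have ihK := L1_ker l1 ih.
have h1 : (cauchy leb hh l)^* - ec l * (cauchy leb gm l)^* =
    (cauchy mu (fun t => (sqn (f t))%:C%C) l)^* + cc l * (cauchy mu f l)^*.
  transitivity (pip (vvec l) (g1, g2)).
    rewrite /pip /ip -cintD; [|exact: L2MJ Lv1 Lg1|exact: L2MJ Lv2 Lg2].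
    rewrite /cauchy -!cintJ// -cintZ; last exact: L1J.
    rewrite -cintB; [|exact: L1J|exact/L1Z/L1J].
    apply: eq_cint => t _; rewrite /= /gm /hh !sqnE !(conjD, conjM, conjK) DJ; ring.
  rewrite -adj// (ip_aeql (PhiL Kv) LfK hf e) /ip /cauchy -!cintJ// -cintZ; last exact: L1J.
  rewrite -cintD; [|exact: L1J|exact/L1Z/L1J].
  by apply: eq_cint => t _; rewrite /= !sqnE !(conjD, conjM, conjK); ring.
rewrite cauchy_gm// conjC0 mulr0 subr0 in h1.
have h0 : cint leb I0 hh = cint mu I0 (fun t => (sqn (f t))%:C%C).
  transitivity (pip (g1, g2) (g1, g2)).
    rewrite /pip /ip -cintD; [|exact: L2MJ|exact: L2MJ].
    by apply: eq_cint => t _; rewrite /hh /= !sqnE.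
  have Lp := PhiL Kg.
  rewrite -Phi_iso// (ip_aeql Lp hf Lp Phi_adj) (ip_aeqr Lp hf hf Phi_adj).
  by apply: eq_cint => t _; rewrite sqnE.
have cr (nu : {measure set MR -> \bar RR}) (G : MR -> CC) : (forall t, (G t)^* = G t) ->
    cauchy nu (fun t => (G t)^*) l = cauchy nu G l.
  by move=> hG; apply: eq_cint => t _; rewrite hG.
rewrite !pintE// (cr leb hh) ?(cr mu (fun t => (sqn (f t))%:C%C)) ?h0; last 2 first.
- by move=> t; rewrite conjR.
- by move=> t; rewrite /hh conjD !conjR.
have h2 : cauchy leb hh l = cauchy mu (fun t => (sqn (f t))%:C%C) l + (cc l)^* * cauchy mu f l.
  by apply/eqP; rewrite -subr_eq0 -nm_eq0 -nmJ conjB h1 conjD conjM conjK subrr nm0.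
have -> : ((cc l)^* * cauchy mu f l)^* = cc l * (cauchy mu f l)^*.
  by move: (cc l) => C; rewrite conjM conjK.
by rewrite h1 h2; ring.
Qed.
End clark.

(** * Densities *)

Section density.
Variables nu k : {finite_measure set MR -> \bar RR}.
Hypothesis dom : forall A, measurable A -> k A = 0%E -> nu A = 0%E.

Let numu : nu `<< k. Proof. exact/null_content_dominatesP. Qed.
Let D := Radon_Nikodym_SigmaFinite.f nu k.

Definition dens (t : MR) : RR := fine (D t).

Lemma densE t : (dens t)%:E = D t.
Proof. by rewrite fineK//; exact: Radon_Nikodym_SigmaFinite.f_fin_num. Qed.

Lemma dens_ge0 t : 0 <= dens t.
Proof. by rewrite fine_ge0//; exact: Radon_Nikodym_SigmaFinite.f_ge0. Qed.

Lemma integrable_dens A : measurable A -> k.-integrable A (EFin \o dens).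
Proof.
move=> mA; have := Radon_Nikodym_SigmaFinite.f_integrable numu => h.
have h2 := integrableS measurableT mA (@subsetT _ A) h.
by apply: eq_integrable h2 => // t _; rewrite /= densE.
Qed.

Lemma measurable_dens : measurable_fun I0 dens.
Proof. by apply/measurable_EFinP; exact: measurable_int (integrable_dens mI0). Qed.

Lemma dens_integral A : measurable A -> nu A = (\int[k]_(t in A) (dens t)%:E)%E.
Proof.
move=> mA; rewrite (Radon_Nikodym_SigmaFinite.f_integral numu mA).
by apply: eq_integral => t _; rewrite densE.
Qed.

Lemma dens_change A (phi : MR -> RR) : measurable A -> measurable_fun A phi -> (forall t, 0 <= phi t) ->
  (\int[k]_(t in A) (phi t * dens t)%:E = \int[nu]_(t in A) (phi t)%:E)%E.
Proof.
move=> mA mphi p0; have mE : measurable_fun A (EFin \o phi) by exact/measurable_EFinP.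
have pE t : (0 <= (EFin \o phi) t)%E by rewrite lee_fin.
rewrite -(Radon_Nikodym_SigmaFinite.change_of_variables numu pE mA mE).
by apply: eq_integral => t _; rewrite EFinM densE.
Qed.

Let nonneg (phi : MR -> RR) : nu.-integrable I0 (EFin \o phi) -> (forall t, 0 <= phi t) ->
  k.-integrable I0 (EFin \o (fun t => phi t * dens t)) /\
  Rintegral k I0 (fun t => phi t * dens t) = Rintegral nu I0 phi.
Proof.
move=> ip p0; have /integrableP[mp fp] := ip; have mp' : measurable_fun I0 phi by exact/measurable_EFinP.
have e := dens_change mI0 mp' p0; split; last by rewrite /Rintegral e.
apply/integrableP; split.
  by apply/measurable_EFinP; apply: measurable_funM => //; exact: measurable_dens.
rewrite (eq_integral (fun t => (phi t * dens t)%:E)) ?e; last first.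
  by move=> t _; rewrite /= ger0_norm// mulr_ge0// dens_ge0.
by apply: le_lt_trans fp; apply: ge0_le_integral => //; [by move=> t _; rewrite lee_fin|exact: measurableT_comp|by move=> t _; rewrite /= lee_fin ler_norm].
Qed.

(** [h] is the difference of the nonnegative functions [|h| + h] and [|h|]. *)
Let signed (h : MR -> RR) : nu.-integrable I0 (EFin \o h) ->
  k.-integrable I0 (EFin \o (fun t => h t * dens t)) /\
  Rintegral k I0 (fun t => h t * dens t) = Rintegral nu I0 h.
Proof.
move=> ih; have ia : nu.-integrable I0 (EFin \o (fun t => `|h t|)) by exact: integrable_norm.
have i1 : nu.-integrable I0 (EFin \o (fun t => `|h t| + h t)) by exact: (integrableD mI0 ia ih).
have p1 t : 0 <= `|h t| + h t by have := ler_norm (- h t); rewrite normrN; lra.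
have [A1 A2] := nonneg i1 p1; have [B1 B2] := nonneg ia (fun t => normr_ge0 _).
have E : (fun t => h t * dens t) = (fun t => (`|h t| + h t) * dens t - `|h t| * dens t).
  by apply/funext => t; ring.
rewrite E; split; first exact: (integrableB mI0 A1 B1).
rewrite RintegralB// A2 B2 RintegralD//; lra.
Qed.

Lemma dens_L1 G : L1 nu G -> L1 k (fun t => G t * (dens t)%:C%C).
Proof.
move=> iG; have [cG _] := iG; split.
  by apply: cmeasM => //; apply: cmeas_real; exact: measurable_dens.
have [h _] := signed (L1_nm iG); apply: eq_integrable h => // t _.
by rewrite /= nmM nm_real (ger0_norm (dens_ge0 t)).
Qed.

Lemma dens_cint G : L1 nu G -> cint k I0 (fun t => G t * (dens t)%:C%C) = cint nu I0 G.
Proof.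
move=> iG; have [_ hR] := signed (L1_Re iG); have [_ hI] := signed (L1_Im iG).
apply: CCext; rewrite ?Re_cint ?Im_cint -?hR -?hI; apply: eq_Rintegral => t _.
  by move: (G t) => [a b] /=; ring.
by move: (G t) => [a b] /=; ring.
Qed.

Lemma dens_pint G z : nm z < 1 -> L1 nu G -> pint k (fun t => G t * (dens t)%:C%C) z = pint nu G z.
Proof.
move=> z1 iG; rewrite /pint -(dens_cint (L1_pk z1 iG)).
by apply: eq_cint => t _; ring.
Qed.
End density.

Section sum_measure.
Variables m1 m2 : {finite_measure set MR -> \bar RR}.

Let M : {measure set MR -> \bar RR} := measure_add m1 m2.

(** A name of its own, to which the structure of a finite measure can be attached. *)
Definition msum2 (A : set MR) : \bar RR := M A.

HB.instance Definition _ := isMeasure.Build _ _ _ msum2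
  (measure0 M) (measure_ge0 M) (@measure_semi_sigma_additive _ _ _ M).

Let sum_fin : fin_num_fun msum2.
Proof.
move=> A mA; rewrite (_ : msum2 A = m1 A + m2 A)%E; first by rewrite fin_numD !fin_num_measure.
exact: measure_addE.
Qed.

HB.instance Definition _ := @Measure_isFinite.Build _ _ _ msum2 sum_fin.

Definition sum_measure : {finite_measure set MR -> \bar RR} := msum2.

Lemma sum_measureE A : sum_measure A = (m1 A + m2 A)%E.
Proof. exact: measure_addE. Qed.

Lemma sum_dom1 A : measurable A -> sum_measure A = 0%E -> m1 A = 0%E.
Proof.
move=> mA; rewrite sum_measureE => h; apply/eqP; rewrite eq_le measure_ge0 andbT -h.
by rewrite leeDl// measure_ge0.
Qed.

Lemma sum_dom2 A : measurable A -> sum_measure A = 0%E -> m2 A = 0%E.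
Proof.
move=> mA; rewrite sum_measureE => h; apply/eqP; rewrite eq_le measure_ge0 andbT -h.
by rewrite leeDr// measure_ge0.
Qed.
End sum_measure.

Lemma ae_dom (nu k : {measure set MR -> \bar RR}) (P : MR -> Prop) :
  (forall A, measurable A -> k A = 0%E -> nu A = 0%E) -> {ae k, forall x, P x} -> {ae nu, forall x, P x}.
Proof. by move=> dom [N [mN N0 HN]]; exists N; split => //; exact: dom. Qed.

Lemma leb_sub0 (A B : set MR) : measurable A -> measurable B -> A `<=` B -> leb B = 0%E -> leb A = 0%E.
Proof.
move=> mA mB AB B0; apply/eqP; rewrite eq_le (measure_ge0 (@lebesgue_measure RR)) andbT -B0.
by apply: (le_measure (@lebesgue_measure RR)); rewrite ?inE.
Qed.

(** * Nontangential quotients relative to mu + m and the Lebesgue decomposition *)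

Section decomposition.
Variable mu : probability MR RR.
Hypothesis hmu : mu I0 = 1%E.
Variable S : set RR.
Hypothesis mS : measurable (S : set MR).
Hypothesis SI : S `<=` I0.
Hypothesis S0 : leb S = 0%E.
Variable w : RR -> RR.
Hypothesis mw : measurable_fun I0 (w : MR -> RR).
Hypothesis w0 : forall x, 0 <= w x.
Hypothesis hw : forall A, measurable A -> A `<=` I0 -> mu (A `\` S) = (\int[leb]_(x in A) (w x)%:E)%E.

Definition kapm := sum_measure mu lebI.

(** Densities of [mu] and [m] with respect to their sum: almost everywhere [r1 + r0 = 1], with
    [r0 = 0] on [S] and [r1 = w * r0] off [S]. Dividing by P[kapm] thus treats the singular and the
    absolutely continuous part alike. *)
Let r1 := dens mu kapm.
Let r0 := dens lebI kapm.
Let dom1 := @sum_dom1 mu lebI.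
Let dom0 := @sum_dom2 mu lebI.

Lemma kapmI : kapm (~` I0) = 0%E.
Proof.
have h1 : mu (~` I0) = 0%E by rewrite probability_setC// hmu subee.
have h2 : lebI (~` I0) = 0%E by rewrite lebIE setICl; exact: (measure0 (@lebesgue_measure RR)).
by apply: (eq_trans (sum_measureE mu lebI _)); rewrite h2 adde0.
Qed.

Lemma leb_le_kapm (phi : MR -> RR) : measurable_fun I0 phi -> (forall t, 0 <= phi t) ->
  (\int[leb]_(t in I0) (phi t)%:E <= \int[kapm]_(t in I0) (phi t)%:E)%E.
Proof.
move=> mp p0; have mE : measurable_fun I0 (EFin \o phi) by exact/measurable_EFinP.
rewrite [leRHS](ge0_integral_measure_add mu lebI mI0)//; last by move=> t _; rewrite lee_fin.
by rewrite integral_lebI leeDr//; apply: integral_ge0 => t _; rewrite lee_fin.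
Qed.

Lemma dens_ae_eq (A : set MR) (p q : MR -> RR) : measurable A ->
  kapm.-integrable A (EFin \o p) -> measurable_fun A q ->
  (forall E, E `<=` A -> measurable E -> (\int[kapm]_(t in E) (p t)%:E = \int[kapm]_(t in E) (q t)%:E)%E) ->
  {ae kapm, forall x, A x -> p x = q x}.
Proof.
move=> mA ip mq H; have mq' : measurable_fun A (EFin \o q) by exact/measurable_EFinP.
have := integral_ae_eq mA ip mq' H; apply: ae_mono => x h Ax.
by have [] := h Ax.
Qed.

Lemma r0_S : {ae kapm, forall x, S x -> r0 x = 0}.
Proof.
apply: (dens_ae_eq mS (integrable_dens dom0 mS)) => [|E ES mE]; first exact: measurable_cst.
rewrite integral0 -(dens_integral dom0 mE) lebIE.
apply: (leb_sub0 _ mS _ S0); first exact: measurableI.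
by move=> t [Et _]; exact: ES.
Qed.

Lemma r_sum : {ae kapm, forall x, I0 x -> r1 x = 1 - r0 x}.
Proof.
apply: (dens_ae_eq mI0 (integrable_dens dom1 mI0)) => [|E EI mE].
  by apply: measurable_funB => //; exact: (measurable_dens dom0).
rewrite -(dens_integral dom1 mE).
have i0 := integrable_dens dom0 mE.
have i1 : kapm.-integrable E (EFin \o (fun=> 1 : RR)) by exact: finite_measure_integrable_cst.
have -> : (\int[kapm]_(t in E) (1 - r0 t)%:E = \int[kapm]_(t in E) ((1 : RR)%:E - (r0 t)%:E))%E.
  by apply: eq_integral => t _; rewrite EFinB.
rewrite (integralB mE i1 i0) -(dens_integral dom0 mE) integral_cst// mul1e.
have h : kapm E = (mu E + lebI E)%E by exact: sum_measureE.
apply: esym; apply: (@eq_trans _ _ ((mu E + lebI E) - lebI E)%E).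
  by apply: (f_equal (fun y => y - lebI E)%E); exact: h.
by rewrite addeK// fin_num_measure.
Qed.

Lemma r1_w : {ae kapm, forall x, (I0 `\` S) x -> r1 x = w x * r0 x}.
Proof.
have mIS : measurable (I0 `\` S : set MR) by exact: measurableD.
have mwE (E : set MR) : E `<=` I0 -> measurable E -> measurable_fun E (w : MR -> RR).
  by move=> EI mE; apply: measurable_funS mw.
apply: (dens_ae_eq mIS (integrable_dens dom1 mIS)) => [|E EIS mE].
  apply: measurable_funM; first by apply: mwE => // t [].
  by have := integrable_dens dom0 mIS => /(@measurable_int _ _ _ _ _) /measurable_EFinP.
have EI : E `<=` I0 by move=> t /EIS[].
rewrite -(dens_integral dom1 mE) (dens_change dom0 mE (mwE E EI mE) w0).
have -> : (\int[lebI]_(x in E) (w x)%:E = \int[leb]_(x in E) (w x)%:E)%E.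
  by apply: eq_measure_integral => A mA AE; apply: (eq_trans (lebIE A)); congr (leb _); apply/setIidPl => t /AE /EI.
rewrite -hw//; congr (mu _); apply/esym/setDidPl; apply/seteqP; split=> t // -[Et St].
by have [] := EIS t Et.
Qed.

Lemma r0_neq0 : {ae leb, forall x, I0 x -> r0 x != 0}.
Proof.
pose A : set MR := I0 `&` r0 @^-1` [set 0].
have mA : measurable A by exact: (measurable_dens dom0) mI0 _ (measurable_set1 (0 : RR)).
exists A; split => //.
  have : lebI A = 0%E.
    by rewrite (dens_integral dom0 mA) integral0_eq// => t [_ /= h]; exact: (congr1 EFin h).
  by rewrite lebIE (_ : A `&` I0 = A)//; apply/setIidPl => t [].
move=> x /= nx; have [Ix|nI] := pselect (I0 x); last by exfalso; apply: nx => /nI.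
split => //=; apply/eqP; rewrite -[_ == _]negbK; apply/negP => h; exact: nx.
Qed.

Lemma kapm_leb (P : MR -> Prop) : {ae kapm, forall x, I0 x -> P x} -> {ae leb, forall x, I0 x -> P x}.
Proof. by move=> h; apply: ae_lebI; exact: ae_dom dom0 h. Qed.

Lemma L1_lebI G : L1 leb G -> L1 lebI G.
Proof. by move=> [cG iG]; split => //; exact: integrable_lebI. Qed.

Definition Pkap z : CC := (Rintegral kapm I0 (pk z))%:C%C.

Lemma nt_mu G : L1 mu G -> {ae kapm, forall x, I0 x -> forall al,
  (fun z => pint mu G z / Pkap z) @ ntf x al --> G x * (r1 x)%:C%C}.
Proof.
move=> iG; have := nt_pint kapmI leb_le_kapm (dens_L1 dom1 iG).
apply: ae_mono => x h Ix al; apply: (cvgC_near _ _ (h Ix al)).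
by apply: filterS (ntf_disc x al) => z z1; rewrite dens_pint.
Qed.

Lemma nt_leb G : L1 leb G -> {ae kapm, forall x, I0 x -> forall al,
  (fun z => pint leb G z / Pkap z) @ ntf x al --> G x * (r0 x)%:C%C}.
Proof.
move=> /L1_lebI iG; have := nt_pint kapmI leb_le_kapm (dens_L1 dom0 iG).
apply: ae_mono => x h Ix al; apply: (cvgC_near _ _ (h Ix al)).
by apply: filterS (ntf_disc x al) => z z1; rewrite dens_pint// /pint cint_lebI.
Qed.

Lemma pint_leb1 z : nm z < 1 -> pint leb (fun=> 1) z = 1.
Proof.
move=> z1; have -> : pint leb (fun=> 1) z = cint leb I0 (fun t => (pk z t)%:C%C).
  by apply: eq_cint => t _; rewrite mulr1.
by rewrite cint_real Rintegral_pk_leb.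
Qed.

Lemma pint_mu1 z : pint mu (fun=> 1) z = (Pmu mu z)%:C%C.
Proof. by rewrite -cint_real; apply: eq_cint => t _; rewrite mulr1. Qed.

Lemma nt_singular : {ae mu, forall x, S x -> r1 x = 1 /\ r0 x = 0}.
Proof.
apply: (ae_dom dom1); apply: ae_mono (ae_and r0_S r_sum) => x [h0 h1] Sx.
by rewrite h1 ?h0 ?subr0//; exact: SI.
Qed.

Lemma nt_absolute : {ae leb, forall x, I0 x -> r1 x = w x * r0 x /\ r0 x != 0}.
Proof.
have h : {ae leb, forall x, I0 x -> ~ S x}.
  exists S; split => //; move=> x /= nx; apply: contrapT => nS; exact: nx.
have r1w : {ae kapm, forall x, I0 x -> ~ S x -> r1 x = w x * r0 x}.
  by apply: ae_mono r1_w => x hx Ix nS; exact: hx.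
apply: ae_mono (ae_and (kapm_leb r1w) (ae_and r0_neq0 h)) => x [a [b c]] Ix.
by split; [apply: a => //; exact: c|exact: b].
Qed.
End decomposition.

Lemma Re_cint_set (nu : {measure set MR -> \bar RR}) (A : set MR) F : ReC (cint nu A F) = Rintegral nu A (fun t => ReC (F t)).
Proof. by rewrite /cint /= mul0r mulr0 subr0 addr0. Qed.

Lemma Im_cint_set (nu : {measure set MR -> \bar RR}) (A : set MR) F : ImC (cint nu A F) = Rintegral nu A (fun t => ImC (F t)).
Proof. by rewrite /cint /= mul0r mul1r !add0r. Qed.

(** For identifying [f_s] and [f_a], given only through integrals over sets, with [f] on [S] and off
    [S]. *)
Lemma cint_ae_eq (nu : {measure set MR -> \bar RR}) (A : set MR) (F G : MR -> CC) : measurable A -> A `<=` I0 ->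
  L1 nu F -> (forall E, measurable E -> E `<=` A ->
   [/\ nu.-integrable E (fun x => (ReC (G x))%:E), nu.-integrable E (fun x => (ImC (G x))%:E) &
       cint nu E G = cint nu E F]) ->
  {ae nu, forall x, A x -> G x = F x}.
Proof.
move=> mA AI iF H.
have key (p q : MR -> RR) : nu.-integrable I0 (EFin \o q) ->
   (forall E, measurable E -> E `<=` A -> nu.-integrable E (EFin \o p) /\ Rintegral nu E p = Rintegral nu E q) ->
   {ae nu, forall x, A x -> p x = q x}.
  move=> iq h; have [ip _] := h A mA (@subset_refl _ A).
  have iqA := integrableS mI0 mA AI iq.
  have HE E : E `<=` A -> measurable E -> (\int[nu]_(x in E) (EFin \o p) x = \int[nu]_(x in E) (EFin \o q) x)%E.
    move=> EA mE; have [ipE e] := h E mE EA; have iqE := integrableS mA mE EA iqA.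
    by move: e; rewrite /Rintegral => e; rewrite -[LHS]fineK ?integrable_fin_num// -[RHS]fineK ?integrable_fin_num// e.
  have := integral_ae_eq mA ip (measurable_int _ iqA) HE; apply: ae_mono => x hx Ax.
  by have [] := hx Ax.
have hR := key (fun t => ReC (G t)) (fun t => ReC (F t)) (L1_Re iF) _.
have hI := key (fun t => ImC (G t)) (fun t => ImC (F t)) (L1_Im iF) _.
apply: ae_mono (ae_and (hR _) (hI _)) => [x [a b] Ax|E mE EA|E mE EA].
- by apply: CCext; [exact: a|exact: b].
- by have [iR _ e] := H E mE EA; split => //; rewrite -!Re_cint_set e.
- by have [_ iI e] := H E mE EA; split => //; rewrite -!Im_cint_set e.
Qed.

(* The functions [1 / (1 + e R)], bounded by 1, vanish where [theta_0 = 1] on the boundary; the mean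
   value property then forces this set to be null as [e] tends to 0. *)
Section theta0_boundary.
Variable mu : {measure set MR -> \bar RR}.
Hypothesis hmu : mu I0 = 1%E.

Let z01 : nm 0 < 1. Proof. by rewrite nm0. Qed.
Let T := theta mu 0.
Let R := Rmu mu.

Lemma theta0_Rmu l : nm l < 1 -> R l != 0 /\ 1 - T l = (R l)^-1.
Proof.
move=> l1; have Q0 := Qmu_neq0 hmu z01 l1.
have QE : Qmu mu 0 l = R l by rewrite /Qmu conjC0 subr0 mul1r addr0.
rewrite QE in Q0; split => //; rewrite /T thetaE// QE subr0 mul1r -/R.
by field.
Qed.

Let Ge (e : RR) (l : CC) : CC := (1 + e%:C%C * R l)^-1.

Let Re_den (e : RR) l : 0 < e -> nm l < 1 -> 1 <= ReC (1 + e%:C%C * R l).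
Proof.
move=> e0 l1; rewrite ReD ReM ReR ImR mul0r subr0.
by rewrite lerDl mulr_ge0 ?(ltW e0)//; have := Re_Rmu hmu l1; have := Pmu_gt0 hmu l1; rewrite -/R; lra.
Qed.

Let dG e : 0 < e -> discA (Ge e).
Proof.
move=> e0; apply: (discAV (d := 1)) => // [l l1|]; first exact: Re_den.
apply: discAD; first exact: discA_cst.
by apply: discAM; [exact: discA_cst|exact: discA_Rmu].
Qed.

Let Ge1 e l : 0 < e -> nm l < 1 -> nm (Ge e l) <= 1.
Proof.
move=> e0 l1; have h := Re_den e0 l1; have h2 := le_trans h (le_trans (ler_norm _) (Re_le_nm _)).
by rewrite /Ge nmV invf_le1// (lt_le_trans ltr01).
Qed.

(** Written through theta_0, the function has a computable boundary limit also where [R] tends to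
    infinity. *)
Let GeE e l : 0 < e -> nm l < 1 -> Ge e l = (1 - T l) / (1 - T l + e%:C%C).
Proof.
move=> e0 l1; have [R0 hT] := theta0_Rmu l1.
have d0 : 1 + e%:C%C * R l != 0.
  by rewrite -nm_gt0; apply: lt_le_trans (Re_le_nm _); rewrite (lt_le_trans _ (ler_norm _))// (lt_le_trans _ (Re_den e0 l1)).
rewrite hT /Ge.
have -> : (R l)^-1 + e%:C%C = (1 + e%:C%C * R l) / R l by field.
by field; rewrite R0 d0.
Qed.

Lemma thetab0_neq1 : {ae leb, forall x, I0 x -> 1 - thetab mu 0 x != 0}.
Proof.
pose E : set MR := I0 `&` [set x | thetab mu 0 x = 1].
have cT := cmeas_thetab hmu z01.
have mE : measurable E.
  have -> : E = (I0 `&` (fun t => ReC (thetab mu 0 t)) @^-1` [set 1]) `&`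
                (I0 `&` (fun t => ImC (thetab mu 0 t)) @^-1` [set 0]).
    apply/seteqP; split=> t /=; first by move=> [It ->].
    by move=> [[It a] [_ b]]; split => //=; apply: CCext; rewrite ?a ?b.
  by apply: measurableI; [exact: cT.1 mI0 _ (measurable_set1 (1 : RR))|exact: cT.2 mI0 _ (measurable_set1 (0 : RR))].
have aeE e : 0 < e -> {ae leb, forall t, I0 t -> E t -> bval (Ge e) t = 0}.
  move=> e0; have f1 := fatou (discA_theta hmu z01) (nm_theta hmu z01).
  apply: ae_mono f1 => t h It [_ Et].
  have {}h := h It 0; rewrite -/(thetab mu 0 t) Et in h.
  have eC : e%:C%C != 0 :> CC by rewrite -nm_eq0 nm_real normr_eq0 gt_eqF.
  have lim : Ge e @ ntf t 0 --> ((1 - 1) / (1 - 1 + e%:C%C) : CC).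
    apply: (cvgC_near _ (f := fun l => (1 - T l) / (1 - T l + e%:C%C))).
      by apply: filterS (ntf_disc t 0) => l l1; rewrite GeE.
    have d1 : (fun l => 1 - T l) @ ntf t 0 --> (1 - 1 : CC) by apply: cvgCB; [exact: cvgC_cst|exact: h].
    apply: cvgCM; first exact: d1.
    apply: cvgCV; first by rewrite subrr add0r.
    by apply: cvgCD; [exact: d1|exact: cvgC_cst].
  by rewrite (bval_eq (radial_cvg lim)) subrr mul0r.
(* The mean of [bval (Ge e)] is [1 / (1 + e)], while the function has modulus at most 1 and vanishes
   almost everywhere on [E]: hence [1 / (1 + e) <= 1 - m(E)]. *)
have leE e : 0 < e -> fine (leb E) <= e.
  move=> e0; have G1 := fun l l1 => @Ge1 e l e0 l1.
  have cB := cmeas_bval (dG e0).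
  have i1 : leb.-integrable I0 (EFin \o (fun=> 1 : RR)) by exact: integrable_cstI0.
  have mi : measurable_fun I0 (\1_E : MR -> RR) by exact: measurable_indic.
  have iE : leb.-integrable I0 (EFin \o (\1_E : MR -> RR)).
    apply: (le_integrable mI0 _ _ i1); first exact/measurable_EFinP.
    by move=> t _; rewrite /= lee_fin normr1 indicE; case: (_ \in _); rewrite ?normr1 ?normr0.
  have hG := cint_bvalM (dG e0) G1 H2_1.
  rewrite cint_leb_cst mulr1 in hG.
  have G0 : Ge e 0 = ((1 + e)^-1)%:C%C by rewrite /Ge /R Rmu0// mulr1 -realC1 -realCD -realCV.
  have iB : L1 leb (fun t => bval (Ge e) t * 1) by apply: L1_bvalM => //; [exact: dG|exact: L1_cst].
  have e1 : 0 < 1 + e by rewrite addr_gt0.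
  have : (1 + e)^-1 <= Rintegral leb I0 (fun t => nm (bval (Ge e) t * 1)).
    apply: le_trans (nm_cint_le iB); rewrite hG G0 nm_real ger0_norm//.
    by rewrite invr_ge0 ltW.
  have -> : Rintegral leb I0 (fun t => nm (bval (Ge e) t * 1)) =
            Rintegral leb I0 (fun t => nm (bval (Ge e) t * 1) * (1 - \1_E t)).
    rewrite /Rintegral; congr fine; apply: ae_eq_integral => //.
    - by apply/measurable_EFinP; apply: cmeas_nm; case: iB.
    - apply/measurable_EFinP; apply: measurable_funM; first by apply: cmeas_nm; case: iB.
      exact: (measurable_funB (measurable_cst _) mi).
    - apply: ae_mono (aeE e e0) => t h It; rewrite indicE; have [tE|tE] := boolP (t \in E).
        by rewrite (h It (set_mem tE)) mul0r nm0 mul0r.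
      by rewrite subr0 !mulr1.
  have iM : leb.-integrable I0 (EFin \o (fun t => nm (bval (Ge e) t * 1) * (1 - \1_E t))).
    have iB' := integrableB mI0 i1 iE.
    apply: (le_integrable mI0 _ _ iB').
      apply/measurable_EFinP; apply: measurable_funM; first by apply: cmeas_nm; case: iB.
      exact: (measurable_funB (measurable_cst _) mi).
    move=> t _; rewrite /= lee_fin normrM ler_piMl// ger0_norm ?nm_ge0// mulr1.
    by apply: nm_bval_le; exact: G1.
  have : Rintegral leb I0 (fun t => nm (bval (Ge e) t * 1) * (1 - \1_E t)) <= 1 - fine (leb E).
    have -> : 1 - fine (leb E) = Rintegral leb I0 (fun t => 1 - \1_E t).
      rewrite (RintegralB mI0 i1 iE) Rintegral_leb_cst; congr (_ - _).
      rewrite /Rintegral integral_indic// (_ : E `&` I0 = E)//.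
      by apply/setIidPl => t [].
    apply: le_Rintegral => //; first exact: (integrableB mI0 i1 iE).
    move=> t _; rewrite mulr1 ler_piMl ?nm_bval_le//.
  move=> h1 h2; have := le_trans h2 h1; move: (fine (leb E)) => x hx.
  have q : (1 + e)^-1 * (1 + e) = 1 by rewrite mulVf// gt_eqF.
  by move: hx q e1 e0; move: ((1 + e)^-1) => y; nra.
exists E; split => //.
  have fE : leb E \is a fin_num.
    rewrite ge0_fin_numE; last exact: (measure_ge0 (@lebesgue_measure RR)).
    apply: (@le_lt_trans _ _ (leb I0)) => //; apply: le_measure; rewrite ?inE//.
    by move=> t [].
  rewrite -[LHS]fineK//; congr EFin; apply/eqP; rewrite eq_le fine_ge0 ?andbT; last exact: (measure_ge0 (@lebesgue_measure RR)).
  by apply/ler_addgt0Pr => e e0; rewrite add0r leE.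
move=> x /= nx; have [Ix|nI] := pselect (I0 x); last by exfalso; apply: nx => /nI.
split => //=; apply: contrapT => h; apply: nx => _; rewrite subr_eq0 eq_sym.
exact/eqP.
Qed.
End theta0_boundary.

(** * Boundary limits of the disc identities *)

Lemma cvgC_sqr0 (T : Type) (f : set_system T) (FF : ProperFilter f) (g : T -> CC) :
  (fun t => g t * (g t)^*) @ f --> (0 : CC) -> g @ f --> (0 : CC).
Proof.
move=> /cvgCP/cvgr0Pnorm_lt h; apply/cvgCP/cvgr0Pnorm_lt => e e0.
have e2 : 0 < e ^+ 2 by rewrite exprn_gt0.
apply: filterS (h _ e2) => t /=; rewrite !subr0 !ger0_norm ?nm_ge0// nmM nmJ -expr2.
by rewrite ltr_sqr ?nnegrE ?nm_ge0// ltW.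
Qed.

Section main.
Variable mu : probability MR RR.
Hypothesis hmu : mu I0 = 1%E.
Variable gam : CC.
Hypothesis hgam : nm gam < 1.
Variable Phi : (MR -> CC) * (MR -> CC) -> (MR -> CC).
Hypothesis hPhi : IsClark mu gam Phi.
Variable f : MR -> CC.
Hypothesis hf : L2 mu f.
Variables g1 g2 : MR -> CC.
Hypothesis Kg : Kmodel (thetab mu gam) (Deltab mu gam) (g1, g2).
Hypothesis adj : forall v, Kmodel (thetab mu gam) (Deltab mu gam) v -> ip mu (Phi v) f = pip v (g1, g2).

Let fmu : (mu I0 < +oo)%E. Proof. by rewrite hmu ltry. Qed.
Let kk : CC := (Num.sqrt (1 - sqn gam))%:C%C.
Let Q := Qmu mu gam.
Let N := Nmu mu gam.
Let e := ec mu gam g1 g2.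

Let kk0 : kk != 0.
Proof. by rewrite -nm_eq0 nm_real normr_eq0 gt_eqF// sqrtr_gt0 sqng. Qed.

Let gJ0 : 1 - gam^* != 0. Proof. by apply: one_sub_neq0; rewrite nmJ. Qed.

Let Q_N l : Q l = (1 - gam^*) * N l.
Proof. by rewrite /N /Nmu /Q mulrC divfK. Qed.

Let T (z : CC) : CC := (Pmu mu z)%:C%C + (kap gam)%:C%C.

Let T_N z : nm z < 1 -> T z = N z + (N z)^*.
Proof. by move=> z1; rewrite addCJ (Re_Nmu hmu hgam z1) realCD. Qed.

Definition clarkG (z : CC) : CC := (1 - gam^*) / kk * cauchy leb g1 z.

(** With [E' = (1 - gamma) P[g_- m] / k] the identities read [P[f mu] = N G + conj(N) E'] and
    [T = N + conj(N)], so [T G - P[f mu] = conj(N) (G - E')]. By [clark_plus] the energy difference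
    is [2 Re (conj(E') N G)], and expanding [|N|^2 |G - E'|^2] gives the right-hand side. *)
Lemma clark_square z : nm z < 1 -> z != 0 ->
  (T z * clarkG z - pint mu f z) * (T z * clarkG z - pint mu f z)^* =
  pint mu f z * (pint mu f z)^* - T z * (pint mu (fun t => (sqn (f t))%:C%C) z - pint leb (hh g1 g2) z).
Proof.
move=> z1 z0.
have hP := clark_poisson hmu hgam hPhi hf Kg adj z1 z0.
have hE := clark_energy hmu hgam hPhi hf Kg adj z1 z0.
have hR := clark_plus hmu hgam hPhi hf Kg adj z1 z0.
rewrite -/kk -/Q -/e in hP; rewrite -/kk -/Q in hR.
pose E' := (1 - gam) / kk * e z.
have ccE : cc mu gam g1 g2 z = - E'.
  by rewrite /cc /E' realCV -/kk -/e; ring.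
have GE : cauchy mu f z = N z * clarkG z.
  by apply: (mulfI kk0); rewrite hR Q_N /clarkG; field.
have AE : pint mu f z = N z * clarkG z + (N z)^* * E'.
  apply: (mulfI kk0); rewrite hP Q_N conjM conjB conj1 conjK /clarkG /E'; field.
  exact: kk0.
rewrite hE ccE GE AE T_N//; clear ccE AE GE hP hE hR.
move: (N z) (clarkG z) E' (pint mu _ z) => n G E B.
by rewrite !(conjD, conjM, conjN, conjK); ring.
Qed.

Lemma cauchy_pint_H2 h z : nm z < 1 -> H2 h -> pint leb h z = cauchy leb h z.
Proof.
move=> z1 hH; have iH := L2_L1 leb_I0_lty hH.1.
rewrite pintE//; suff -> : (cauchy leb (fun t => (h t)^*) z)^* = cint leb I0 h by rewrite addrK.
have iK := L1_kerJ z1 iH; have hK := H2_kerJ z1 hH; have /H2P[_ /(_ 0%N) z0] := hK.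
rewrite /cauchy -cintJ; last by apply: L1_ker => //; exact: L1J.
rewrite (eq_cint _ (G := fun t => h t + z^* * (h t * (ker z t)^* * ee t ^+ 1))).
  rewrite cintD ?cintZ ?z0 ?mulr0 ?addr0//; first exact: L1_eeX.
  by apply: L1Z; exact: L1_eeX.
move=> t _; rewrite conjM conjK expr1.
have -> : z^* * (h t * (ker z t)^* * ee t) = h t * (z^* * ee t * (ker z t)^*) by ring.
by rewrite kerJE//; ring.
Qed.

Lemma ec_pint z : nm z < 1 -> pint leb (gm mu gam g1 g2) z = e z.
Proof.
move=> z1; have [Lg1 Lg2] := K_L2 Kg.
have Lgm : L2 leb (gm mu gam g1 g2).
  apply: L2D.
    apply: (L2_mulb (B := 1)) => // [|t]; first by apply: cmeasJ; exact: cmeas_thetab.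
    by rewrite nmJ thetab_le.
  by apply: (L2_mulb (B := 1)) => // [|t]; [exact: cmeas_Deltab|exact: Deltab_le].
have iG := L2_L1 leb_I0_lty Lgm.
rewrite pintE// (cauchy_gm hmu hgam Kg z1) (cint_gm hmu hgam Kg) add0r subr0.
rewrite /cauchy -cintJ; last by apply: L1_ker => //; exact: L1J.
by apply: eq_cint => t _; rewrite conjM conjK.
Qed.

Variable S : set RR.
Hypothesis mS : measurable (S : set MR).
Hypothesis SI : S `<=` I0.
Hypothesis S0 : leb S = 0%E.
Variable w : RR -> RR.
Hypothesis mw : measurable_fun I0 (w : MR -> RR).
Hypothesis w0 : forall x, 0 <= w x.
Hypothesis hw : forall A, measurable A -> A `<=` I0 -> mu (A `\` S) = (\int[leb]_(x in A) (w x)%:E)%E.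

Let dom1 := @sum_dom1 mu lebI.

(** The disc identities rest on [resolvent] and are stated for [z != 0]; points close to the circle
    satisfy this. *)
Let ntf_neq0 x al : \forall z \near ntf x al, z != 0.
Proof.
exists (1 : RR) => // z z1 zx _; apply: contraTneq zx => ->.
by rewrite subr0 nm_ee ltxx.
Qed.

Let Pkap_neq0 z : nm z < 1 -> Pkap mu z != 0.
Proof.
move=> z1; rewrite /Pkap -nm_eq0 nm_real normr_eq0 gt_eqF//.
have fk : (kapm mu I0 < +oo)%E by rewrite ltey_eq fin_num_measure.
apply: (@lt_le_trans _ _ (Rintegral leb I0 (pk z))); first by rewrite Rintegral_pk_leb.
rewrite -lee_fin /Rintegral !fineK ?integrable_fin_num//; try exact: integrable_pk.
by apply: leb_le_kapm => [|t]; [exact: measurable_pk|rewrite ltW// pk_gt0].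
Qed.

Let PkapJ z : (Pkap mu z)^* = Pkap mu z. Proof. exact: conjR. Qed.

Theorem clark_singular : {ae mu, forall x, S x -> forall al, clarkG @ ntf x al --> f x}.
Proof.
have i1 := L1_cst fmu 1; have iF := L2_L1 fmu hf; have i2 := L1_sqn hf.
have [Lg1 Lg2] := K_L2 Kg; have ih : L1 leb (hh g1 g2) by apply: L1D; exact: L1_sqn.
have j1 := L1_cst leb_I0_lty 1.
have toS (P : MR -> Prop) : {ae kapm mu, forall x, I0 x -> P x} -> {ae mu, forall x, S x -> P x}.
  by move=> h; apply: (ae_dom dom1); apply: ae_mono h => x hx /SI; exact: hx.
have m1 := toS _ (nt_mu hmu i1).
have m2 := toS _ (nt_mu hmu iF).
have m3 := toS _ (nt_mu hmu i2).
have m4 := toS _ (nt_leb hmu ih).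
have m5 := toS _ (nt_leb hmu j1).
have m0 := nt_singular mu mS SI S0.
have ma := ae_and m0 (ae_and m1 (ae_and m2 (ae_and m3 (ae_and m4 m5)))).
apply: ae_mono ma.
move=> x [hx [h1 [h2 [h3 [h4 h5]]]]] Sx al.
have [r1 r0] := hx Sx.
have {}h1 := h1 Sx al; have {}h2 := h2 Sx al; have {}h3 := h3 Sx al.
have {}h4 := h4 Sx al; have {}h5 := h5 Sx al.
rewrite r1 in h1; rewrite r1 in h2; rewrite r1 in h3; rewrite r0 in h4; rewrite r0 in h5.
rewrite !realC1 !mulr1 in h1; rewrite !realC1 !mulr1 in h2; rewrite !realC1 !mulr1 in h3.
rewrite !mulr0 in h4; rewrite !mulr0 in h5.
pose p := Pkap mu.
(* On [S] the densities are [r1 = 1] and [r0 = 0], so the constant of [T] disappears in the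
   limit. *)
have hT : (fun z => T z / p z) @ ntf x al --> (1 + (kap gam)%:C%C * 0 : CC).
  apply: (cvgC_near _ (f := fun z => pint mu (fun=> 1) z / p z + (kap gam)%:C%C * (pint leb (fun=> 1) z / p z))).
    apply: filterS (ntf_disc x al) => z z1.
    by rewrite pint_mu1 pint_leb1// /T mulrDl mul1r.
  by apply: cvgCD; [exact: h1|apply: cvgCM; [exact: cvgC_cst|exact: h5]].
rewrite mulr0 addr0 in hT.
have hD : (fun z => T z / p z * clarkG z - pint mu f z / p z) @ ntf x al --> (0 : CC).
  apply: cvgC_sqr0.
  (* The right-hand side of [clark_square] over the square of [p]. The quotients tend to [f], 1,
     [|f|^2] and 0; the last one because P[(|g_1|^2 + |g_2|^2) m] is negligible against [p] on
     [S]. *)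
  have lim : (fun z => (pint mu f z / p z) * (pint mu f z / p z)^* -
      T z / p z * (pint mu (fun t => (sqn (f t))%:C%C) z / p z - pint leb (hh g1 g2) z / p z)) @ ntf x al -->
      (f x * (f x)^* - 1 * ((sqn (f x))%:C%C - 0) : CC).
    apply: cvgCB; first by apply: cvgCM; [exact: h2|apply: cvgCJ; exact: h2].
    by apply: cvgCM; [exact: hT|apply: cvgCB; [exact: h3|exact: h4]].
  rewrite subr0 mul1r sqnE subrr in lim.
  apply: (cvgC_near _ _ lim).
  apply: filterS (filterI (ntf_disc x al) (ntf_neq0 x al)) => z [z1 z0].
  have p0 := Pkap_neq0 z1; have pJ := PkapJ z; rewrite -/p in p0 pJ.
  have cs := clark_square z1 z0.
  have -> : T z / p z * clarkG z - pint mu f z / p z = (T z * clarkG z - pint mu f z) / p z by field.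
  rewrite !(conjM, conjV) pJ.
  have -> : (T z * clarkG z - pint mu f z) / p z * ((T z * clarkG z - pint mu f z)^* / p z) =
     ((T z * clarkG z - pint mu f z) * (T z * clarkG z - pint mu f z)^*) / (p z * p z) by field.
  by rewrite cs; field.
have hTG : (fun z => T z / p z * clarkG z) @ ntf x al --> (0 + f x : CC).
  apply: (cvgC_near _ (f := fun z => (T z / p z * clarkG z - pint mu f z / p z) + pint mu f z / p z)).
    by apply: nearW => z; rewrite subrK.
  by apply: cvgCD; [exact: hD|exact: h2].
rewrite add0r in hTG.
have lim : (fun z => (T z / p z)^-1 * (T z / p z * clarkG z)) @ ntf x al --> (1^-1 * f x : CC).
  by apply: cvgCM; [apply: cvgCV; [exact: oner_neq0|exact: hT]|exact: hTG].
rewrite invr1 mul1r in lim; apply: (cvgC_near _ _ lim).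
apply: filterS (ntf_disc x al) => z z1.
rewrite mulrA mulVf ?mul1r// mulf_neq0 ?invr_neq0 ?Pkap_neq0//.
rewrite /T -realCD -nm_eq0 nm_real normr_eq0 gt_eqF// addr_gt0 ?kap_gt0//.
exact: Pmu_gt0.
Qed.

Let th0 := thetab mu 0.

Theorem clark_absolute : {ae leb, forall x, I0 x ->
  kk * (w x)%:C%C * f x =
    (1 - gam^* * th0 x) / (1 - th0 x) * g1 x +
    (1 - gam * (th0 x)^*) / (1 - (th0 x)^*) * gm mu gam g1 g2 x}.
Proof.
have z01 : nm 0 < 1 by rewrite nm0.
have iF := L2_L1 fmu hf; have j1 := L1_cst leb_I0_lty 1.
have [Lg1 Lg2] := K_L2 Kg; have hg1 : H2 g1 by case: Kg.
have i1 := L2_L1 leb_I0_lty Lg1.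
have Lgm : L2 leb (gm mu gam g1 g2).
  apply: L2D.
    apply: (L2_mulb (B := 1)) => // [|t]; first by apply: cmeasJ; exact: cmeas_thetab.
    by rewrite nmJ thetab_le.
  by apply: (L2_mulb (B := 1)) => // [|t]; [exact: cmeas_Deltab|exact: Deltab_le].
have ig := L2_L1 leb_I0_lty Lgm.
apply: ae_mono (ae_and (nt_absolute mS S0 mw w0 hw) (ae_and (kapm_leb (nt_mu hmu iF))
  (ae_and (kapm_leb (nt_leb hmu j1)) (ae_and (nt_pint_leb i1) (ae_and (nt_pint_leb ig)
  (ae_and (fatou (discA_theta hmu z01) (nm_theta hmu z01)) (thetab0_neq1 hmu))))))).
move=> x [hx [h2 [h3 [h4 [h5 [h6 h7]]]]]] Ix.
have [r1 r0] := hx Ix.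
have {}h2 := h2 Ix 0; have {}h3 := h3 Ix 0; have {}h4 := h4 Ix 0.
have {}h5 := h5 Ix 0; have {}h6 := h6 Ix 0; have {}h7 := h7 Ix.
pose p := Pkap mu; pose q : CC := (dens lebI (kapm mu) x)%:C%C.
have q0 : q != 0 by rewrite -nm_eq0 nm_real normr_eq0.
rewrite mul1r -/q in h3; rewrite r1 realCM -/q in h2.
(* P[f mu] is the quotient of two differentiated quotients: as P[m] = 1, [1 / p] tends to the
   density [q] of [m], which is nonzero at Lebesgue-a.e. point. *)
have hA : (fun z => pint mu f z) @ ntf x 0 --> (f x * ((w x)%:C%C * q) * q^-1 : CC).
  apply: (cvgC_near _ (f := fun z => (pint mu f z / p z) * (pint leb (fun=> 1) z / p z)^-1)).
    apply: filterS (ntf_disc x 0) => z z1; have p0 := Pkap_neq0 z1; rewrite -/p in p0.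
    by rewrite pint_leb1//; field.
  by apply: cvgCM; [exact: h2|apply: cvgCV; [exact: q0|exact: h3]].
have s0 : 1 - th0 x != 0 by exact: h7.
have sc0 : 1 - (th0 x)^* != 0 by have := s0; rewrite -nm_eq0 -nmJ conjB conj1 nm_eq0.
have ht : (fun z => 1 - theta mu 0 z) @ ntf x 0 --> (1 - th0 x : CC).
  by apply: cvgCB; [exact: cvgC_cst|exact: h6].
have hq : (fun z => (1 - gam^* * theta mu 0 z) / (1 - theta mu 0 z)) @ ntf x 0 -->
    ((1 - gam^* * th0 x) / (1 - th0 x) : CC).
  apply: cvgCM; last by apply: cvgCV; [exact: s0|exact: ht].
  by apply: cvgCB; [exact: cvgC_cst|apply: cvgCM; [exact: cvgC_cst|exact: h6]].
(* [R] is a Cauchy transform and may be unbounded; expressed through the bounded function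
   [theta_0 = 1 - 1 / R], [Q] inherits boundary values from Fatou's theorem. *)
have QE z : nm z < 1 -> Q z = (1 - gam^* * theta mu 0 z) / (1 - theta mu 0 z).
  move=> z1; have [R0 hT] := theta0_Rmu hmu z1.
  have -> : theta mu 0 z = 1 - (Rmu mu z)^-1 by rewrite -hT; ring.
  rewrite /Q /Qmu; have -> : 1 - (1 - (Rmu mu z)^-1) = (Rmu mu z)^-1 by ring.
  by field.
have c1 : (fun z => kk * pint mu f z) @ ntf x 0 --> (kk * (f x * ((w x)%:C%C * q) * q^-1) : CC).
  by apply: cvgCM; [exact: cvgC_cst|exact: hA].
have c2 : (fun z => kk * pint mu f z) @ ntf x 0 -->
   ((1 - gam^* * th0 x) / (1 - th0 x) * g1 x +
    ((1 - gam^* * th0 x) / (1 - th0 x))^* * gm mu gam g1 g2 x : CC).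
  apply: (cvgC_near _ (f := fun z => (1 - gam^* * theta mu 0 z) / (1 - theta mu 0 z) * pint leb g1 z +
     ((1 - gam^* * theta mu 0 z) / (1 - theta mu 0 z))^* * pint leb (gm mu gam g1 g2) z)).
    apply: filterS (filterI (ntf_disc x 0) (ntf_neq0 x 0)) => z [z1 z0].
    by rewrite -!QE// (clark_poisson hmu hgam hPhi hf Kg adj z1 z0) ec_pint// cauchy_pint_H2.
  apply: cvgCD; first by apply: cvgCM; [exact: hq|exact: h4].
  by apply: cvgCM; [apply: cvgCJ; exact: hq|exact: h5].
have := cvgC_unique _ c1 c2.
have -> : ((1 - gam^* * th0 x) / (1 - th0 x))^* = (1 - gam * (th0 x)^*) / (1 - (th0 x)^*).
  by rewrite !(conjM, conjB, conjV, conj1, conjK).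
move=> <-; by field.
Qed.
End main.

Unset Implicit Arguments.

Theorem theorem4p4
  (mu : probability MR RR) (gam : CC)
  (* mu is a Borel probability measure on T = e([0,1)) *)
  (hmuT : mu I0 = 1%E)
  (hgam : `|gam| < 1)
  (* mu is not normalized Lebesgue measure *)
  (hnotleb : ~ (forall A, measurable A -> mu A = leb (A `&` I0)))
  (* Lebesgue decomposition: mu_s = mu|_S, mu_a = mu|_(T\S), w = d mu_a / dm *)
  (S : set RR) (mS : measurable S) (hSI : S `<=` I0) (hSnull : leb S = 0%E)
  (hac : forall A, measurable A -> leb A = 0%E -> mu (A `\` S) = 0%E)
  (w : RR -> RR) (mw : measurable_fun I0 w) (w0 : forall x, 0 <= w x)
  (hw : forall A, measurable A -> A `<=` I0 ->
          mu (A `\` S) = (\int[leb]_(x in A) (w x)%:E)%E)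
  (f : RR -> CC) (hf : L2 mu f)
  (* f_a = d(f mu)_a / d mu_a and f_s = d(f mu)_s / d mu_s *)
  (fa fs : RR -> CC) (mfa : cmeas fa) (mfs : cmeas fs)
  (hfa : forall A, measurable A -> A `<=` I0 ->
          mu.-integrable (A `\` S) (fun x => (complex.Re (fa x))%:E) /\
          mu.-integrable (A `\` S) (fun x => (complex.Im (fa x))%:E) /\
          cint mu (A `\` S) fa = cint mu (A `\` S) f)
  (hfs : forall A, measurable A -> A `<=` I0 ->
          mu.-integrable (A `&` S) (fun x => (complex.Re (fs x))%:E) /\
          mu.-integrable (A `&` S) (fun x => (complex.Im (fs x))%:E) /\
          cint mu (A `&` S) fs = cint mu (A `&` S) f)
  (* Phi_gamma is the Clark operator, (g1, g2) = Phi_gamma^* f *)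
  (Phi : (RR -> CC) * (RR -> CC) -> (RR -> CC)) (hPhi : IsClark mu gam Phi)
  (g1 g2 : RR -> CC) (hg : IsAdj mu gam Phi f (g1, g2)) :
  (* (1) *)
  {ae mu, forall x, S x ->
     ntlim (fun z => (1 - gam^*) / (Num.sqrt (1 - sqn gam))%:C%C * hext g1 z)
           (ee x) (fs x)} /\
  (* (2) *)
  {ae leb, forall x, I0 x ->
     (Num.sqrt (1 - sqn gam))%:C%C * (w x)%:C%C * fa x =
       (1 - gam^* * thetab mu 0 x) / (1 - thetab mu 0 x) * g1 x
     + (1 - gam * (thetab mu 0 x)^*) / (1 - (thetab mu 0 x)^*)
       * ((thetab mu gam x)^* * g1 x + Deltab mu gam x * g2 x)}.
Proof.
rewrite nm_lt1_norm in hgam.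
have fmu : (mu I0 < +oo)%E by rewrite hmuT ltry.
have iF := L2_L1 fmu hf; have [Kg adj] := hg.
have mIS : measurable (I0 `\` S : set MR) by exact: measurableD.
have eqs : {ae mu, forall x, S x -> fs x = f x}.
  apply: (cint_ae_eq mS hSI iF) => E mE ES.
  have EI : E `<=` I0 by move=> t /ES /hSI.
  have [a [b c]] := hfs E mE EI.
  have EE : E `&` S = E by exact/setIidPl.
  by rewrite EE in a b c; split.
have eqa : {ae mu, forall x, (I0 `\` S) x -> fa x = f x}.
  apply: (cint_ae_eq mIS _ iF) => [t []//|E mE ES].
  have EI : E `<=` I0 by move=> t /ES[].
  have [a [b c]] := hfa E mE EI.
  have EE : E `\` S = E.
    by apply/setDidPl; apply/seteqP; split=> t // -[Et St]; have [] := ES t Et.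
  by rewrite EE in a b c; split.
(* [fa = f] holds [mu]-a.e. off [S], which says nothing about Lebesgue measure where [w] vanishes.
   On the part of the exceptional set off [S], [w] has integral 0, hence is 0 Lebesgue-a.e., so the
   products with [w] agree. *)
have eqw : {ae leb, forall x, I0 x -> (w x)%:C%C * fa x = (w x)%:C%C * f x}.
  have [B [mB B0 HB]] := eqa.
  pose C : set MR := (B `&` I0) `\` S.
  have mC : measurable C by apply: measurableD => //; exact: measurableI.
  have CI : C `<=` I0 by move=> t [[]].
  have C0 : (\int[leb]_(x in C) (w x)%:E = 0)%E.
    rewrite -hw//; apply: (subset_measure0 (B := B)) => //; first exact: measurableD.
    by move=> t [[[]]].
  have mwC : measurable_fun C (fun x => (w x)%:E).
    by apply/measurable_EFinP; apply: measurable_funS mw.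
  have h0 : (\int[leb]_(x in C) `|(w x)%:E| = 0)%E.
    by under eq_integral do rewrite gee0_abs ?lee_fin//.
  have wC : {ae leb, forall x, C x -> w x = 0}.
    have := (ae_eq_integral_abs (@lebesgue_measure RR) mC mwC).1 h0.
    by apply: ae_mono => x h Cx; have [] := h Cx.
  have nS : {ae leb, forall x, I0 x -> ~ S x}.
    exists S; split => //; move=> x /= nx; apply: contrapT => nS; exact: nx.
  apply: ae_mono (ae_and wC nS) => x [hx hS] Ix.
  have [Bx|nB] := pselect (B x).
    have -> : w x = 0 by apply: hx; split => //; exact: hS.
    by rewrite !mul0r.
  suff -> : fa x = f x by [].
  by apply: contrapT => h; apply: nB; apply: HB => h2; apply: h; apply: h2; split => //; exact: hS.
split.
  have := clark_singular hmuT hgam hPhi hf Kg adj mS hSI hSnull.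
  move=> h; apply: ae_mono (ae_and h eqs) => x [hx ex] Sx.
  apply: ntlim_ntf => al; rewrite ex//.
  have -> : (fun z => (1 - gam^*) / (Num.sqrt (1 - sqn gam))%:C%C * hext g1 z) = clarkG gam g1.
    by apply/funext => z; rewrite /clarkG; congr (_ * _); exact: hextE.
  exact: hx.
have := clark_absolute hmuT hgam hPhi hf Kg adj mS hSnull mw w0 hw.
move=> h; apply: ae_mono (ae_and h eqw) => x [hx ex] Ix.
by rewrite -mulrA ex// mulrA hx.
Qed.
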